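(* Let $K$ be a compact set in $\mathbb{R}^3$, and let $\omega\subset\mathbb{R}^3$ be a bounded open convex set containing $K$. A point $p\in\omega$ belongs to the minimal hull $\widehat K_{\mathfrak M}$ of $K$ if and only if there exists a sequence of conformal minimal discs $f_j\colon\overline{\mathbb D}\to\omega$ such that for all $j=1,2,\ldots$ we have $f_j(0)=p$ and $$\big|\{t\in[0,2\pi]:\ \mathrm{dist}(f_j(e^{it}),K)<1/j\}\big|\ \ge\ 2\pi-\frac1j .$$
   Context: $\mathbb D=\{\zeta\in\mathbb C:|\zeta|<1\}$, $\overline{\mathbb D}$ is its closure, and $|I|$ denotes the Lebesgue measure of a set $I\subset\mathbb R$. Subharmonic functions are allowed to be identically $-\infty$. An upper semicontinuous function $u\colon\omega\to\mathbb R\cup\{-\infty\}$ on a domain $\omega\subset\mathbb R^n$ ($n\ge3$) is minimal plurisubharmonic if the restriction of $u$ to any affine $2$-dimensional plane $L\subset\mathbb R^n$ is subharmonic on $L\cap\omega$ in any isothermal linear coordinates on $L$ (coordinates $(y_1,y_2)$ given by $x=a+y_1v_1+y_2v_2$ with $a\in L$ and $v_1,v_2$ orthogonal of equal nonzero length). The set of all such functions is $\mathfrak M\mathrm{Psh}(\omega)$. The minimal hull of a compact set $K\subset\mathbb R^n$ is $\widehat K_{\mathfrak M}=\{x\in\mathbb R^n: u(x)\le\sup_K u\ \ \forall u\in\mathfrak M\mathrm{Psh}(\mathbb R^n)\}$. A conformal minimal disc $f\colon\overline{\mathbb D}\to\omega$ is a $\mathscr C^1$ immersion of $\overline{\mathbb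 D}$ with values in $\omega$ which is conformal (with $\zeta=x+iy$: $|f_x|=|f_y|$ and $f_x\cdot f_y=0$) and harmonic on $\mathbb D$. *)

(* Defs.v *)
From HB Require Import structures.
From mathcomp Require Import all_boot all_order all_algebra.
From mathcomp Require Import all_classical all_reals all_analysis.

Set Implicit Arguments.
Unset Strict Implicit.
Unset Printing Implicit Defensive.

Import Order.TTheory GRing.Theory Num.Theory.
Import numFieldNormedType.Exports.

Local Open Scope classical_set_scope.
Local Open Scope ring_scope.

(* The library norm on 'rV[R]_n is the sup norm: it gives the usual topology and
   the usual bounded sets, but angles, lengths and distances in R^n are
   Euclidean and go through dotv. *)
Definition dotv (R : realType) (n : nat) (x y : 'rV[R]_n) : R :=
  \sum_(i < n) x ord0 i * y ord0 i.

Definition enorm (R : realType) (n : nat) (x : 'rV[R]_n) : R :=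
  Num.sqrt (dotv x x).

(* With values in \bar R, so that the distance to the empty set is +oo. *)
Definition edist_set (R : realType) (n : nat) (x : 'rV[R]_n)
    (K : set 'rV[R]_n) : \bar R :=
  ereal_inf [set (enorm (x - y))%:E | y in K].

(* The plane, and the complex line, is R * R, with zeta = x + iy read as the
   pair (x, y). *)
Definition cdisc (R : realType) (c : R * R) (r : R) : set (R * R) :=
  [set z | (z.1 - c.1) ^+ 2 + (z.2 - c.2) ^+ 2 <= r ^+ 2].

Definition unit_disc (R : realType) : set (R * R) :=
  [set z | z.1 ^+ 2 + z.2 ^+ 2 < 1].

Definition closed_unit_disc (R : realType) : set (R * R) :=
  [set z | z.1 ^+ 2 + z.2 ^+ 2 <= 1].

(* c + r e^{it} *)
Definition circle_pt (R : realType) (c : R * R) (r t : R) : R * R :=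
  (c.1 + r * cos t, c.2 + r * sin t).

(* An upper semicontinuous function A -> R u {-oo}; only the values of u on A
   matter. *)
Definition usc_on (R : realType) (T : topologicalType) (A : set T)
    (u : T -> \bar R) : Prop :=
  (forall x, A x -> u x != +oo%E) /\
  (forall x, A x -> forall b : R, (u x < b%:E)%E ->
     \forall y \near within A (nbhs x), (u y < b%:E)%E).

(* The integral makes sense in [-oo, +oo[, as u is bounded above on the circle
   by upper semicontinuity; u = -oo is allowed. *)
Definition subharmonic_on (R : realType) (A : set (R * R))
    (u : R * R -> \bar R) : Prop :=
  usc_on A u /\
  forall (c : R * R) (r : R), 0 < r -> cdisc c r `<=` A ->
    (u c <= ((2 * pi)^-1)%:E *
       \int[lebesgue_measure]_(t in `[0%R, (2 * pi)%R]) u (circle_pt c r t))%E.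

Definition plane_pt (R : realType) (n : nat) (a v1 v2 : 'rV[R]_n)
    (y : R * R) : 'rV[R]_n :=
  a + y.1 *: v1 + y.2 *: v2.

Definition isothermal (R : realType) (n : nat) (v1 v2 : 'rV[R]_n) : Prop :=
  [/\ dotv v1 v2 = 0, enorm v1 = enorm v2 & enorm v1 != 0].

Definition minimal_psh (R : realType) (n : nat) (omega : set 'rV[R]_n)
    (u : 'rV[R]_n -> \bar R) : Prop :=
  usc_on omega u /\
  forall a v1 v2 : 'rV[R]_n, isothermal v1 v2 ->
    subharmonic_on (plane_pt a v1 v2 @^-1` omega) (u \o plane_pt a v1 v2).

Definition minimal_hull (R : realType) (n : nat) (K : set 'rV[R]_n) :
    set 'rV[R]_n :=
  [set x | forall u : 'rV[R]_n -> \bar R, minimal_psh setT u ->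
     (u x <= ereal_sup (u @` K))%E].

Definition partial_x (R : realType) (n : nat) (f : R * R -> 'rV[R]_n)
    (z : R * R) : 'rV[R]_n := 'D_((1, 0) : R * R) f z.

Definition partial_y (R : realType) (n : nat) (f : R * R -> 'rV[R]_n)
    (z : R * R) : 'rV[R]_n := 'D_((0, 1) : R * R) f z.

(* For A open. *)
Definition C1_on (R : realType) (n : nat) (A : set (R * R))
    (f : R * R -> 'rV[R]_n) : Prop :=
  forall z, A z -> [/\ differentiable f z,
    {for z, continuous (partial_x f)} & {for z, continuous (partial_y f)}].

(* For A open. *)
Definition harmonic_on (R : realType) (n : nat) (A : set (R * R))
    (f : R * R -> 'rV[R]_n) : Prop :=
  [/\ C1_on A f, C1_on A (partial_x f), C1_on A (partial_y f) &
    forall z, A z ->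
      partial_x (partial_x f) z + partial_y (partial_y f) z = 0].

Definition conformal_on (R : realType) (n : nat) (A : set (R * R))
    (f : R * R -> 'rV[R]_n) : Prop :=
  forall z, A z -> enorm (partial_x f z) = enorm (partial_y f z) /\
    dotv (partial_x f z) (partial_y f z) = 0.

(* C^1 on the closed disc means that f extends to a C^1 map F on a neighbourhood;
   the differential of F at a point of the closed disc, boundary included, does
   not depend on the choice of F. *)
Definition C1_immersion_closed_disc (R : realType) (n : nat)
    (f : R * R -> 'rV[R]_n) : Prop :=
  exists (U : set (R * R)) (F : R * R -> 'rV[R]_n),
    [/\ open U, @closed_unit_disc R `<=` U, C1_on U F,
        forall z, closed_unit_disc z -> F z = f z &
        forall z, closed_unit_disc z -> injective ('d F z)].

(* Only the values of f on the closed disc matter. *)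
Definition conformal_minimal_disc (R : realType) (n : nat)
    (omega : set 'rV[R]_n) (f : R * R -> 'rV[R]_n) : Prop :=
  [/\ f @` @closed_unit_disc R `<=` omega,
      C1_immersion_closed_disc f,
      conformal_on (@unit_disc R) f &
      harmonic_on (@unit_disc R) f].

(* Main.v *)
(* If p lies in the hull, consider, for a Lipschitz Phi vanishing exactly on K and
   with values in [0, 1], the infimum v(x) of the circle means of Phi o f over
   the discs f in omega centred at x that are real parts of primitives of
   polynomial null curves, written with spinors (a, b) as
   (a^2 - b^2, i (a^2 + b^2), 2ab). A Riemann-Hilbert deformation, which attaches
   small planar null discs along an arc of the boundary by perturbing the spinor,
   shows that v satisfies the mean value inequality on conformal circles.
   Taking the maximum with a convex function that vanishes on K and p and is large
   off omega extends v to a minimal plurisubharmonic function on R^3 vanishing on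
   K, hence nonpositive at p: some disc through p has small mean of Phi, that is,
   most of its boundary lies close to K.

   Conversely, let f be a disc whose boundary is close to K off a small set. An
   upper semicontinuous minimal plurisubharmonic u satisfies a viscosity form of
   the maximum principle along f: if u o f is bounded on the circle by a harmonic
   function, then it is so at the centre. A constant close to sup_K u plus a small
   combination of Poisson kernels, with poles just outside the bad arcs, is such
   a majorant. *)

Require Import Defs.
From HB Require Import structures.
From mathcomp Require Import all_boot all_order all_algebra.
From mathcomp Require Import all_classical all_reals all_analysis measurable_realfun.
From mathcomp Require Import complex ring lra zify.

Set Implicit Arguments.
Unset Strict Implicit.
Unset Printing Implicit Defensive.

Import Order.TTheory GRing.Theory Num.Theory.
Import numFieldNormedType.Exports.

Local Open Scope classical_set_scope.
Local Open Scope ring_scope.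

(** * Complex numbers and polynomials *)

(** The obstacle is nonlinearity: null curves do not add, so a disc cannot be deformed by adding to
    it the discs to be attached. Spinors do add, and a rapidly oscillating increment of the spinor
    contributes its square, again a null curve, while the cross term is averaged out by integration.
    Staying with polynomials makes primitives single-valued, boundary regularity automatic and every
    estimate a matter of coefficients. Convexity of omega supplies the small homotheties that carry
    a nearly optimal disc from one centre to another; they also make the envelope continuous. Zeros
    common to both spinor components would be branch points; a last constant perturbation removes
    them. In the converse direction u is merely upper semicontinuous and its mean value inequality
    is given on planes only. Hence u and the disc get separate variables, tied together by a
    quadratic penalty, and the inequality is used on a plane parallel to a tangent plane of the
    disc. *)

Section ComplexModulus.
Context {R : realType}.
Local Notation C := (R[i]).

Definition cmod (z : C) : R := Normc.normc z.
Arguments cmod : simpl never.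

Lemma cmodM (z w : C) : cmod (z * w) = cmod z * cmod w.
Proof. exact: Normc.normcM. Qed.

Lemma cmodD (z w : C) : cmod (z + w) <= cmod z + cmod w.
Proof. exact: le_normcD. Qed.

Lemma cmodN (z : C) : cmod (- z) = cmod z.
Proof. exact: normcN. Qed.

Lemma cmod0 : cmod 0 = 0. Proof. exact: Normc.normc0. Qed.
Lemma cmod1 : cmod 1 = 1. Proof. exact: Normc.normc1. Qed.

Lemma cmodX (z : C) n : cmod (z ^+ n) = cmod z ^+ n.
Proof. by elim: n => [|n IH]; rewrite ?expr0 ?cmod1// !exprS cmodM IH. Qed.

Lemma cmodV (z : C) : cmod z^-1 = (cmod z)^-1.
Proof. exact: Normc.normcV. Qed.

Lemma cmodBC (z w : C) : cmod (z - w) = cmod (w - z).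
Proof. by rewrite -cmodN opprB. Qed.

Lemma cmodE (x y : R) : cmod (x +i* y)%C = Num.sqrt (x ^+ 2 + y ^+ 2).
Proof. by []. Qed.

Lemma sqr_cmod (z : C) : cmod z ^+ 2 = complex.Re z ^+ 2 + complex.Im z ^+ 2.
Proof. by case: z => x y; rewrite cmodE sqr_sqrtr//= addr_ge0// sqr_ge0. Qed.

Lemma cmod_ge0 (z : C) : 0 <= cmod z.
Proof. by case: z => x y; rewrite cmodE sqrtr_ge0. Qed.

Lemma cmod_eq0 (z : C) : (cmod z == 0) = (z == 0).
Proof.
by apply/eqP/eqP => [/Normc.eq0_normc|->]//; rewrite cmod0.
Qed.

Lemma cmod_real (x : R) : cmod (x%:C)%C = `|x|.
Proof. by rewrite cmodE expr0n addr0 sqrtr_sqr. Qed.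

Lemma cmod_nat n : cmod n%:R = n%:R.
Proof.
have -> : n%:R = ((n%:R : R)%:C)%C :> C by rewrite (rmorph_nat (real_complex R)).
by rewrite cmod_real ger0_norm.
Qed.

Lemma ler_Re_cmod (z : C) : `|complex.Re z| <= cmod z.
Proof.
case: z => x y; rewrite cmodE /= -sqrtr_sqr ler_wsqrtr//.
by rewrite lerDl sqr_ge0.
Qed.

Lemma ler_Im_cmod (z : C) : `|complex.Im z| <= cmod z.
Proof.
case: z => x y; rewrite cmodE /= -sqrtr_sqr ler_wsqrtr//.
by rewrite lerDr sqr_ge0.
Qed.

Lemma cReD (z w : C) : complex.Re (z + w) = complex.Re z + complex.Re w.
Proof. by case: z w => ? ? []. Qed.
Lemma cImD (z w : C) : complex.Im (z + w) = complex.Im z + complex.Im w.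
Proof. by case: z w => ? ? []. Qed.
Lemma cReN (z : C) : complex.Re (- z) = - complex.Re z.
Proof. by case: z. Qed.
Lemma cImN (z : C) : complex.Im (- z) = - complex.Im z.
Proof. by case: z. Qed.
Lemma cReM (z w : C) : complex.Re (z * w) =
  complex.Re z * complex.Re w - complex.Im z * complex.Im w.
Proof. by case: z w => ? ? []. Qed.
Lemma cImM (z w : C) : complex.Im (z * w) =
  complex.Re z * complex.Im w + complex.Im z * complex.Re w.
Proof. by case: z w => ? ? [] *; rewrite /= addrC. Qed.

Lemma complex_eq (z w : C) : complex.Re z = complex.Re w ->
  complex.Im z = complex.Im w -> z = w.
Proof. by case: z w => ? ? [? ?] /= -> ->. Qed.

Definition expi (t : R) : C := (cos t +i* sin t)%C.

Lemma cmod_expi t : cmod (expi t) = 1.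
Proof. by rewrite cmodE cos2Dsin2 sqrtr1. Qed.

Lemma expiD s t : expi (s + t) = expi s * expi t.
Proof.
by apply: complex_eq; rewrite ?cReM ?cImM /= ?cosD ?sinD//; ring.
Qed.

Lemma expi0 : expi 0 = 1.
Proof. by rewrite /expi cos0 sin0. Qed.

Lemma expiX t n : expi t ^+ n = expi (t *+ n).
Proof.
by elim: n => [|n IH]; rewrite ?expr0 ?mulr0n ?expi0// exprS mulrS expiD IH.
Qed.

Lemma expi_sum2pi t : expi (t + 2 * pi) = expi t.
Proof.
by rewrite mulr_natl /expi cosD2pi sinD2pi.
Qed.

Lemma expi_surj (u : C) : cmod u = 1 ->
  exists2 t, 0 <= t <= 2 * pi & u = expi t.
Proof.
case: u => x y; move=> /(congr1 (fun z => z ^+ 2)); rewrite sqr_cmod /= expr1n => xy.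
have y2 : y ^+ 2 = 1 - x ^+ 2 by rewrite -xy; ring.
have x1 : -1 <= x <= 1.
  by rewrite -ler_norml -(expr_le1 (n := 2))// real_normK ?num_real// -xy lerDl sqr_ge0.
have xi : x \in `[(-1), 1] by rewrite in_itv.
have sa : sin (acos x) = `|y| by rewrite sin_acos// -y2 sqrtr_sqr.
have a0 := acos_ge0 x1; have ap := acos_lepi x1.
have [y0|y0] := leP 0 y.
  exists (acos x); first by apply/andP; split => //; have := pi_gt0 R; lra.
  by rewrite /expi acosK// sa ger0_norm.
exists (2 * pi - acos x); first by apply/andP; split; have := pi_gt0 R; lra.
rewrite /expi addrC mulr_natl cosD2pi sinD2pi cosN sinN acosK// sa.
by rewrite ltr0_norm// opprK.
Qed.

Lemma polar (z : C) : exists2 t, 0 <= t <= 2 * pi & z = (cmod z)%:C%C * expi t.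
Proof.
have [->|z0] := eqVneq z 0.
  exists 0; last by rewrite cmod0 mul0r.
  by rewrite lexx mulr_ge0// pi_ge0.
have cz0 : cmod z != 0 by rewrite cmod_eq0.
have C0 : (cmod z)%:C%C != 0 :> C.
  by apply: contra cz0 => /eqP[->].
have [|t t2 tE] := @expi_surj (z / (cmod z)%:C%C).
  by rewrite cmodM cmodV cmod_real ger0_norm ?cmod_ge0// divff.
by exists t => //; rewrite -tE mulrC divfK.
Qed.

Definition sqrtC' (z : C) : C := sqrtc z.
Lemma sqrtC'K z : sqrtC' z ^+ 2 = z. Proof. exact: sqr_sqrtc. Qed.

End ComplexModulus.
#[global] Arguments cmod : simpl never.

(** * Coefficient norm and primitives of polynomials *)

Section PolyNorm.
Context {R : realType}.
Local Notation C := (R[i]).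
Implicit Types p q : {poly C}.

(** The Wiener algebra norm: it dominates the supremum over the closed unit disc, is
    submultiplicative, and detects directly what integration gains on high powers of 'X. *)
Definition nrm1 p : R := \sum_(i < size p) cmod p`_i.

Lemma nrm1_wide p n : (size p <= n)%N -> nrm1 p = \sum_(i < n) cmod p`_i.
Proof.
move=> pn; rewrite /nrm1 (big_ord_widen n (fun i => cmod p`_i) pn) big_mkcond /=.
apply: eq_bigr => i _; case: ltnP => // /(nth_default 0) ->.
by rewrite cmod0.
Qed.

Lemma nrm1_ge0 p : 0 <= nrm1 p.
Proof. by apply: sumr_ge0 => i _; exact: cmod_ge0. Qed.

Lemma nrm1D p q : nrm1 (p + q) <= nrm1 p + nrm1 q.
Proof.
pose n := maxn (size p) (size q).
rewrite (@nrm1_wide (p + q) n); last exact: size_polyD.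
rewrite (@nrm1_wide p n) ?leq_maxl// (@nrm1_wide q n) ?leq_maxr//.
by rewrite -big_split /=; apply: ler_sum => i _; rewrite coefD cmodD.
Qed.

Lemma nrm1Z a p : nrm1 (a *: p) = cmod a * nrm1 p.
Proof.
rewrite (@nrm1_wide (a *: p) (size p)); last exact: size_scale_leq.
by rewrite mulr_sumr; apply: eq_bigr => i _; rewrite coefZ cmodM.
Qed.

Lemma nrm1N p : nrm1 (- p) = nrm1 p.
Proof. by rewrite -scaleN1r nrm1Z cmodN cmod1 mul1r. Qed.

Lemma nrm1B p q : nrm1 (p - q) <= nrm1 p + nrm1 q.
Proof. by rewrite -(nrm1N q) nrm1D. Qed.

Lemma nrm1C c : nrm1 c%:P = cmod c.
Proof.
rewrite (@nrm1_wide _ 1) ?size_polyC ?leq_b1// big_ord1 coefC eqxx//.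
Qed.

Lemma nrm1MX p : nrm1 (p * 'X) = nrm1 p.
Proof.
rewrite (@nrm1_wide _ (size p).+1).
  rewrite big_ord_recl coefMX /= cmod0 add0r.
  by apply: eq_bigr => i _; rewrite coefMX.
by apply: leq_trans (size_polyMleq _ _) _; rewrite size_polyX addn2.
Qed.

Lemma nrm1MXn p n : nrm1 (p * 'X^n) = nrm1 p.
Proof.
by elim: n => [|n IH]; rewrite ?expr0 ?mulr1// exprSr mulrA nrm1MX.
Qed.

Lemma nrm1M p q : nrm1 (p * q) <= nrm1 p * nrm1 q.
Proof.
have nMX (r : {poly C}) c : nrm1 (r * 'X + c%:P) = nrm1 r + cmod c.
  rewrite (@nrm1_wide _ (size r).+1); last first.
    rewrite -cons_poly_def size_cons_poly; case: ifP => // _.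
  rewrite big_ord_recl -cons_poly_def coef_cons /= addrC.
  by congr (_ + _); apply: eq_bigr => i _; rewrite coef_cons.
elim/poly_ind: p => [|p c IH].
  by rewrite mul0r {1}/nrm1 size_poly0 big_ord0 mulr_ge0// nrm1_ge0.
rewrite mulrDl nMX mulrDl mulrAC mul_polyC.
apply: (le_trans (nrm1D _ _)).
by rewrite nrm1MX nrm1Z lerD2r.
Qed.

Lemma nrm1_expn p n : nrm1 (p ^+ n) <= nrm1 p ^+ n.
Proof.
elim: n => [|n IH]; first by rewrite !expr0 nrm1C cmod1.
rewrite !exprS; apply: (le_trans (nrm1M _ _)).
by rewrite ler_wpM2l// nrm1_ge0.
Qed.

Lemma horner_le_nrm1 p z : cmod z <= 1 -> cmod p.[z] <= nrm1 p.
Proof.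
move=> z1; rewrite horner_coef /nrm1.
apply: (@le_trans _ _ (\sum_(i < size p) cmod (p`_i * z ^+ i))).
  apply: (big_ind2 (fun a b => cmod a <= b)) => [|a b c d ab cd|//].
    by rewrite cmod0.
  by apply: (le_trans (cmodD _ _)); exact: lerD.
apply: ler_sum => i _; rewrite cmodM cmodX ler_piMr ?cmod_ge0//.
by rewrite exprn_ile1// cmod_ge0.
Qed.

(** The bound depends on q through its norm only; this makes the deformation estimates uniform in
    the frequency k and the phase u. *)
Lemma nrm1_comp p B : 0 <= B ->
  exists2 K, 0 <= K & forall q, nrm1 q <= B -> nrm1 (p \Po q) <= K.
Proof.
move=> B0; elim/poly_ind: p => [|p c [K K0 IH]].
  by exists 0 => // q _; rewrite comp_poly0 nrm1C cmod0.
exists (K * B + cmod c); first by rewrite addr_ge0 ?mulr_ge0 ?cmod_ge0.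
move=> q qB; rewrite comp_polyD comp_polyM comp_polyX comp_polyC.
apply: (le_trans (nrm1D _ _)); rewrite nrm1C lerD2r.
apply: (le_trans (nrm1M _ _)).
by apply: ler_pM; rewrite ?nrm1_ge0//; exact: IH.
Qed.

Lemma horner_lipschitz p B : 0 <= B ->
  exists2 L, 0 <= L & forall z w, cmod z <= B ->
  cmod w <= B -> cmod (p.[z] - p.[w]) <= L * cmod (z - w).
Proof.
(* The induction also carries a bound M on the values, because the difference of p.[z] * z splits by
   the product rule. *)
move=> B0; suff [L [M [L0 M0 hL hM]]] : exists L M, [/\ 0 <= L, 0 <= M,
    forall z w, cmod z <= B -> cmod w <= B ->
      cmod (p.[z] - p.[w]) <= L * cmod (z - w) &
    forall z, cmod z <= B -> cmod p.[z] <= M] by exists L.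
elim/poly_ind: p => [|p c [L [M [L0 M0 hL hM]]]].
  exists 0, 0; split => // [z w _ _|z _]; first by rewrite !horner0 subr0 cmod0 mul0r.
  by rewrite horner0 cmod0.
exists (L * B + M), (M * B + cmod c); split.
- by rewrite addr_ge0 ?mulr_ge0.
- by rewrite addr_ge0 ?mulr_ge0 ?cmod_ge0.
- move=> z w zB wB; rewrite !hornerE.
  have -> : p.[z] * z + c - (p.[w] * w + c) =
    (p.[z] - p.[w]) * z + p.[w] * (z - w) by ring.
  apply: (le_trans (cmodD _ _)); rewrite (mulrDl (L * B)) !cmodM; apply: lerD.
    by rewrite mulrAC; apply: ler_pM; rewrite ?cmod_ge0//; exact: hL.
  by rewrite ler_wpM2r ?cmod_ge0// hM.
- move=> z zB; rewrite !hornerE; apply: (le_trans (cmodD _ _)).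
  by rewrite lerD2r cmodM; apply: ler_pM; rewrite ?cmod_ge0//; exact: hM.
Qed.

Definition prim p : {poly C} :=
  \poly_(i < (size p).+1) (if i is j.+1 then p`_j / j.+1%:R else 0).

Lemma coef_prim p i : (prim p)`_i = if i is j.+1 then p`_j / j.+1%:R else 0.
Proof.
rewrite coef_poly; case: i => [|i]//; rewrite ltnS; case: ltnP => // pi.
by rewrite nth_default// mul0r.
Qed.

Lemma primB p q : prim (p - q) = prim p - prim q.
Proof.
by apply/polyP => -[|i]; rewrite coefB !coef_prim ?subr0// coefB mulrBl.
Qed.

Lemma primZ a p : prim (a *: p) = a *: prim p.
Proof.
by apply/polyP => -[|i]; rewrite coefZ !coef_prim ?mulr0// coefZ mulrA.
Qed.

Lemma deriv_prim p : (prim p)^`() = p.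
Proof.
by apply/polyP => i; rewrite coef_deriv coef_prim -[_ *+ _]mulr_natr divfK.
Qed.

Lemma horner_prim0 p : (prim p).[0] = 0.
Proof. by rewrite horner_coef0 coef_prim. Qed.

Lemma prim_deriv p : p.[0] = 0 -> prim p^`() = p.
Proof.
rewrite horner_coef0 => p0; apply/polyP => -[|i]; rewrite coef_prim ?p0//.
by rewrite coef_deriv -[_ *+ _]mulr_natr mulfK.
Qed.

(** Every monomial of p * 'X^n has degree at least n, so integration divides its coefficient by at
    least n + 1. This gain is what suppresses the cross terms. *)
Lemma nrm1_primMXn p n : nrm1 (prim (p * 'X^n)) <= nrm1 p / n.+1%:R.
Proof.
set q := p * 'X^n.
have sq : (size (prim q) <= (size p + n).+1)%N.
  apply: leq_trans (size_poly _ _) _; rewrite ltnS.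
  by apply: leq_trans (size_polyMleq _ _) _; rewrite size_polyXn addnS.
rewrite (nrm1_wide sq) big_ord_recl coef_prim cmod0 add0r.
rewrite -(@nrm1MXn p n) (@nrm1_wide (p * 'X^n) (size p + n)); last first.
  by apply: leq_trans (size_polyMleq _ _) _; rewrite size_polyXn addnS.
rewrite mulr_suml; apply: ler_sum => i _ /=; rewrite coef_prim cmodM cmodV cmod_nat.
rewrite /q coefMXn; case: ltnP => [_|ni]; first by rewrite cmod0 !mul0r.
by rewrite ler_wpM2l ?cmod_ge0// lef_pV2 ?posrE ?ltr0n// ler_nat.
Qed.

End PolyNorm.

(** * Null discs and their Riemann-Hilbert deformations *)

Section NullDisc.
Context {R : realType}.
Local Notation C := (R[i]).
Local Notation spinor := ({poly C} * {poly C})%type.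
Implicit Types (s : spinor) (p q g : {poly C}).

(* The spinor parametrisation of the null quadric z0^2 + z1^2 + z2^2 = 0, in
   polarised form. *)
Definition nullb s1 s2 (i : 'I_3) : {poly C} :=
  if val i == 0%N then s1.1 * s2.1 - s1.2 * s2.2
  else if val i == 1%N then 'i%C *: (s1.1 * s2.1 + s1.2 * s2.2)
  else s1.1 * s2.2 + s1.2 * s2.1.

Definition nullp s := nullb s s.

(** The Weierstrass representation: the real part of a primitive of a null curve is harmonic and
    conformal. The primitive vanishes at 0, so the centre is exactly c. *)
Definition disc (c : 'rV[R]_3) s (z : C) : 'rV[R]_3 :=
  \row_i (c ord0 i + complex.Re (prim (nullp s i)).[z]).

Lemma nullbDr s1 s2 s3 i :
  nullb s1 (s2.1 + s3.1, s2.2 + s3.2) i = nullb s1 s2 i + nullb s1 s3 i.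
Proof.
rewrite /nullb /=; case: ifP => _; first by ring.
by case: ifP => _; [rewrite -scalerDr; congr (_ *: _); ring|ring].
Qed.

Lemma nullbC s1 s2 i : nullb s1 s2 i = nullb s2 s1 i.
Proof.
rewrite /nullb /=; case: ifP => _; first by ring.
by case: ifP => _; [congr (_ *: _); ring|ring].
Qed.

Lemma nullbZr s1 q s2 i : nullb s1 (q * s2.1, q * s2.2) i = q * nullb s1 s2 i.
Proof.
rewrite /nullb /=; case: ifP => _; first by ring.
by case: ifP => _; [rewrite -scalerAr; congr (_ *: _); ring|ring].
Qed.

Lemma nullpD s1 s2 i : nullp (s1.1 + s2.1, s1.2 + s2.2) i =
  nullp s1 i + 2 *: nullb s1 s2 i + nullp s2 i.
Proof.
rewrite /nullp nullbDr !(nullbC (_, _)) !nullbDr (nullbC s2 s1) scaler_nat mulr2n.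
by rewrite !addrA.
Qed.

Lemma nullpZ q s i : nullp (q * s.1, q * s.2) i = q ^+ 2 * nullp s i.
Proof. by rewrite /nullp nullbZr nullbC nullbZr mulrA -expr2. Qed.

Lemma nullp_comp q s i : nullp (s.1 \Po q, s.2 \Po q) i = nullp s i \Po q.
Proof.
rewrite /nullp /nullb /=; case: ifP => _; first by rewrite comp_polyB !comp_polyM.
case: ifP => _; first by rewrite comp_polyZ comp_polyD !comp_polyM.
by rewrite comp_polyD !comp_polyM.
Qed.

Lemma nrm1_nullb s1 s2 i : nrm1 (nullb s1 s2 i) <=
  (nrm1 s1.1 + nrm1 s1.2) * (nrm1 s2.1 + nrm1 s2.2).
Proof.
have ci : cmod ('i%C : C) = 1 by rewrite cmodE expr0n add0r expr1n sqrtr1.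
have h p1 p2 : nrm1 (p1 * p2) <= nrm1 p1 * nrm1 p2 by exact: nrm1M.
have [? ? ? ?] : [/\ 0 <= nrm1 s1.1, 0 <= nrm1 s1.2, 0 <= nrm1 s2.1 &
  0 <= nrm1 s2.2] by rewrite !nrm1_ge0.
have ? : 0 <= nrm1 s1.1 * nrm1 s2.2 by exact: mulr_ge0.
have ? : 0 <= nrm1 s1.2 * nrm1 s2.1 by exact: mulr_ge0.
have ? : 0 <= nrm1 s1.1 * nrm1 s2.1 by exact: mulr_ge0.
have ? : 0 <= nrm1 s1.2 * nrm1 s2.2 by exact: mulr_ge0.
have := h s1.1 s2.2; have := h s1.2 s2.1; have := h s1.1 s2.1; have := h s1.2 s2.2.
rewrite /nullb; case: ifP => _.
  by have := nrm1B (s1.1 * s2.1) (s1.2 * s2.2); lra.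
case: ifP => _; first rewrite nrm1Z ci mul1r.
  by have := nrm1D (s1.1 * s2.1) (s1.2 * s2.2); lra.
by have := nrm1D (s1.1 * s2.2) (s1.2 * s2.1); lra.
Qed.

(** The parameter at which the attached disc is evaluated: a fast power of z, with a phase u ^+ 2
    and an arc cutoff g ^+ 2. Both are squares because spinors enter quadratically. *)
Definition rhpoly g u k : {poly C} := u ^+ 2 *: (g ^+ 2 * 'X^((2 * k + 1) ^ 2)).

(* The factor (2k+1) 'X^N with 2N+1 = (2k+1)^2 makes the squared increment
   integrate to the attached disc, while the cross term, of size 2k+1, gains
   the factor 1/(N+1) upon integration. *)
Definition rhspinor s sg g u k : spinor :=
  let q := (u * (2 * k + 1)%:R) *: (g * 'X^(2 * k * (k + 1))) in
  (s.1 + q * (sg.1 \Po rhpoly g u k), s.2 + q * (sg.2 \Po rhpoly g u k)).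

(** The norm of [rhpoly] stays below nrm1 g ^+ 2 for all k and unimodular u, so every composition
    with it is bounded uniformly and k enters only through the integration gains. *)
Lemma prim_rhspinor s sg g : exists2 K, 0 <= K & forall k u i, cmod u = 1 ->
  nrm1 (prim (nullp (rhspinor s sg g u k) i) - prim (nullp s i) -
        (prim (nullp sg i) \Po rhpoly g u k)) <= K / (2 * k + 1)%:R.
Proof.
pose B := nrm1 g ^+ 2.
have B0 : 0 <= B by rewrite sqr_ge0.
have [K1 K10 hK1] := nrm1_comp sg.1 B0.
have [K2 K20 hK2] := nrm1_comp sg.2 B0.
have hK3 (i : 'I_3) := nrm1_comp (nullp sg i) B0.
have [K3 hK] : exists K3 : 'I_3 -> R, forall i, 0 <= K3 i /\
    forall q, nrm1 q <= B -> nrm1 (nullp sg i \Po q) <= K3 i.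
  suff /choice[K3 ?] : forall i : 'I_3, exists y, 0 <= y /\
    forall q, nrm1 q <= B -> nrm1 (nullp sg i \Po q) <= y by exists K3.
  by move=> i; have [K ? ?] := hK3 i; exists K.
pose K4 := \sum_i K3 i.
have K4i i : K3 i <= K4.
  rewrite /K4 (bigD1 i)//= lerDl; apply: sumr_ge0 => j _; by case: (hK j).
have K40 : 0 <= K4 by apply: sumr_ge0 => j _; by case: (hK j).
pose A := nrm1 g * ((nrm1 s.1 + nrm1 s.2) * (K1 + K2)).
pose A' := nrm1 g * nrm1 g^`() * K4.
have A0 : 0 <= A by rewrite !mulr_ge0 ?addr_ge0 ?nrm1_ge0.
have A'0 : 0 <= A' by rewrite !mulr_ge0 ?nrm1_ge0.
exists (4 * A + 2 * A'); first by lra.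
move=> k u i u1.
set n := (2 * k + 1)%N; set N := (2 * k * (k + 1))%N.
set Q := rhpoly g u k.
have n2 : (n ^ 2 = (2 * N).+1)%N by rewrite /n /N; nia.
have nQ : nrm1 Q <= B.
  rewrite nrm1Z nrm1MXn cmodX u1 expr1n mul1r; exact: nrm1_expn.
pose sQ := (sg.1 \Po Q, sg.2 \Po Q).
have Q0 : Q.[0] = 0 by rewrite /Q /rhpoly -/n n2 !hornerE /= expr0n/= !mulr0.
(* All terms are primitives vanishing at 0, so derivatives are compared. The square of the increment
   matches the part of Q' where the power of 'X is differentiated; the cross term and the part with
   g' remain. *)
have -> : prim (nullp (rhspinor s sg g u k) i) - prim (nullp s i) -
    (prim (nullp sg i) \Po Q) =
    (2 * u * n%:R) *: prim (g * nullb s sQ i * 'X^N) -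
    (2 * u ^+ 2) *: prim (g * g^`() * (nullp sg i \Po Q) * 'X^(n ^ 2)).
  rewrite -[prim (nullp sg i) \Po Q]prim_deriv; last first.
    by rewrite horner_comp Q0 horner_prim0.
  rewrite deriv_comp deriv_prim -!primZ -!primB; congr prim.
  rewrite /rhspinor -/n -/N -/Q.
  set q := (u * n%:R) *: _.
  have /= -> := nullpD s (q * (sg.1 \Po Q), q * (sg.2 \Po Q)) i.
  have /= -> := nullbZr s q sQ i.
  have /= -> := nullpZ q sQ i; rewrite nullp_comp.
  have -> : Q^`() = u ^+ 2 *: (g ^+ 2 *+ (n ^ 2) * 'X^(N) * 'X^N + 2 *: g * g^`() * 'X^(n ^ 2)).
    have XX : 'X^((n ^ 2).-1) = 'X^N * 'X^N :> {poly C}.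
      by rewrite n2 /= mul2n -addnn exprD.
    rewrite /Q /rhpoly -/n derivZ derivM derivXn XX deriv_exp /= expr1.
    rewrite -[2 *: g]mul_polyC polyC_natr; congr (_ *: _).
    by set m := (n ^ 2)%N; ring.
  rewrite /q -!mul_polyC !polyCM !polyC_natr.
  set U := u%:P; set XN := 'X^N; set W := nullp sg i \Po Q; set V := nullb s sQ i.
  rewrite -[g ^+ 2 *+ _]mulr_natr natrX.
  set X2 := 'X^(n ^ 2); set nn : {poly C} := n%:R.
  by ring.
apply: (le_trans (nrm1B _ _)); rewrite !nrm1Z !cmodM !cmod_nat !u1 !mulr1.
have nR : 0 < n%:R :> R by rewrite ltr0n /n addn1.
(* As 2N + 1 = n ^ 2, the gain 1 / (N + 1) is at most 2 / n ^ 2, which beats the factor n in front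
   of the cross term. *)
have b1 : nrm1 (prim (g * nullb s sQ i * 'X^N)) <= A * (2 / n%:R ^+ 2).
  apply: (le_trans (nrm1_primMXn _ _)); apply: ler_pM.
  - exact: nrm1_ge0.
  - by rewrite invr_ge0.
  - apply: (le_trans (nrm1M _ _)); rewrite ler_wpM2l ?nrm1_ge0//.
    apply: (le_trans (nrm1_nullb _ _ _)); rewrite ler_wpM2l ?addr_ge0 ?nrm1_ge0//.
    by apply: lerD; [exact: hK1|exact: hK2].
  - rewrite -[2 / _]invf_div lef_pV2 ?posrE ?divr_gt0 ?exprn_gt0// ler_pdivrMr// -natrX.
    by rewrite n2 -natrM ler_nat; lia.
have b2 : nrm1 (prim (g * g^`() * (nullp sg i \Po Q) * 'X^(n ^ 2))) <= A' / n%:R.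
  apply: (le_trans (nrm1_primMXn _ _)); apply: ler_pM.
  - exact: nrm1_ge0.
  - by rewrite invr_ge0.
  - apply: (le_trans (nrm1M _ _)); apply: ler_pM; rewrite ?nrm1_ge0//.
      exact: nrm1M.
    by apply: (le_trans _ (K4i i)); case: (hK i) => _; exact.
  - rewrite lef_pV2 ?posrE// ler_nat; nia.
rewrite (mulrDl (4 * A)); apply: lerD; last first.
  by rewrite -(mulrA 2 A') ler_pM2l.
have -> : 4 * A / n%:R = 2 * n%:R * (A * (2 / n%:R ^+ 2)).
  by field; rewrite gt_eqF.
by rewrite ler_pM2l// mulr_gt0.
Qed.

End NullDisc.

(** * Null discs under scaling, deformation and perturbation *)

Section DiscGeometry.
Context {R : realType}.
Local Notation C := (R[i]).
Local Notation spinor := ({poly C} * {poly C})%type.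
Local Notation V := 'rV[R]_3.
Implicit Types (s : spinor) (g : {poly C}) (c x y : V).

Lemma rv_norm_le n (x : 'rV[R]_n) (e : R) :
  0 <= e -> (forall i, `|x ord0 i| <= e) -> `|x| <= e.
Proof.
move=> e0 xe; rewrite [leLHS]/Num.Def.normr /= mx_normrE.
by apply/bigmax_leP; split => // -[i j] _ /=; rewrite ord1.
Qed.

Lemma rv_coord_le n (x : 'rV[R]_n) i : `|x ord0 i| <= `|x|.
Proof.
rewrite [leRHS]/Num.Def.normr /= mx_normrE.
exact: (le_bigmax (0 : R) (fun ij : 'I_1 * 'I_n => `|x ij.1 ij.2|) (ord0, i)).
Qed.

Lemma discE c s z : disc c s z = c + disc 0 s z.
Proof. by apply/rowP => i; rewrite !mxE add0r. Qed.

Lemma disc0 c s : disc c s 0 = c.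
Proof. by apply/rowP => i; rewrite !mxE horner_prim0 addr0. Qed.

Lemma disc_trivial c z : disc c (0, 0) z = c.
Proof.
apply/rowP => i; rewrite !mxE.
have -> : nullp (0, 0) i = 0 :> {poly C}.
  rewrite /nullp /nullb /= !mulr0 subr0 addr0 scaler0.
  by case: ifP => // _; case: ifP.
have -> : prim (0 : {poly C}) = 0 by apply/polyP => -[|j]; rewrite coef_prim ?coef0 ?mul0r.
by rewrite horner0 addr0.
Qed.

(** The null curve is quadratic in the spinor, so the square root makes the disc itself shrink by
    the factor l. *)
Definition scale_spinor (l : R) s : spinor :=
  ((Num.sqrt l)%:C%C%:P * s.1, (Num.sqrt l)%:C%C%:P * s.2).

Lemma disc_scale l c s z : 0 <= l ->
  disc c (scale_spinor l s) z = c + l *: disc 0 s z.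
Proof.
move=> l0; apply/rowP => i; rewrite !mxE add0r nullpZ; congr (_ + _).
rewrite -polyC_exp mul_polyC primZ hornerZ -rmorphXn sqr_sqrtr//.
by rewrite cReM /= mul0r subr0.
Qed.

(** Radii B beyond 1 occur because the parameter of the attached disc is bounded inside the disc by
    a coefficient norm. *)
Lemma disc_lipschitz_on s B : 0 <= B ->
  exists2 L, 0 <= L & forall c z w, cmod z <= B ->
  cmod w <= B -> `|disc c s z - disc c s w| <= L * cmod (z - w).
Proof.
move=> B0; have h (i : 'I_3) := horner_lipschitz (prim (nullp s i)) B0.
have /choice[L hL] : forall i : 'I_3, exists L, 0 <= L /\ forall z w, cmod z <= B ->
  cmod w <= B -> cmod ((prim (nullp s i)).[z] - (prim (nullp s i)).[w]) <= L * cmod (z - w).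
  by move=> i; have [K ? ?] := h i; exists K.
have L0 i : 0 <= L i by case: (hL i).
exists (\sum_i L i); first exact: sumr_ge0.
move=> c z w z1 w1; apply: rv_norm_le.
  by rewrite mulr_ge0 ?cmod_ge0 ?sumr_ge0.
move=> i; rewrite !mxE opprD addrACA subrr add0r -cReN -cReD.
apply: (le_trans (ler_Re_cmod _)); apply: (le_trans ((hL i).2 _ _ z1 w1)).
rewrite ler_wpM2r ?cmod_ge0// (bigD1 i)//= lerDl; exact: sumr_ge0.
Qed.

Lemma disc_lipschitz s : exists2 L, 0 <= L & forall c z w, cmod z <= 1 ->
  cmod w <= 1 -> `|disc c s z - disc c s w| <= L * cmod (z - w).
Proof. exact: disc_lipschitz_on. Qed.

Lemma disc_rh s sg g : exists2 K, 0 <= K & forall k u c z, cmod u = 1 ->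
  cmod z <= 1 ->
  `|disc c (rhspinor s sg g u k) z -
    (disc c s z + (disc 0 sg (u ^+ 2 * g.[z] ^+ 2 * z ^+ ((2 * k + 1) ^ 2))))|
  <= K / (2 * k + 1)%:R.
Proof.
have [K K0 hK] := prim_rhspinor s sg g; exists K => // k u c z u1 z1.
apply: rv_norm_le; first by rewrite divr_ge0.
move=> i; rewrite !mxE add0r.
set A := prim _; set B := prim _; set D := prim _.
have -> : u ^+ 2 * g.[z] ^+ 2 * z ^+ ((2 * k + 1) ^ 2) = (rhpoly g u k).[z].
  by rewrite /rhpoly hornerZ hornerM hornerXn horner_exp -mulrA.
rewrite -horner_comp.
rewrite (_ : _ - _ = complex.Re A.[z] - complex.Re B.[z] -
  complex.Re (D \Po rhpoly g u k).[z]); last by ring.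
rewrite -!cReN -!cReD -(hornerN B) -(hornerN (D \Po _)) -!hornerD.
apply: (le_trans (ler_Re_cmod _)); apply: (le_trans (horner_le_nrm1 _ z1)).
exact: hK.
Qed.

(** For the final removal of common zeros of the spinor, which would be branch points of the
    disc. *)
Lemma disc_perturb s : exists2 K, 0 <= K & forall c z (a b : C), cmod z <= 1 ->
  cmod a <= 1 -> cmod b <= 1 ->
  `|disc c (s.1 + a%:P, s.2 + b%:P) z - disc c s z| <= K * (cmod a + cmod b).
Proof.
pose K := 2 * (nrm1 s.1 + nrm1 s.2) + 2.
exists K; first by rewrite addr_ge0// mulr_ge0// addr_ge0// nrm1_ge0.
move=> c z a b z1 a1 b1.
have ab0 : 0 <= cmod a + cmod b by rewrite addr_ge0 ?cmod_ge0.
have N0 : 0 <= nrm1 s.1 + nrm1 s.2 by rewrite addr_ge0 ?nrm1_ge0.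
apply: rv_norm_le; first by rewrite mulr_ge0// addr_ge0// mulr_ge0// addr_ge0// nrm1_ge0.
move=> i; rewrite !mxE opprD addrACA subrr add0r -cReN -cReD -hornerN -hornerD -primB.
have /= -> := nullpD s (a%:P, b%:P) i.
apply: (le_trans (ler_Re_cmod _)); apply: (le_trans (horner_le_nrm1 _ z1)).
set P := (_ - _); have -> : P = 2 *: nullb s (a%:P, b%:P) i + nullp (a%:P, b%:P) i.
  by rewrite /P -[X in X - _]addrA addrAC subrr add0r.
have := nrm1_primMXn (2 *: nullb s (a%:P, b%:P) i + nullp (a%:P, b%:P) i) 0.
rewrite expr0 mulr1 divr1 => /le_trans; apply.
apply: (le_trans (nrm1D _ _)); rewrite nrm1Z cmod_nat.
have := nrm1_nullb s (a%:P, b%:P) i; have := nrm1_nullb (a%:P, b%:P) (a%:P, b%:P) i.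
rewrite /nullp /= !nrm1C => h1 h2.
rewrite /K [leRHS]mulrDl; apply: lerD; first by rewrite -mulrA ler_pM2l.
apply: (le_trans h1); rewrite ler_wpM2r//; lra.
Qed.

Lemma convexP (omega : set V) : convex_set omega ->
  forall x y (t : R), omega x -> omega y -> 0 <= t <= 1 ->
  omega ((1 - t) *: x + t *: y).
Proof.
move=> cvx x y t ox oy /andP[t0 t1].
have t01 : 0 <= t <= 1 by apply/andP.
have := cvx x y; rewrite /conv /= => h.
have := cvx y x (@Itv01 R t t0 t1).
rewrite !inE => /(_ oy ox); rewrite /conv /= addrC.
by [].
Qed.

End DiscGeometry.

(** * Lipschitz bounds and continuity on the circle *)

Section ExpiContinuity.
Context {R : realType}.

Lemma lipschitz_continuous (U W : normedModType R) (f : U -> W) (L : R) :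
  (forall x y, `|f x - f y| <= L * `|x - y|) -> continuous f.
Proof.
move=> hf x; apply/cvgrPdist_lt => e e0; near=> y.
apply: (le_lt_trans (hf x y)).
have L1 : L <= `|L| + 1 by rewrite (le_trans (ler_norm _))// lerDl.
apply: (@le_lt_trans _ _ ((`|L| + 1) * `|x - y|)).
  by rewrite ler_wpM2r.
rewrite mulrC -ltr_pdivlMr; last by rewrite ltr_wpDl.
near: y; apply: (@cvgr_dist_lt _ _ _ _ _ id) => //.
by rewrite divr_gt0// ltr_wpDl.
Unshelve. all: by end_near. Qed.

Lemma continuous_at_normP (U W : normedModType R) (f : U -> W) (x : U) :
  (forall e : R, 0 < e -> exists2 d : R, 0 < d &
    forall y, `|x - y| < d -> `|f x - f y| <= e) -> {for x, continuous f}.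
Proof.
move=> h; apply/cvgrPdist_le => e e0; have [d d0 hd] := h e e0.
by apply/nbhs_ballP; exists d => //= y; rewrite -ball_normE /=; exact: hd.
Qed.

Lemma norm_continuous_at (U W : normedModType R) (f : U -> W) (x : U) :
  {for x, continuous f} -> forall e : R, 0 < e -> exists2 d : R, 0 < d &
    forall y, `|x - y| < d -> `|f x - f y| <= e.
Proof.
move=> cf e e0; have /cvgrPdist_le/(_ e e0)/nbhs_ballP[d /= d0 hd] := cf.
by exists d => // y xy; apply: hd; rewrite -ball_normE.
Qed.

Lemma continuous_at_eq (U W : normedModType R) (f g : U -> W) (x : U) (d : R) :
  0 < d -> (forall y, `|x - y| < d -> f y = g y) -> {for x, continuous g} ->
  {for x, continuous f}.
Proof.
move=> d0 fg cg; apply: continuous_at_normP => e e0.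
have [d' d'0 hd'] := norm_continuous_at cg e0.
exists (Num.min d d'); first by rewrite lt_min d0.
move=> y; rewrite lt_min => /andP[h1 h2].
by rewrite !fg ?subrr ?normr0//; exact: hd'.
Qed.

Lemma open_norm (U : normedModType R) (A : set U) x : open A -> A x ->
  exists2 d : R, 0 < d & forall y, `|x - y| < d -> A y.
Proof.
move=> oA Ax; have /nbhs_ballP[d /= d0 hd] : nbhs x A by exact: open_nbhs_nbhs.
by exists d => // y xy; apply: hd; rewrite -ball_normE.
Qed.

Lemma ler_lipschitz_derive (f : R -> R) (f' : R -> R) :
  (forall x : R, is_derive x (1 : R) f (f' x)) -> (forall x, `|f' x| <= 1) ->
  forall x y, `|f x - f y| <= `|x - y|.
Proof.
move=> df f1 x y; wlog xy : x y / y <= x.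
  by move=> H; have [/H//|/ltW/H] := leP y x; rewrite distrC (distrC x).
have cf : continuous f.
  by move=> z; apply: differentiable_continuous; apply/derivable1_diffP; case: (df z).
have [z _ ->] := @MVT_segment _ f f' y x xy (fun z _ => df z)
  (continuous_subspaceT cf).
by rewrite normrM ler_piMl.
Qed.

Lemma cos_lip (x y : R) : `|cos x - cos y| <= `|x - y|.
Proof.
apply: (@ler_lipschitz_derive cos (fun x => - sin x)) => z.
by rewrite normrN sin_max.
Qed.

Lemma sin_lip (x y : R) : `|sin x - sin y| <= `|x - y|.
Proof. by apply: (@ler_lipschitz_derive sin cos) => z; rewrite cos_max. Qed.

Lemma expi_lip (s t : R) : cmod (expi s - expi t) <= 2 * `|s - t|.
Proof.
have -> : expi s - expi t = (cos s - cos t)%:C%C + 'i%C * (sin s - sin t)%:C%C.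
  apply: complex_eq; rewrite ?cReD ?cImD ?cReN ?cImN ?cReM ?cImM /=; ring.
apply: (le_trans (cmodD _ _)); rewrite cmodM !cmod_real cmodE expr0n add0r expr1n.
rewrite sqrtr1 mul1r mulr_natl mulr2n; apply: lerD; [exact: cos_lip|exact: sin_lip].
Qed.

Lemma continuous_disc (c : 'rV[R]_3) s :
  continuous (fun t : R => disc c s (expi t)).
Proof.
have [L L0 hL] := disc_lipschitz s.
apply: (@lipschitz_continuous _ _ _ (L * 2)) => x y.
apply: (le_trans (hL _ _ _ _ _)); rewrite ?cmod_expi//.
by rewrite -mulrA ler_wpM2l// expi_lip.
Qed.

End ExpiContinuity.

(** * Integrals and circle means *)

Section RealIntegrals.
Context {R : realType}.
Notation mu := (@lebesgue_measure R).
Implicit Types (q f F : R -> R) (a b c : R).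

Definition rint a b q : R := \int[mu]_(t in `[a, b]) q t.

Lemma cont_integrable a b q : continuous q ->
  mu.-integrable `[a, b] (EFin \o q).
Proof.
move=> cq; apply: continuous_compact_integrable; first exact: segment_compact.
exact: continuous_subspaceT.
Qed.

Lemma rintE a b q : continuous q ->
  (\int[mu]_(t in `[a, b]) (q t)%:E)%E = (rint a b q)%:E.
Proof.
move=> cq; rewrite /rint /Rintegral fineK//; apply: integrable_fin_num => //.
exact: cont_integrable.
Qed.

Lemma le_rint a b q1 q2 : continuous q1 -> continuous q2 ->
  (forall t, a <= t <= b -> q1 t <= q2 t) -> rint a b q1 <= rint a b q2.
Proof.
by move=> c1 c2 h; apply: le_Rintegral => //; exact: cont_integrable.
Qed.

Lemma eq_rint a b q1 q2 : (forall t, a <= t <= b -> q1 t = q2 t) ->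
  rint a b q1 = rint a b q2.
Proof.
by move=> h; apply: eq_Rintegral => x; rewrite inE /= in_itv /=; exact: h.
Qed.

Lemma rintD a b q1 q2 : continuous q1 -> continuous q2 ->
  rint a b (fun t => q1 t + q2 t) = rint a b q1 + rint a b q2.
Proof. by move=> ? ?; apply: RintegralD => //; exact: cont_integrable. Qed.

Lemma rintZ a b k q : continuous q ->
  rint a b (fun t => k * q t) = k * rint a b q.
Proof. by move=> ?; apply: RintegralZl => //; exact: cont_integrable. Qed.

Lemma rint_cst a b k : a <= b -> rint a b (fun=> k) = k * (b - a).
Proof.
move=> ab; rewrite /rint Rintegral_cst//; congr (_ * _).
have := lebesgue_measure_itv `[a, b]; rewrite /= lte_fin => ->.
by move: ab; rewrite le_eqVlt => /predU1P[->|->//]; rewrite ltxx subrr.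
Qed.

Lemma rint_ge0 a b q : (forall t, a <= t <= b -> 0 <= q t) -> 0 <= rint a b q.
Proof.
by move=> h; apply: Rintegral_ge0 => x /=; rewrite in_itv /=; exact: h.
Qed.

Lemma rint_split b a c q : continuous q -> a <= b -> b <= c ->
  rint a c q = rint a b q + rint b c q.
Proof.
move=> cq ab bc; have := @Rintegral_itvB R q (BLeft a) (BRight c) b.
rewrite !bnd_simp => /(_ (cont_integrable _ _ cq) ab bc) h.
apply/eqP; rewrite addrC -subr_eq /rint h; apply/eqP.
rewrite Rintegral_itv_obnd_cbnd//.
apply: integrableS (cont_integrable b c cq) => //.
by apply: subset_itvr; rewrite bnd_simp.
Qed.

Lemma le_rint_cst a b q k : continuous q -> a <= b ->
  (forall t, a <= t <= b -> q t <= k) -> rint a b q <= k * (b - a).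
Proof.
move=> cq ab h; rewrite -rint_cst//; apply: le_rint => //.
by move=> x; exact: cst_continuous.
Qed.

Lemma rint_pt a q : rint a a q = 0.
Proof. by rewrite /rint set_itv1 Rintegral_set1. Qed.

Lemma rint_FTC a b f F : a <= b -> continuous f ->
  (forall x, a <= x <= b -> is_derive x (1 : R) F (f x)) ->
  rint a b f = F b - F a.
Proof.
rewrite le_eqVlt => /predU1P[<-|ab] cf dF; first by rewrite rint_pt subrr.
have cF x : a <= x <= b -> {for x, continuous F}.
  move=> /dF[+ _] => /derivable1_diffP; exact: differentiable_continuous.
apply: EFin_inj; rewrite -rintE// (@continuous_FTC2 R f F a b)//.
- exact: continuous_subspaceT.
- split.
  + by move=> x; rewrite in_itv /= => /andP[ax xb]; case: (dF x) => //; rewrite !ltW.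
  + by apply: cvg_at_right_filter; apply: cF; rewrite lexx ltW.
  + by apply: cvg_at_left_filter; apply: cF; rewrite lexx ltW.
- move=> x; rewrite in_itv /= => /andP[ax xb].
  by rewrite derive1E; case: (dF x) => //; rewrite !ltW.
Qed.

Lemma primitive_exists c d q : continuous q -> exists F,
  forall x, c <= x <= d -> is_derive x (1 : R) F (q x).
Proof.
(* Starting the integral at c - 1 and applying the fundamental theorem up to d + 1 makes c and d
   interior points. *)
move=> cq; exists (fun x => rint (c - 1) x q) => x /andP[cx xd].
have [] := @continuous_FTC1_closed R q (c - 1) x (d + 1).
- by rewrite (le_lt_trans xd)// ltrDl.
- exact: cont_integrable.
- by rewrite (lt_le_trans _ cx)// ltrBlDr ltrDl.
- exact: cq.
move=> D; rewrite derive1E => Dx; exact: DeriveDef.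
Qed.

Lemma rint_shift a b s q : continuous q -> a <= b ->
  rint a b (fun t => q (t + s)) = rint (a + s) (b + s) q.
Proof.
move=> cq ab; have [F dF] := primitive_exists (a + s) (b + s) cq.
have abs : a + s <= b + s by rewrite lerD2r.
have cqs : continuous (fun t => q (t + s)).
  move=> t; apply: continuous_comp; last exact: cq.
  by apply: cvgD; [exact: cvg_id|exact: cvg_cst].
have dFs x : a <= x <= b -> is_derive x (1 : R) (fun t => F (t + s)) (q (x + s)).
  move=> /andP[ax xb].
  have dF' : is_derive (x + s) (1 : R) F (q (x + s)).
    by apply: dF; rewrite !lerD2r ax.
  have d2 : is_derive x (1 : R) (fun t => t + s) 1.
    by have := is_deriveD (is_derive_id x 1) (is_derive_cst s x 1); rewrite addr0.
  have := is_derive1_comp (f := F) (g := fun t => t + s) dF' d2.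
  by rewrite mulr1.
by rewrite (rint_FTC abs cq dF) (rint_FTC ab cqs dFs).
Qed.

Definition mean q : R := (2 * pi)^-1 * rint 0 (2 * pi) q.

Lemma twopi_gt0 : 0 < 2 * pi :> R. Proof. by rewrite mulr_gt0 ?pi_gt0. Qed.

Lemma rint_mean q : rint 0 (2 * pi) q = 2 * pi * mean q.
Proof. by rewrite /mean mulVKf// gt_eqF ?twopi_gt0. Qed.

Lemma mean_rotate q s : continuous q -> (forall t, q (t + 2 * pi) = q t) ->
  0 <= s <= 2 * pi -> mean (fun t => q (t + s)) = mean q.
Proof.
move=> cq pq /andP[s0 s2]; have p0 := ltW twopi_gt0.
congr (_ * _); rewrite rint_shift// add0r.
rewrite (rint_split (b := 2 * pi))//; last by rewrite lerDl.
rewrite [RHS](rint_split (b := s))// addrC; congr (_ + _).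
rewrite (addrC _ s) -{1}[2 * pi]add0r -rint_shift//.
by apply: eq_rint => t _; exact: pq.
Qed.

Lemma le_mean q1 q2 : continuous q1 -> continuous q2 ->
  (forall t, 0 <= t <= 2 * pi -> q1 t <= q2 t) -> mean q1 <= mean q2.
Proof.
move=> c1 c2 h; rewrite ler_pM2l ?invr_gt0 ?twopi_gt0//; exact: le_rint.
Qed.

Lemma meanD q1 q2 : continuous q1 -> continuous q2 ->
  mean (fun t => q1 t + q2 t) = mean q1 + mean q2.
Proof. by move=> ? ?; rewrite /mean rintD// mulrDr. Qed.

Lemma mean_cst k : mean (fun=> k) = k.
Proof.
rewrite /mean rint_cst ?(ltW twopi_gt0)// subr0 mulrCA mulVf ?mulr1//.
by rewrite gt_eqF// twopi_gt0.
Qed.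

Lemma mean_ge0 q : (forall t, 0 <= t <= 2 * pi -> 0 <= q t) -> 0 <= mean q.
Proof. by move=> h; rewrite mulr_ge0 ?invr_ge0 ?(ltW twopi_gt0) ?rint_ge0. Qed.

(* Open rational rectangles generate the topology of the plane. *)
Lemma open_measurable2 (A : set (R * R)) : open A -> measurable A.
Proof.
move=> oA.
pose D := [set r : (rat * rat) * (rat * rat) |
  `](ratr r.1.1 : R), ratr r.1.2[ `*` `](ratr r.2.1 : R), ratr r.2.2[ `<=` A].
have -> : A = \bigcup_(r in D)
    (`](ratr r.1.1 : R), ratr r.1.2[ `*` `](ratr r.2.1 : R), ratr r.2.2[).
  apply/seteqP; split => [[x y] Axy|z [r Dr]]; last exact: Dr.
  have /nbhs_ballP[e /= e0 eA] : nbhs (x, y) A by exact: open_nbhs_nbhs.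
  have xe1 : x - e < x by rewrite ltrBlDr ltrDl.
  have xe2 : x < x + e by rewrite ltrDl.
  have ye1 : y - e < y by rewrite ltrBlDr ltrDl.
  have ye2 : y < y + e by rewrite ltrDl.
  have [a] := rat_in_itvoo xe1; rewrite in_itv /= => /andP[a1 a2].
  have [b] := rat_in_itvoo xe2; rewrite in_itv /= => /andP[b1 b2].
  have [c] := rat_in_itvoo ye1; rewrite in_itv /= => /andP[c1 c2].
  have [d] := rat_in_itvoo ye2; rewrite in_itv /= => /andP[d1 d2].
  exists ((a, b), (c, d)); last by split; rewrite /= in_itv /= ?a2 ?b1 ?c2 ?d1.
  move=> -[u v] [/=]; rewrite !in_itv /= => /andP[au ub] /andP[cv vd].
  by apply: eA; split; rewrite /= /ball /= ltr_norml; apply/andP; split; lra.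
rewrite bigcup_mkcond; apply: countable_bigcupT_measurable => // r.
case: ifP => // _; apply: measurableX; exact: measurable_itv.
Qed.

Lemma continuous_measurable2 (H : R * R -> R) : continuous H ->
  measurable_fun setT (EFin \o H).
Proof.
move=> cH; apply/measurable_EFinP.
apply: (@measurability _ _ _ _ _ _ (@RGenOInfty.G R)).
  exact: RGenOInfty.measurableE.
move=> _ [_ [r ->] <-]; rewrite setTI.
apply: open_measurable2; apply: open_comp => // x _; exact: cH.
Qed.

End RealIntegrals.

Section GoodPhase.
Context {R : realType}.
Notation mu := (@lebesgue_measure R).

(** Averaging over the phase: if every th failed, the double integral of H would be at least 2 * pi
    * (rint a b m + e), whereas Tonelli and the bound on the means give at most 2 * pi * rint a b
    m. *)
Lemma exists_phase (H : R * R -> R) (a b : R) (m : R -> R) (e : R) :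
  continuous H -> (forall z, 0 <= H z) -> a <= b -> continuous m ->
  (forall t, a <= t <= b -> mean (fun th => H (t, th)) <= m t) -> 0 < e ->
  exists2 th, 0 <= th <= 2 * pi &
    rint a b (fun t => H (t, th)) <= rint a b m + e.
Proof.
move=> cH H0 ab cm hm e0; apply: contrapT => /forall2NP hth.
have cH1 t : continuous (fun th => H (t, th)).
  move=> x; apply: (@continuous_comp _ _ _ (fun th => (t, th)) H); last exact: cH.
  apply: (@cvg_pair _ _ _ _ (nbhs t) (nbhs x)); [exact: cvg_cst|exact: cvg_id].
have cH2 th : continuous (fun t => H (t, th)).
  move=> x; apply: (@continuous_comp _ _ _ (fun t => (t, th)) H); last exact: cH.
  apply: (@cvg_pair _ _ _ _ (nbhs x) (nbhs th)); [exact: cvg_id|exact: cvg_cst].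
pose A := `[a, b]%classic; pose B := `[0, 2 * pi]%classic : set R.
have mA : measurable A by exact: measurable_itv.
have mB : measurable B by exact: measurable_itv.
pose f := (EFin \o H) \_ (A `*` B).
have mf : measurable_fun setT f.
  have mH := continuous_measurable2 cH.
  have mH' : measurable_fun (A `*` B) (EFin \o H).
    exact: (measurable_funS measurableT (@subsetT _ _) mH).
  exact: (iffLR (measurable_restrictT _ (measurableX mA mB)) mH').
have f0 z : (0 <= f z)%E.
  by rewrite /f patchE; case: ifP => _ //=; rewrite lee_fin.
have fE1 : (\int[mu]_x \int[mu]_y f (x, y) =
            \int[mu]_(x in A) (2 * pi * mean (fun th => H (x, th)))%:E)%E.
  rewrite [RHS]integral_mkcond; apply: eq_integral => x _; rewrite patchE.
  case: ifPn => xA.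
    rewrite -rint_mean -(rintE _ _ (cH1 x)) [RHS]integral_mkcond.
    apply: eq_integral => y _; rewrite /f !patchE.
    by rewrite in_setX /= xA.
  apply: integral0_eq => y _; rewrite /f patchE in_setX /=.
  by rewrite (negbTE xA).
have fE2 : (\int[mu]_y \int[mu]_x f (x, y) =
            \int[mu]_(y in B) (rint a b (fun t => H (t, y)))%:E)%E.
  rewrite [RHS]integral_mkcond; apply: eq_integral => y _; rewrite patchE.
  case: ifPn => yB.
    rewrite -(rintE _ _ (cH2 y)) [RHS]integral_mkcond.
    apply: eq_integral => x _; rewrite /f !patchE.
    by rewrite in_setX /= yB andbT.
  apply: integral0_eq => x _; rewrite /f patchE in_setX /=.
  by rewrite (negbTE yB) andbF.
have mG := measurable_fun_fubini_tonelli_G (m1 := mu) f mf f0.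
have mF := measurable_fun_fubini_tonelli_F (m2 := mu) f mf f0.
have p0 := twopi_gt0 (R := R).
have lo : ((2 * pi * (rint a b m + e))%:E <= \int[mu]_y \int[mu]_x f (x, y))%E.
  have -> : ((2 * pi * (rint a b m + e))%:E =
     \int[mu]_(y in B) (rint a b m + e)%:E)%E.
    rewrite (@rintE R 0 (2 * pi) (fun=> rint a b m + e)); last by move=> x; exact: cst_continuous.
    by rewrite rint_cst ?ltW// subr0 mulrC.
  apply: (@le_trans _ _ (\int[mu]_(y in B) fubini_G mu f y)%E); last first.
    rewrite integral_mkcond; apply: ge0_le_integral => //.
    - by move=> y _; rewrite patchE; case: ifP => // _; exact: integral_ge0.
    - by apply: (iffLR (measurable_restrictT _ mB)); exact: measurable_funS mG.
    - by move=> y _; rewrite patchE; case: ifP => // _; exact: integral_ge0.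
  have I0 : 0 <= rint a b m + e.
    rewrite addr_ge0 ?(ltW e0)// rint_ge0// => t /hm; apply: le_trans.
    by apply: mean_ge0.
  apply: ge0_le_integral => //.
  - exact: measurable_funS mG.
  - move=> y yB; rewrite /fubini_G.
    have -> : (\int[mu]_x f (x, y) = (rint a b (fun t => H (t, y)))%:E)%E.
      rewrite -(rintE _ _ (cH2 y)) [RHS]integral_mkcond.
      apply: eq_integral => x _; rewrite /f !patchE.
      by rewrite in_setX /= [y \in B]mem_set// andbT.
    rewrite lee_fin; case: (hth y) => [|/negP]; last by rewrite -ltNge => /ltW.
    by move: yB; rewrite /B /= in_itv /=.
have up : (\int[mu]_y \int[mu]_x f (x, y) <= (2 * pi * rint a b m)%:E)%E.
  rewrite -fubini_tonelli// fE1 -rintZ// -(rintE _ _ _); last first.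
    by move=> x; apply: cvgM; [exact: cvg_cst|exact: cm].
  apply: ge0_le_integral => //.
  - by move=> x _; rewrite lee_fin mulr_ge0 ?(ltW p0)// mean_ge0.
  - have : measurable_fun A (fubini_F mu f) by exact: measurable_funS mF.
    apply: eq_measurable_fun => x xA; rewrite /fubini_F -rint_mean -(rintE _ _ (cH1 x)).
    rewrite [RHS]integral_mkcond.
    apply: eq_integral => y _; rewrite /f !patchE.
    by rewrite in_setX /= xA.
  - apply/measurable_EFinP; apply: (measurable_funS measurableT) => //.
    apply: continuous_measurable_fun.
    by move=> x; apply: cvgM; [exact: cvg_cst|exact: cm].
  - move=> x; rewrite /A /= in_itv /= => /hm xm.
    by rewrite lee_fin ler_pM2l.
have := le_trans lo up; rewrite lee_fin ler_pM2l//.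
by rewrite gerDl leNgt e0.
Qed.

End GoodPhase.

(** * Polynomials concentrated on an arc *)

Section ArcCutoff.
Context {R : realType}.
Local Notation C := (R[i]).

(** Trigonometric polynomials, encoded through analytic ones because the cutoff has to be the
    modulus of a polynomial in z. *)
Definition trig_poly (T : R -> R) :=
  exists q : {poly C}, forall t, complex.Re q.[expi t] = T t.

Lemma trig_poly_cst k : trig_poly (fun=> k).
Proof. by exists (k%:C%C)%:P => t; rewrite hornerC. Qed.

Lemma trig_polyD T1 T2 : trig_poly T1 -> trig_poly T2 ->
  trig_poly (fun t => T1 t + T2 t).
Proof.
by move=> [p hp] [q hq]; exists (p + q) => t; rewrite hornerD cReD hp hq.
Qed.

Lemma trig_polyZ k T : trig_poly T -> trig_poly (fun t => k * T t).
Proof.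
move=> [p hp]; exists ((k%:C%C)%:P * p) => t.
by rewrite hornerM hornerC cReM /= mul0r subr0 hp.
Qed.

Lemma trig_poly_sum (I : Type) (r : seq I) (T : I -> R -> R) :
  (forall i, trig_poly (T i)) -> trig_poly (fun t => \sum_(i <- r) T i t).
Proof.
move=> hT; elim: r => [|i r IH].
  by have [q hq] := trig_poly_cst 0; exists q => t; rewrite big_nil hq.
have [q hq] := trig_polyD (hT i) IH.
by exists q => t; rewrite big_cons hq.
Qed.

(* If [w = e^{is}], then [2 cos (t - s) = conj w z + w / z] on the circle. *)
Lemma trig_poly_cos s T : trig_poly T -> trig_poly (fun t => cos (t - s) * T t).
Proof.
move=> [p hp].
have [q [c pE]] : exists q c, p = q * 'X + c%:P.
  by elim/poly_ind: p {hp} => [|q c _]; [exists 0, 0; rewrite mul0r addr0|exists q, c].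
subst p.
have hT t : T t = complex.Re (q.[expi t] * expi t) + complex.Re c.
  by rewrite -hp hornerD hornerM hornerX hornerC cReD.
pose w := expi s; pose w' := expi (- s).
(* Division by z lowers q * 'X to q. The constant term cannot be lowered; its share complex.Re c *
   cos (t - s) is the real part of a multiple of w' * z. *)
exists ((2^-1)%:C%C *: (w' *: (q * 'X^2) + w *: q + (2 * (complex.Re c))%:C%C *: (w' *: 'X))).
move=> t; rewrite !hornerE hT; set Q := q.[expi t].
rewrite /w /w' cosB /expi !(cReM, cReD, cImM, cImD) /= sinN cosN.
have := cos2Dsin2 t.
set a := cos t; set b := sin t; set x := complex.Re Q; set y := complex.Im Q.
set e := cos s; set f := sin s; set g := complex.Re c => ab.
have aa : a ^+ 2 = 1 - b ^+ 2 by rewrite -ab; ring.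
by field: aa.
Qed.

Lemma trig_poly_bump s n : trig_poly (fun t => ((1 + cos (t - s)) / 2) ^+ n).
Proof.
elim: n => [|n IH]; first exact: trig_poly_cst.
have [q hq] := trig_polyZ 2^-1 (trig_polyD IH (trig_poly_cos s IH)).
by exists q => t; rewrite hq exprS; ring.
Qed.

Lemma cos_lt_cos (x y : R) : 0 <= x -> x < y -> y <= pi -> cos y < cos x.
Proof.
move=> x0 xy yp; have xI : x \in `[0, pi].
  by rewrite in_itv /= x0 (le_trans (ltW xy)).
have yI : y \in `[0, pi] by rewrite in_itv /= yp (le_trans x0)// ltW.
by rewrite (ltr_cos xI yI).
Qed.

Lemma cos_le_cos (d u : R) : 0 <= d -> d <= u -> u <= 2 * pi - d -> cos u <= cos d.
Proof.
move=> d0 du u2; have p0 := pi_gt0 R.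
have mono (x y : R) : 0 <= x -> x <= y -> y <= pi -> cos y <= cos x.
  by move=> x0; rewrite le_eqVlt => /predU1P[->//|xy yp]; apply/ltW; exact: cos_lt_cos.
have [up|up] := leP u pi; first exact: mono.
have -> : cos u = cos (2 * pi - u).
  by rewrite addrC mulr_natl cosD2pi cosN.
by apply: mono => //; lra.
Qed.

Lemma bernoulli_ge (x : R) n : -1 <= x -> 1 + n%:R * x <= (1 + x) ^+ n.
Proof.
move=> x1; elim: n => [|n IH]; first by rewrite mul0r addr0 expr0.
have x10 : 0 <= 1 + x by lra.
rewrite exprS; apply: (le_trans _ (ler_wpM2l x10 IH)).
rewrite -natr1; have : 0 <= n%:R * x ^+ 2 by rewrite mulr_ge0 ?sqr_ge0.
lra.
Qed.

Lemma expr_small (c e : R) : 0 <= c < 1 -> 0 < e -> exists n, c ^+ n < e.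
Proof.
move=> /andP[c0 c1] e0.
have : (fun n => c ^+ n) @ \oo --> 0 by apply: cvg_expr; rewrite ger0_norm.
move=> /cvgrPdist_lt /(_ _ e0) [N _ hN]; exists N.
by have := hN N (leqnn N); rewrite /= sub0r normrN ger0_norm// exprn_ge0.
Qed.

Lemma exists_nat_gt (x : R) : exists2 n, (0 < n)%N & x < n%:R.
Proof.
exists (Num.trunc `|x|).+1 => //.
by apply: (le_lt_trans (ler_norm x)); rewrite truncnS_gt.
Qed.

(* [exp (- q)] with [Re q] nonnegative on the circle, replaced by
   [(1 - q / M) ^ M] to stay among polynomials. *)
Lemma poly_exp_cutoff (T : R -> R) (tau : R) : trig_poly T -> 0 < tau ->
  (forall t, tau <= T t) -> exists g : {poly C}, forall t,
  [/\ cmod g.[expi t] <= 1, cmod g.[expi t] ^+ 2 <= (1 + T t)^-1 &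
      1 - 2 * T t <= cmod g.[expi t] ^+ 2].
Proof.
move=> [q hq] tau0 hT; pose B := nrm1 q.
(* M >= B ^+ 2 / tau lets half of the linear term absorb the quadratic term of the squared modulus
   of 1 - q / M, and M >= B keeps 1 - T / M nonnegative. *)
have [M M0 hM] := exists_nat_gt (B ^+ 2 / tau + B).
have MR : 0 < M%:R :> R by rewrite ltr0n.
have B0 : 0 <= B := nrm1_ge0 q.
have M1 : B ^+ 2 <= M%:R * tau.
  by rewrite -ler_pdivrMr// ltW// (le_lt_trans _ hM)// lerDl.
have M2 : B <= M%:R.
  by rewrite ltW// (le_lt_trans _ hM)// lerDr divr_ge0 ?sqr_ge0 ?ltW.
exists ((1 - (M%:R^-1)%:C%C *: q) ^+ M) => t.
set z := q.[expi t]; set x := T t.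
have zB : cmod z <= B by rewrite horner_le_nrm1// cmod_expi.
have xB : `|x| <= B by rewrite /x -(hq t) (le_trans (ler_Re_cmod _)).
have x0 : 0 < x by apply: lt_le_trans (hT t).
have xM : x / M%:R <= 1.
  by rewrite ler_pdivrMr// mul1r (le_trans _ M2)// (le_trans _ xB)// ler_norm.
have zz : cmod z ^+ 2 <= B ^+ 2 by rewrite lerXn2r ?nnegrE ?cmod_ge0.
rewrite horner_exp cmodX hornerD hornerN hornerZ -/z (_ : (1 : {poly C}) = 1%:P)// hornerC.
set w := 1 - _.
have wE : cmod w ^+ 2 = 1 - 2 * (x / M%:R) + cmod z ^+ 2 / M%:R ^+ 2.
  rewrite !sqr_cmod /w !(cReD, cReN, cImD, cImN, cReM, cImM) /= hq -/x -/z.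
  by field; rewrite gt_eqF.
(* The squared modulus lies between (1 - x / M) ^+ 2 and 1 - x / M; Bernoulli's inequality then
   compares the M-th powers with 1 - 2 * x and 1 / (1 + x). *)
have wle : cmod w ^+ 2 <= 1 - x / M%:R.
  rewrite wE -lerBrDl; apply: (@le_trans _ _ (M%:R * tau / M%:R ^+ 2)).
    by rewrite ler_pM2r ?invr_gt0 ?exprn_gt0// (le_trans zz).
  have -> : M%:R * tau / M%:R ^+ 2 = tau / M%:R by field; rewrite gt_eqF.
  have : tau / M%:R <= x / M%:R by rewrite ler_pM2r ?invr_gt0//; exact: hT.
  lra.
have wge : (1 - x / M%:R) ^+ 2 <= cmod w ^+ 2.
  rewrite sqr_cmod /w !(cReD, cReN, cImD, cImN, cReM, cImM) /= hq -/x mul0r subr0 mulrC.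
  by rewrite lerDl sqr_ge0.
have y0 : 0 <= 1 - x / M%:R by rewrite subr_ge0.
have y1 : 1 - x / M%:R <= 1 by rewrite gerBl divr_ge0 ?ltW.
have x01 : 0 < 1 + x by rewrite addr_gt0.
split.
- rewrite exprn_ile1 ?cmod_ge0// -(@expr_le1 _ 2) ?cmod_ge0//.
  exact: le_trans wle y1.
- rewrite exprAC; apply: (@le_trans _ _ ((1 - x / M%:R) ^+ M)).
    by rewrite lerXn2r ?nnegrE ?sqr_ge0.
  rewrite -[leRHS]mul1r ler_pdivlMr//.
  have := @bernoulli_ge (x / M%:R) M; rewrite mulrCA divff ?gt_eqF// mulr1 => hb.
  have xM0 : 0 <= x / M%:R by rewrite divr_ge0 ?ltW.
  apply: (@le_trans _ _ ((1 - x / M%:R) ^+ M * (1 + x / M%:R) ^+ M)).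
    by rewrite ler_wpM2l ?exprn_ge0// hb// (le_trans _ xM0)// lerN10.
  rewrite -exprMn exprn_ile1//; first by rewrite mulr_ge0// addr_ge0.
  have -> : (1 - x / M%:R) * (1 + x / M%:R) = 1 - (x / M%:R) ^+ 2 by ring.
  by rewrite gerBl sqr_ge0.
- rewrite exprAC; apply: (@le_trans _ _ (((1 - x / M%:R) ^+ 2) ^+ M)); last first.
    by rewrite lerXn2r ?nnegrE ?sqr_ge0.
  rewrite -exprM.
  have := @bernoulli_ge (- (x / M%:R)) (2 * M); rewrite lerN2 natrM mulrN -mulrA.
  by rewrite (mulrCA M%:R) divff ?gt_eqF// mulr1; exact.
Qed.

(** A positive trigonometric polynomial T, large off the arc and small deep inside it, is a sum of
    high powers of bumps centred off the arc; the cutoff then behaves like exp (- T). *)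
Lemma arc_cutoff (al be ka e : R) : 0 < ka -> 0 <= al -> be <= 2 * pi ->
  al + ka <= be - ka -> 0 < e -> exists g : {poly C},
  [/\ forall t, cmod g.[expi t] <= 1,
      forall t, 0 <= t <= al \/ be <= t <= 2 * pi -> cmod g.[expi t] ^+ 2 <= e &
      forall t, al + ka <= t <= be - ka -> 1 - e <= cmod g.[expi t] ^+ 2].
Proof.
move=> ka0 al0 be2 ab e0; have p0 := pi_gt0 R.
(* A point off the arc, rounded down to the grid of mesh d, is within d of a centre in S, whence be
   - d below. A point at depth ka = 4 * d inside the arc is at least 3 * d away from every
   centre. *)
pose d := ka / 4; have d0 : 0 < d by rewrite divr_gt0.
have kaE : ka = 4 * d by rewrite /d; field.
have [N _ hN] := exists_nat_gt (2 * pi / d).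
pose S := [seq s <- [seq j%:R * d | j <- iota 0 N] |
  (s <= al) || ((be - d <= s) && (s <= 2 * pi))].
pose c2 := (1 + cos d) / 2; pose c1 := (1 + cos (3 * d)) / 2.
have c12 : c1 < c2.
  rewrite ltr_pM2r// ltrD2l.
  by apply: cos_lt_cos; lra.
have c10 : 0 <= c1 by rewrite divr_ge0//; have := cos_geN1 (3 * d); lra.
have c20 : 0 < c2 by exact: le_lt_trans c10 c12.
have off t : 0 <= t <= al \/ be <= t <= 2 * pi -> exists2 s, s \in S & c2 <= (1 + cos (t - s)) / 2.
  move=> ht; have /andP[t0 t2] : 0 <= t <= 2 * pi by case: ht => /andP[? ?]; apply/andP; split; lra.
  have td0 : 0 <= t / d by rewrite divr_ge0// ltW.
  pose j := Num.trunc (t / d).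
  have /andP[j1 j2] := truncn_itv td0.
  have {}j1 : j%:R * d <= t by rewrite -ler_pdivlMr.
  have {}j2 : t < j.+1%:R * d by rewrite -ltr_pdivrMr.
  have j3 : t < j%:R * d + d by move: j2; rewrite -natr1; lra.
  exists (j%:R * d).
    rewrite mem_filter; apply/andP; split.
      by apply/orP; case: ht => /andP[? ?]; [left; lra|right; apply/andP; split; lra].
    apply/mapP; exists j => //; rewrite mem_iota /= add0n -(ltr_nat R).
    apply: le_lt_trans hN; rewrite ler_pdivlMr//; lra.
  rewrite ler_pM2r// lerD2l; have [h|h] := leP d (t - j%:R * d); last first.
    by apply/ltW/cos_lt_cos; lra.
  lra.
have on t s : al + ka <= t <= be - ka -> s \in S -> (1 + cos (t - s)) / 2 <= c1.
  move=> /andP[t1 t2]; rewrite mem_filter => /andP[hs /mapP[j _ sE]].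
  have s0 : 0 <= s by rewrite sE mulr_ge0// ltW.
  rewrite ler_pM2r// lerD2l; case/orP: hs => [sal|/andP[s1 s2]].
    by apply: cos_le_cos; lra.
  by rewrite -cosN; apply: cos_le_cos; lra.
pose A := e^-1; have A0 : 0 < A by rewrite invr_gt0.
pose eta := e / 4; have eta0 : 0 < eta by rewrite divr_gt0.
pose m : R := (size S)%:R.
have [n hn] : exists n, (c1 / c2) ^+ n < eta / (A * (m + 1)).
  apply: expr_small; last by rewrite divr_gt0// mulr_gt0// ltr_wpDl.
  by rewrite divr_ge0 ?(ltW c20)//= ltr_pdivrMr// mul1r.
(* After division by c2 ^+ n a single bump forces T >= A = 1 / e off the arc, while deep inside all
   the bumps together stay below eta. So T <= 2 * eta there and 1 - 2 * T >= 1 - e. *)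
pose T t := eta + (A / c2 ^+ n) * \sum_(s <- S) ((1 + cos (t - s)) / 2) ^+ n.
have tT : trig_poly T.
  apply: trig_polyD; first exact: trig_poly_cst.
  apply: trig_polyZ; apply: trig_poly_sum => s; exact: trig_poly_bump.
have k0 s t : 0 <= ((1 + cos (t - s)) / 2) ^+ n.
  by rewrite exprn_ge0// divr_ge0//; have := cos_geN1 (t - s); lra.
have Ac : 0 < A / c2 ^+ n by rewrite divr_gt0 ?exprn_gt0.
have hT t : eta <= T t.
  by rewrite lerDl mulr_ge0 ?(ltW Ac)//; apply: sumr_ge0.
have [g hg] := poly_exp_cutoff tT eta0 hT.
exists g; split => t; first by case: (hg t).
- move=> /off[s sS hs]; have [_ h _] := hg t; apply: (le_trans h).
  have T0 : 0 < 1 + T t by rewrite addr_gt0// (lt_le_trans eta0).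
  rewrite -[e]invrK lef_pV2 ?posrE//.
  suff : A <= T t by rewrite /A; lra.
  have : A <= (A / c2 ^+ n) * \sum_(s <- S) ((1 + cos (t - s)) / 2) ^+ n.
    rewrite mulrAC ler_pdivlMr ?exprn_gt0// ler_pM2l//.
    apply: (@le_trans _ _ (((1 + cos (t - s)) / 2) ^+ n)).
      by rewrite lerXn2r ?nnegrE ?(ltW c20)// (le_trans _ hs)// ltW.
    rewrite (perm_big _ (perm_to_rem sS)) big_cons /= lerDl.
    by apply: sumr_ge0.
  by rewrite /T; lra.
- move=> ht; have [_ _] := hg t; apply: le_trans.
  suff : T t <= 2 * eta by rewrite /eta; lra.
  rewrite /T [2 * _]mulr_natl mulr2n lerD2l.
  apply: (@le_trans _ _ ((A / c2 ^+ n) * (m * c1 ^+ n))).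
    rewrite ler_pM2l//; have -> : m * c1 ^+ n = \sum_(s <- S) c1 ^+ n.
      by rewrite big_const_seq count_predT iter_addr_0 -[RHS]mulr_natl.
    rewrite big_seq [leRHS]big_seq; apply: ler_sum => s sS.
    by rewrite lerXn2r ?nnegrE// ?on// divr_ge0//; have := cos_geN1 (t - s); lra.
  have -> : A / c2 ^+ n * (m * c1 ^+ n) = A * m * (c1 / c2) ^+ n.
    have aux (x y z w : R) : x / y ^+ n * (w * z ^+ n) = x * w * (z / y) ^+ n.
      by rewrite expr_div_n -!mulrA; congr (_ * _); rewrite mulrC -mulrA.
    exact: aux.
  apply: (@le_trans _ _ (A * (m + 1) * (c1 / c2) ^+ n)).
    by rewrite ler_wpM2r ?exprn_ge0 ?divr_ge0 ?(ltW c20)// ler_pM2l// lerDl.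
  by rewrite mulrC -ler_pdivlMr ?ltW// mulr_gt0// ltr_wpDl.
Qed.

End ArcCutoff.

(** * Attaching discs along an arc *)

Section OneStep.
Context {R : realType}.
Local Notation C := (R[i]).
Local Notation spinor := ({poly C} * {poly C})%type.
Local Notation V := 'rV[R]_3.

Lemma compact_margin (W : normedModType R) (S omega : set W) :
  compact S -> open omega -> S `<=` omega ->
  exists2 rho : R, 0 < rho & forall x y, S x -> `|x - y| < rho -> omega y.
Proof.
move=> cS oo So.
have /compact_near_coveringP/(_ _ (0^'+ : set_system R)
  (fun e x => forall y, `|x - y| < e -> omega y)) := cS.
move=> /(_ _)[].
  move=> x Sx; have /nbhs_ballP[r /= r0 hr] : nbhs x omega.
    by apply: open_nbhs_nbhs; split => //; exact: So.
  have r20 : 0 < r / 2 by rewrite divr_gt0.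
  exists (ball x (r / 2), [set e | e < r / 2]).
    split => /=; first exact: nbhsx_ballx.
    exact: nbhs_right_lt.
  move=> [x' e] /= [xx' er] y x'y; apply: hr.
  move: xx'; rewrite -!ball_normE /= => xx'.
  rewrite (splitr r) (le_lt_trans (ler_distD x' _ _))// ltrD//.
  exact: lt_trans x'y er.
move=> r r0 h; exists (r / 2); first by rewrite divr_gt0.
move=> x y Sx xy; apply: (h (r / 2) _ _ x Sx y xy) => /=.
  by rewrite sub0r normrN gtr0_norm ?divr_gt0// ltr_pdivrMr// ltr_pMr// ltr1n.
by rewrite divr_gt0.
Qed.

Lemma ler_dist_cmod (z w : C) : `|cmod z - cmod w| <= cmod (z - w).
Proof.
have h a b : cmod a - cmod b <= cmod (a - b) :> R.
  by rewrite lerBlDr; have := cmodD (a - b) b; rewrite subrK.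
by rewrite ler_norml h lerNl opprB cmodBC h.
Qed.

Lemma compact_disc_image (c : V) s :
  compact [set x | exists2 z, cmod z <= 1 & x = disc c s z].
Proof.
pose F (z : R * R) := disc c s (z.1 +i* z.2)%C.
have [L L0 hL] := disc_lipschitz s.
pose A : set (R * R) := [set z | cmod (z.1 +i* z.2)%C <= 1].
have lipc (z w : R * R) : cmod ((z.1 +i* z.2)%C - (w.1 +i* w.2)%C) <= 2 * `|z - w|.
  have -> : (z.1 +i* z.2)%C - (w.1 +i* w.2)%C =
    (z.1 - w.1)%:C%C + 'i%C * (z.2 - w.2)%:C%C.
    by apply: complex_eq; rewrite !(cReD, cImD, cReN, cImN, cReM, cImM) /=; ring.
  apply: (le_trans (cmodD _ _)); rewrite cmodM !cmod_real cmodE expr0n add0r expr1n.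
  rewrite sqrtr1 mul1r mulr_natl mulr2n.
  by apply: lerD; rewrite prod_normE /= le_max lexx// orbT.
have cF : {within A, continuous F}.
  have L1 : 0 < L * 2 + 1 by rewrite ltr_wpDl// mulr_ge0.
  apply/subspace_continuousP => z Az; apply/cvgrPdist_lt => e e0.
  rewrite near_withinE; near=> w => Aw.
  apply: (le_lt_trans (hL _ _ _ Az Aw)).
  apply: (@le_lt_trans _ _ (L * 2 * `|z - w|)).
    by rewrite -mulrA ler_wpM2l.
  apply: (@le_lt_trans _ _ ((L * 2 + 1) * `|z - w|)).
    by rewrite ler_wpM2r// lerDl.
  rewrite mulrC -ltr_pdivlMr//.
  near: w; apply: (@cvgr_dist_lt _ _ _ _ _ id) => //.
  by rewrite divr_gt0.
have cA : compact A.
  have sub : A `<=` `[(-1 : R), 1] `*` `[(-1 : R), 1].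
    move=> z Az; split; rewrite /= in_itv /= -ler_norml.
      exact: le_trans (ler_Re_cmod (z.1 +i* z.2)%C) Az.
    exact: le_trans (ler_Im_cmod (z.1 +i* z.2)%C) Az.
  apply: (subclosed_compact _ _ sub); last first.
    by apply: compact_setX; exact: segment_compact.
  have -> : A = (fun z : R * R => cmod (z.1 +i* z.2)%C) @^-1` [set x | x <= 1] by [].
  apply: closed_comp; last exact: closed_le.
  move=> z _; apply: (@lipschitz_continuous _ _ _ _ 2) => {}z w.
  apply: le_trans (lipc z w).
  exact: ler_dist_cmod.
have -> : [set x | exists2 z, cmod z <= 1 & x = disc c s z] = F @` A.
  apply/seteqP; split => [x [z z1 ->]|_ [z Az <-]].
    by exists (complex.Re z, complex.Im z); rewrite /F /A /=; case: z z1.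
  by exists (z.1 +i* z.2)%C.
exact: continuous_compact.
Unshelve. all: by end_near. Qed.

Lemma compactD (W : normedModType R) (A B : set W) : compact A -> compact B ->
  compact [set x | exists2 a, A a & exists2 b, B b & x = a + b].
Proof.
move=> cA cB.
have -> : [set x | exists2 a, A a & exists2 b, B b & x = a + b] =
    (fun z : W * W => z.1 + z.2) @` (A `*` B).
  apply/seteqP; split => [x [a Aa [b Bb ->]]|_ [[a b] [Aa Bb] <-]].
    by exists (a, b).
  by exists a => //; exists b.
apply: continuous_compact; last exact: compact_setX.
apply: continuous_subspaceT => z.
by apply: cvgD; [exact: cvg_fst|exact: cvg_snd].
Qed.

Lemma disc_of_polar_lipschitz (c : V) s sg (q : {poly C}) :
  (forall t, cmod q.[expi t] <= 1) -> exists2 L, 0 <= L &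
  forall z w : R * R, `|disc (disc c s (expi z.1)) sg (expi z.2 * q.[expi z.1]) -
    disc (disc c s (expi w.1)) sg (expi w.2 * q.[expi w.1])| <= L * `|z - w|.
Proof.
move=> q1.
have [L L0 hL] := disc_lipschitz s; have [K K0 hK] := disc_lipschitz sg.
have [M M0 hM] := horner_lipschitz q ler01.
exists (L * 2 + K * (2 + M * 2)).
  by rewrite addr_ge0 ?mulr_ge0 ?addr_ge0// mulr_ge0.
move=> z w; have z1 : `|z.1 - w.1| <= `|z - w|.
  by rewrite prod_normE /= le_max lexx.
have z2 : `|z.2 - w.2| <= `|z - w|.
  by rewrite prod_normE /= le_max lexx orbT.
have e1 : cmod (expi z.1 - expi w.1) <= 2 * `|z - w|.
  by apply: (le_trans (expi_lip _ _)); rewrite ler_pM2l.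
have e2 : cmod (expi z.2 - expi w.2) <= 2 * `|z - w|.
  by apply: (le_trans (expi_lip _ _)); rewrite ler_pM2l.
have e1' := cmod_expi (R := R).
rewrite (discE (disc _ _ _)) (discE (disc c s (expi w.1))) opprD addrACA [leRHS]mulrDl.
apply: (le_trans (ler_normD _ _)); apply: lerD.
  by apply: (le_trans (hL _ _ _ _ _)); rewrite ?cmod_expi// -mulrA ler_wpM2l.
apply: (le_trans (hK _ _ _ _ _)); rewrite ?cmodM ?cmod_expi ?mul1r//.
rewrite -mulrA ler_wpM2l//.
have -> : expi z.2 * q.[expi z.1] - expi w.2 * q.[expi w.1] =
  (expi z.2 - expi w.2) * q.[expi z.1] + expi w.2 * (q.[expi z.1] - q.[expi w.1]).
  by ring.
rewrite [leRHS]mulrDl; apply: (le_trans (cmodD _ _)); apply: lerD.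
  by rewrite cmodM -[leRHS]mulr1 ler_pM ?cmod_ge0.
rewrite cmodM cmod_expi mul1r; apply: (le_trans (hM _ _ _ _)); rewrite ?cmod_expi//.
by rewrite -mulrA ler_wpM2l.
Qed.

Variables (omega : set V) (Phi : V -> R) (LP : R).
Hypotheses (oo : open omega) (LP0 : 0 <= LP)
  (lipP : forall x y, `|Phi x - Phi y| <= LP * `|x - y|)
  (P01 : forall x, 0 <= Phi x <= 1).

Lemma continuous_Phi_disc c s : continuous (fun t => Phi (disc c s (expi t))).
Proof.
move=> t; apply: (@continuous_comp _ _ _ (fun t => disc c s (expi t)) Phi).
  exact: continuous_disc.
exact: lipschitz_continuous lipP _.
Qed.

(** Rotating the circle absorbs the argument of v, so only the defect 1 - cmod v costs anything. *)
Lemma mean_disc_contract (c : V) sg (L : R) (v : C) :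
  (forall c z w, cmod z <= 1 -> cmod w <= 1 ->
    `|disc c sg z - disc c sg w| <= L * cmod (z - w)) -> 0 <= L -> cmod v <= 1 ->
  mean (fun th => Phi (disc c sg (expi th * v))) <=
  mean (fun th => Phi (disc c sg (expi th))) + LP * L * (1 - cmod v).
Proof.
move=> hL L0 v1.
have [tau tau2 ->] := polar v; set r := cmod v.
have r0 : 0 <= r := cmod_ge0 v.
have crE : cmod (r%:C%C : C) = r by rewrite cmod_real ger0_norm.
pose q th := Phi (disc c sg (expi th * r%:C%C)).
have cq : continuous q.
  apply: (@lipschitz_continuous _ _ _ _ (LP * (L * 2))) => x y.
  apply: (le_trans (lipP _ _)); rewrite -mulrA ler_wpM2l//.
  apply: (le_trans (hL _ _ _ _ _)); rewrite ?cmodM ?cmod_expi ?crE ?mul1r//.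
  rewrite -mulrA ler_wpM2l// -mulrBl cmodM crE.
  by apply: le_trans (expi_lip x y); rewrite ler_piMr ?cmod_ge0.
have -> : (fun th => Phi (disc c sg (expi th * (r%:C%C * expi tau)))) =
    (fun th => q (th + tau)).
  by apply/funext => th; rewrite /q expiD -!mulrA (mulrC (expi tau)).
rewrite mean_rotate//; last by move=> t; rewrite /q expi_sum2pi.
rewrite -(mean_cst (LP * L * (1 - cmod _))) -meanD; last 2 first.
- exact: continuous_Phi_disc.
- by move=> x; exact: cst_continuous.
apply: le_mean => //.
  move=> x; apply: cvgD; last exact: cvg_cst.
  exact: continuous_Phi_disc.
move=> t _; rewrite -lerBlDl (le_trans (ler_norm _))// (le_trans (lipP _ _))//.
rewrite -mulrA ler_wpM2l// (le_trans (hL _ _ _ _ _)) ?cmodM ?cmod_expi ?crE ?mul1r//.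
rewrite ler_wpM2l// cmodBC -{1}[expi t]mulr1 -mulrBr cmodM cmod_expi mul1r mulr1.
have -> : 1 - r%:C%C = (1 - r)%:C%C :> C by rewrite rmorphB.
by rewrite cmod_real ger0_norm ?subr_ge0.
Qed.

End OneStep.

Section OneStepLemma.
Context {R : realType}.
Local Notation C := (R[i]).
Local Notation spinor := ({poly C} * {poly C})%type.
Local Notation V := 'rV[R]_3.

Lemma pos_small (A e : R) : 0 <= A -> 0 < e -> exists2 d, 0 < d & A * d <= e.
Proof.
move=> A0 e0; have A1 : 0 < A + 1 by rewrite ltr_wpDl.
exists (e / (A + 1)); first by rewrite divr_gt0.
by rewrite mulrCA ler_piMr ?(ltW e0)// ler_pdivrMr// mul1r lerDl.
Qed.

(** The first inequality controls the deformation error, the second makes the attached term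
    negligible on a smaller concentric disc. *)
Lemma one_step_choose_k (A B r d : R) : 0 <= A -> 0 <= B -> 0 <= r < 1 -> 0 < d ->
  exists k, A / (2 * k + 1)%:R <= d /\ B * r ^+ ((2 * k + 1) ^ 2) <= d.
Proof.
move=> A0 B0 r01 d0; have /andP[r0 r1] := r01.
have [e e0 Be] := pos_small B0 d0.
have [n hn] := expr_small r01 e0.
have [m _ hm] := exists_nat_gt (A / d).
exists (n + m)%N; split.
  rewrite ler_pdivrMr ?ltr0n ?addn1// mulrC -ler_pdivrMr// ltW//.
  by apply: (lt_le_trans hm); rewrite ler_nat; clear; lia.
apply: (le_trans _ Be); rewrite ler_wpM2l//.
apply: (le_trans _ (ltW hn)).
by rewrite ler_wiXn2l// ?ltW//; clear; nia.
Qed.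

(* The attached discs are rotated by a phase chosen by averaging, so that following
   only one point of each attached boundary realises the mean of Phi. *)
Lemma one_step (omega : set V) (Phi : V -> R) (LP : R)
  (oo : open omega) (LP0 : 0 <= LP)
  (lipP : forall x y, `|Phi x - Phi y| <= LP * `|x - y|)
  (P01 : forall x, 0 <= Phi x <= 1)
  (c : V) s sg (al be : R) (m : R -> R) (e : R) :
  0 <= al -> al < be -> be <= 2 * pi -> continuous m -> 0 < e ->
  (forall z, cmod z <= 1 -> omega (disc c s z)) ->
  (forall t z, al <= t <= be -> cmod z <= 1 ->
    omega (disc (disc c s (expi t)) sg z)) ->
  (forall t, al <= t <= be ->
    mean (fun th => Phi (disc (disc c s (expi t)) sg (expi th))) <= m t) ->
  exists s', [/\ forall z, cmod z <= 1 -> omega (disc c s' z),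
    forall t, 0 <= t <= al \/ be <= t <= 2 * pi ->
      `|disc c s' (expi t) - disc c s (expi t)| <= e &
    rint al be (fun t => Phi (disc c s' (expi t))) <= rint al be m + e].
Proof.
move=> al0 ab be2 cm e0 hs hsg hm; have p0 := twopi_gt0 (R := R).
pose S1 := [set x | exists2 z, cmod z <= 1 & x = disc c s z].
pose S2 := [set x | exists2 a, ((fun t => disc c s (expi t)) @` `[al, be]%classic) a &
  exists2 b, [set x | exists2 z, cmod z <= 1 & x = disc 0 sg z] b & x = a + b].
have S2c : compact S2.
  apply: compactD; last exact: compact_disc_image.
  apply: continuous_compact; last exact: segment_compact.
  apply: continuous_subspaceT; exact: continuous_disc.
have S1o : S1 `<=` omega by move=> _ [z z1 ->]; exact: hs.
have S2o : S2 `<=` omega.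
  move=> _ [_ [t /= + <-] [_ [z z1 ->] ->]]; rewrite in_itv /= => ht.
  by rewrite -discE; exact: hsg.
have [r1 r10 hr1] := compact_margin (@compact_disc_image _ c s) oo S1o.
have [r2 r20 hr2] := compact_margin S2c oo S2o.
have [Lf Lf0 hLf] := disc_lipschitz s.
have [Lg Lg0 hLg] := disc_lipschitz sg.
pose e' := Num.min (Num.min r1 r2) e.
have e'0 : 0 < e' by rewrite !lt_min r10 r20.
have [d0' d0'0 hd0'] := pos_small (mulr_ge0 (ltW p0) LP0) e0.
pose d := Num.min (d0' / 8) (e' / 8).
have d0 : 0 < d by rewrite lt_min !divr_gt0.
have dr1 : 8 * d <= r1.
  have : d <= e' / 8 by rewrite ge_min lexx orbT.
  have : e' <= r1 by rewrite /e' !ge_min lexx.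
  lra.
have dr2 : 8 * d <= r2.
  have : d <= e' / 8 by rewrite ge_min lexx orbT.
  have : e' <= r2 by rewrite /e' !ge_min lexx orbT.
  lra.
have de : 8 * d <= e.
  have : d <= e' / 8 by rewrite ge_min lexx orbT.
  have : e' <= e by rewrite /e' !ge_min lexx !orbT.
  lra.
have dP : 2 * pi * LP * (8 * d) <= e.
  have dd : 8 * d <= d0'.
    have : d <= d0' / 8 by rewrite ge_min lexx.
    lra.
  by apply: (le_trans _ hd0'); rewrite ler_wpM2l// mulr_ge0// ltW.
have [e1 e10 he1] := pos_small Lg0 d0.
(* On the two end zones of length ka the cutoff is in transition and Phi is bounded by 1 only, so ka
   is charged to the error. *)
pose ka := Num.min (e / 8) ((be - al) / 4).
have ka0 : 0 < ka by rewrite lt_min !divr_gt0// subr_gt0.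
have kae : ka <= e / 8 by rewrite ge_min lexx.
have kab : al + ka <= be - ka.
  have : ka <= (be - al) / 4 by rewrite ge_min lexx orbT.
  lra.
have [g [g1 goff gon]] := arc_cutoff ka0 al0 be2 kab e10.
have [L2 L20 hL2] := horner_lipschitz (g ^+ 2) ler01.
pose B := nrm1 (g ^+ 2) + 1.
have B0 : 0 <= B by rewrite addr_ge0 ?nrm1_ge0.
have [Lh Lh0 hLh] := disc_lipschitz_on sg B0.
have [K K0 hK] := disc_rh s sg g.
have [k1 k10 hk1] := pos_small Lf0 d0.
have [k2 k20 hk2] := pos_small (mulr_ge0 Lh0 L20) d0.
(* Width of a collar along the circle: pushing z radially to the circle, with the power z ^+ n kept,
   moves the original disc and the attached one by at most d each. *)
pose kp := Num.min (Num.min k1 k2) (1 / 2).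
have kp0 : 0 < kp by rewrite !lt_min k10 k20 divr_gt0.
have kp1 : kp <= k1 by rewrite !ge_min lexx.
have kp2 : kp <= k2 by rewrite !ge_min lexx orbT.
have kp3 : kp <= 1 / 2 by rewrite !ge_min lexx !orbT.
have rk : 0 <= 1 - kp < 1.
  by move: kp0 kp3; clear => *; apply/andP; split; lra.
have [k [hk hkB]] := one_step_choose_k K0 (mulr_ge0 Lh0 (nrm1_ge0 (g ^+ 2))) rk d0.
set n := ((2 * k + 1) ^ 2)%N in hK hkB.
pose q := g ^+ 2 * 'X^n.
have qE z : q.[z] = g.[z] ^+ 2 * z ^+ n by rewrite hornerM hornerXn horner_exp.
have q1 t : cmod q.[expi t] <= 1.
  by rewrite qE cmodM !cmodX cmod_expi expr1n mulr1 exprn_ile1 ?cmod_ge0.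
have qX t : cmod q.[expi t] = cmod g.[expi t] ^+ 2.
  by rewrite qE cmodM !cmodX cmod_expi expr1n mulr1.
pose H (z : R * R) := Phi (disc (disc c s (expi z.1)) sg (expi z.2 * q.[expi z.1])).
have cH : continuous H.
  have [L L0 hL] := disc_of_polar_lipschitz c s sg q1.
  apply: (@lipschitz_continuous _ _ _ _ (LP * L)) => z w.
  by apply: (le_trans (lipP _ _)); rewrite -mulrA ler_wpM2l.
have H0 z : 0 <= H z by case/andP: (P01 (disc (disc c s (expi z.1)) sg (expi z.2 * q.[expi z.1]))).
pose m' t := m t + LP * d.
have cm' : continuous m' by move=> x; apply: cvgD; [exact: cm|exact: cvg_cst].
have hm' t : al + ka <= t <= be - ka -> mean (fun th => H (t, th)) <= m' t.
  move=> ht; have htab : al <= t <= be.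
    by move: ka0 ht; clear => ? /andP[? ?]; apply/andP; split; lra.
  rewrite /H /=; apply: (le_trans (mean_disc_contract LP0 lipP _ hLg Lg0 (q1 t))).
  apply: lerD; first exact: hm.
  rewrite -mulrA ler_wpM2l// (le_trans _ he1)// ler_wpM2l// qX.
  by move: (gon t ht); clear => ?; lra.
have e80 : 0 < e / 8 by rewrite divr_gt0.
have [th th2 hth] := exists_phase cH H0 kab cm' hm' e80.
(* Half the phase, since the spinor enters quadratically. *)
pose u := expi (th / 2).
have u1 : cmod u = 1 by rewrite cmod_expi.
have u2 : u ^+ 2 = expi th by rewrite expiX mulr2n -splitr.
pose s' := rhspinor s sg g u k.
have F z : cmod z <= 1 -> `|disc c s' z - (disc c s z + disc 0 sg (u ^+ 2 * q.[z]))| <= d.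
  by move=> z1; rewrite qE mulrA; apply: le_trans (hK k u c z u1 z1) hk.
have phi0 z : cmod z <= 1 -> `|disc 0 sg z| <= Lg * cmod z.
  by move=> z1; have := hLg 0 z 0 z1; rewrite disc0 !subr0 cmod0; apply.
have offt t : 0 <= t <= al \/ be <= t <= 2 * pi -> Lg * cmod q.[expi t] <= d.
  by move=> ht; apply: (le_trans _ he1); rewrite ler_wpM2l// qX goff.
have near_margin a z : cmod z <= 1 -> forall b, `|disc 0 sg (u ^+ 2 * q.[z]) - b| <= d ->
    `|disc c s z - a| <= d -> `|a + b - disc c s' z| <= 3 * d.
  move=> z1 b hb ha; have := F z z1.
  set x := disc c s' z; set y := disc c s z in ha *.
  set w := disc 0 sg _ in hb *; rewrite (distrC x) => hx.
  have -> : a + b - x = (y + w - x) + ((a - y) + (b - w)).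
    by apply/rowP => i; rewrite !mxE; ring.
  apply: (le_trans (ler_normD _ _)).
  move: (ler_normD (a - y) (b - w)) hx hb ha; rewrite (distrC a) (distrC b).
  by clear => *; lra.
have qB z : cmod z <= 1 -> cmod (u ^+ 2 * q.[z]) <= B.
  move=> z1; rewrite cmodM cmodX u1 expr1n mul1r qE cmodM cmodX.
  rewrite (_ : cmod g.[z] ^+ 2 = cmod (g ^+ 2).[z]); last by rewrite horner_exp cmodX.
  rewrite cmodX (@le_trans _ _ (cmod (g ^+ 2).[z]))//.
    by rewrite ler_piMr ?cmod_ge0// exprn_ile1 ?cmod_ge0.
  by rewrite (le_trans (horner_le_nrm1 _ z1))// lerDl.
exists s'; split.
- move=> z z1.
  (* Away from the circle the power z ^+ n kills the attached term, and the new disc is close to the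
     old one. In the collar the slowly varying data are frozen at z0 = z / cmod z. *)
  have [zk|zk] := leP (cmod z) (1 - kp).
    apply: (hr1 (disc c s z)); first by exists z.
    rewrite -[disc c s z]addr0; apply: (@le_lt_trans _ _ (3 * d)); last by move: d0 dr1; clear => *; lra.
    apply: near_margin => //; last by rewrite subrr normr0 ltW.
    rewrite -[X in _ - X](disc0 0 sg) (le_trans (hLh _ _ _ _ _)) ?qB ?cmod0// subr0.
    rewrite cmodM cmodX u1 expr1n mul1r (le_trans _ hkB)// -(mulrA Lh) ler_wpM2l//.
    rewrite /q hornerM hornerXn cmodM cmodX; apply: ler_pM; rewrite ?exprn_ge0 ?cmod_ge0//.
      exact: horner_le_nrm1.
    by rewrite lerXn2r ?nnegrE ?cmod_ge0//; case/andP: rk.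
  have [t t2 zE] := polar z; set z0 := expi t in zE.
  have z01 : cmod z0 <= 1 by rewrite cmod_expi.
  have zz0 : cmod (z - z0) <= kp.
    rewrite zE cmodBC -{1}[z0]mul1r -mulrBl cmodM cmod_expi mulr1.
    have -> : 1 - (cmod z)%:C%C = (1 - cmod z)%:C%C :> C by rewrite rmorphB.
    by rewrite cmod_real ger0_norm ?subr_ge0//; move: zk; clear => *; lra.
  have fz : `|disc c s z - disc c s z0| <= d.
    rewrite (le_trans (hLf _ _ _ _ _))// (le_trans _ hk1)// ler_wpM2l//.
    exact: le_trans zz0 kp1.
  (* Only g is frozen: the power z ^+ n varies too fast. Still cmod w' <= 1, so w' is a legitimate
     parameter of the disc attached at z0. *)
  pose w' := u ^+ 2 * (g.[z0] ^+ 2 * z ^+ n).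
  have w'1 : cmod w' <= cmod q.[z0].
    rewrite /w' cmodM cmodX u1 expr1n mul1r qX cmodM !cmodX.
    by rewrite ler_piMr ?exprn_ge0 ?cmod_ge0// exprn_ile1 ?cmod_ge0.
  have w'B : cmod w' <= B by rewrite (le_trans w'1)// (le_trans (q1 t))// lerDr nrm1_ge0.
  have pw : `|disc 0 sg (u ^+ 2 * q.[z]) - disc 0 sg w'| <= d.
    rewrite (le_trans (hLh _ _ _ _ _)) ?qB// (le_trans _ hk2)// -(mulrA Lh) ler_wpM2l//.
    rewrite /w' qE -mulrBr -mulrBl cmodM cmodX u1 expr1n mul1r cmodM cmodX.
    rewrite (le_trans (ler_piMr _ _)) ?cmod_ge0// ?exprn_ile1 ?cmod_ge0//.
    have := hL2 z z0 z1 z01; rewrite !horner_exp => /le_trans; apply.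
    by rewrite ler_wpM2l// (le_trans zz0).
  (* Over the arc the attached disc lies in omega by hypothesis; elsewhere the cutoff makes w' so
     small that the new disc stays near the old one. *)
  have [ht|ht] := boolP (al <= t <= be).
    apply: (hr2 (disc c s z0 + disc 0 sg w')).
      exists (disc c s z0); first by exists t => //; rewrite /= in_itv.
      exists (disc 0 sg w') => //; exists w' => //.
      exact: le_trans w'1 (q1 t).
    apply: (@le_lt_trans _ _ (3 * d)); first exact: near_margin.
    by move: d0 dr2; clear => *; lra.
  apply: (hr1 (disc c s z0)); first by exists z0.
  have hw' : `|disc 0 sg w'| <= d.
    have toff : 0 <= t <= al \/ be <= t <= 2 * pi; last first.
      apply: (le_trans (phi0 _ (le_trans w'1 (q1 t)))).
      by apply: (le_trans _ (offt t toff)); rewrite ler_wpM2l.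
    case/andP: t2 => t0 t2; case: (ltP t al) => [h|h]; [left|right].
      by rewrite t0 ltW.
    by rewrite t2 andbT leNgt; apply: contra ht => h2; rewrite h ltW.
  move: (near_margin (disc c s z0) z z1 (disc 0 sg w') pw fz) hw' d0 dr1.
  move: (ler_normD (disc c s z0 + disc 0 sg w' - disc c s' z) (- disc 0 sg w')).
  rewrite normrN (_ : _ - disc c s' z - disc 0 sg w' = disc c s z0 - disc c s' z); last by rewrite addrAC addrK.
  by clear => *; lra.
- move=> t ht; have := F (expi t); rewrite cmod_expi lexx => /(_ isT) Ft.
  have := ler_normD (disc c s' (expi t) - (disc c s (expi t) + disc 0 sg (u ^+ 2 * q.[expi t])))
      (disc 0 sg (u ^+ 2 * q.[expi t])).
  rewrite (_ : _ - _ + disc 0 sg _ = disc c s' (expi t) - disc c s (expi t)); last by rewrite opprD addrA subrK.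
  have := phi0 (u ^+ 2 * q.[expi t]); rewrite cmodM cmodX u1 expr1n mul1r => /(_ (q1 t)).
  by move: Ft (offt t ht) de d0; clear => *; lra.
- have cPs : continuous (fun t => Phi (disc c s' (expi t))).
    move=> x; exact: (continuous_Phi_disc lipP).
  have ab1 : al <= al + ka by rewrite lerDl ltW.
  have ab3 : be - ka <= be by rewrite gerBl ltW.
  have Ple a b : a <= b -> rint a b (fun t => Phi (disc c s' (expi t))) <= b - a.
    move=> hab; rewrite -[leRHS]mul1r; apply: le_rint_cst => // t _.
    by case/andP: (P01 (disc c s' (expi t))).
  have m0 t : al <= t <= be -> 0 <= m t.
    move=> /hm; apply: le_trans; apply: mean_ge0 => x _.
    by case/andP: (P01 (disc (disc c s (expi t)) sg (expi x))).
  (* On the inner arc the new boundary follows the points defining H (t, th) up to d, and th was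
     chosen so that this integral is almost at most that of m. *)
  have mid : rint (al + ka) (be - ka) (fun t => Phi (disc c s' (expi t))) <=
      rint (al + ka) (be - ka) m + e / 8 + 2 * pi * LP * (2 * d).
    have cHt : continuous (fun t => H (t, th)).
      move=> x; apply: (@continuous_comp _ _ _ (fun t => (t, th)) H); last exact: cH.
      apply: (@cvg_pair _ _ _ _ (nbhs x) (nbhs th)); [exact: cvg_id|exact: cvg_cst].
    have cst k' : continuous (fun _ : R => k' : R) by move=> x; exact: cst_continuous.
    apply: (@le_trans _ _ (rint (al + ka) (be - ka) (fun t => H (t, th) + LP * d))).
      apply: le_rint => //; first by move=> x; apply: cvgD; [exact: cHt|exact: cvg_cst].
      move=> t _; rewrite -lerBlDl (le_trans (ler_norm _))// (le_trans (lipP _ _))//.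
      rewrite ler_wpM2l// /H /= -u2 (discE (disc _ _ _)).
      by have := F (expi t); rewrite cmod_expi; apply.
    rewrite rintD// rint_cst// (le_trans (lerD hth (lexx _)))//.
    rewrite rintD// rint_cst//.
    have : LP * d * (be - ka - (al + ka)) <= LP * d * (2 * pi).
      rewrite ler_wpM2l ?mulr_ge0 ?(ltW d0)//.
      by move: al0 be2 ka0; clear => *; lra.
    by clear => *; lra.
  rewrite (rint_split (b := al + ka) (a := al) (c := be))//; last by apply: (le_trans kab).
  rewrite (rint_split (b := be - ka) (a := al + ka) (c := be))//.
  have := Ple _ _ ab1; have := Ple _ _ ab3.
  have : rint (al + ka) (be - ka) m <= rint al be m.
    rewrite (rint_split (b := al + ka) (a := al) (c := be))//; last by apply: (le_trans kab).
    rewrite (rint_split (b := be - ka) (a := al + ka) (c := be))//.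
    have i1 : 0 <= rint al (al + ka) m.
      apply: rint_ge0 => t /andP[t1 t2]; apply: m0; apply/andP.
      by move: t1 t2 ab kab ka0; clear => *; split; lra.
    have i2 : 0 <= rint (be - ka) be m.
      apply: rint_ge0 => t /andP[t1 t2]; apply: m0; apply/andP.
      by move: t1 t2 ab kab ka0; clear => *; split; lra.
    by move: i1 i2; clear => *; lra.
  by move: mid dP kae e0; clear => *; lra.
Qed.

End OneStepLemma.

(** * The envelope over null discs *)

Section Envelope.
Context {R : realType}.
Local Notation C := (R[i]).
Local Notation spinor := ({poly C} * {poly C})%type.
Local Notation V := 'rV[R]_3.
Variables (omega : set V) (Phi : V -> R) (LP D : R).
Hypotheses (oo : open omega) (LP0 : 0 <= LP)
  (lipP : forall x y, `|Phi x - Phi y| <= LP * `|x - y|)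
  (P01 : forall x, 0 <= Phi x <= 1)
  (cvx : forall x y (t : R), omega x -> omega y -> 0 <= t <= 1 ->
    omega ((1 - t) *: x + t *: y))
  (D0 : 0 <= D) (hD : forall x y, omega x -> omega y -> `|x - y| <= D).

Definition admissible (x : V) (s : spinor) :=
  forall z, cmod z <= 1 -> omega (disc x s z).

Definition disc_mean (x : V) s : R := mean (fun t => Phi (disc x s (expi t))).

(** The Poletsky envelope of Phi over null discs in omega. On omega the infimum is over a nonempty
    set of nonnegative numbers. *)
Definition env (x : V) : R := inf [set r | exists2 s, admissible x s & r = disc_mean x s].

Lemma disc_mean_ge0 x s : 0 <= disc_mean x s.
Proof. by apply: mean_ge0 => t _; case/andP: (P01 (disc x s (expi t))). Qed.

Lemma continuous_Phi_disc' x s : continuous (fun t => Phi (disc x s (expi t))).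
Proof. by move=> t; exact: (continuous_Phi_disc lipP). Qed.

Lemma env_has_inf x : omega x ->
  has_inf [set r | exists2 s, admissible x s & r = disc_mean x s].
Proof.
move=> ox; split; last by exists 0 => _ [s _ ->]; exact: disc_mean_ge0.
by exists (disc_mean x (0, 0)), (0, 0) => // z _; rewrite disc_trivial.
Qed.

Lemma env_le x s : omega x -> admissible x s -> env x <= disc_mean x s.
Proof.
move=> ox hs; apply: ge_inf; last by exists s.
by case: (env_has_inf ox).
Qed.

Lemma env_approx x e : omega x -> 0 < e ->
  exists2 s, admissible x s & disc_mean x s < env x + e.
Proof.
by move=> ox e0; have [_ [s hs ->] h] := inf_adherent e0 (env_has_inf ox); exists s.
Qed.

Lemma env_le_Phi x : omega x -> env x <= Phi x.
Proof.
move=> ox; have := @env_le x (0, 0) ox; rewrite /disc_mean.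
have -> : (fun t => Phi (disc x (0, 0) (expi t))) = (fun=> Phi x).
  by apply/funext => t; rewrite disc_trivial.
by rewrite mean_cst; apply => z _; rewrite disc_trivial.
Qed.

Lemma env_le1 x : omega x -> env x <= 1.
Proof. by move=> /env_le_Phi/le_trans; apply; case/andP: (P01 x). Qed.

(** By convexity the homothety of ratio 1 - d centred at z keeps the disc in omega; it moves points
    by at most D * d, hence Phi by at most LP * D * d. *)
Lemma contract_disc x z y s d : omega z -> admissible x s -> 0 <= d <= 1 ->
  y = (1 - d) *: x + d *: z ->
  admissible y (scale_spinor (1 - d) s) /\
  disc_mean y (scale_spinor (1 - d) s) <= disc_mean x s + LP * D * d.
Proof.
move=> oz hs d01 yE; have /andP[d0 d1] := d01.
have d1' : 0 <= 1 - d by rewrite subr_ge0.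
have E w : disc y (scale_spinor (1 - d) s) w = (1 - d) *: disc x s w + d *: z.
  by rewrite disc_scale// (discE x) scalerDr yE addrAC.
split; first by move=> w w1; rewrite E; apply: cvx => //; exact: hs.
rewrite /disc_mean -(mean_cst (LP * D * d)) -meanD; last 2 first.
- exact: continuous_Phi_disc'.
- by move=> ?; exact: cst_continuous.
apply: le_mean; first exact: continuous_Phi_disc'.
  move=> t; apply: cvgD; last exact: cvg_cst.
  exact: continuous_Phi_disc'.
move=> t _; rewrite -lerBlDl (le_trans (ler_norm _))// (le_trans (lipP _ _))//.
rewrite -mulrA ler_wpM2l// E.
have ot : omega (disc x s (expi t)) by apply: hs; rewrite cmod_expi.
have -> : (1 - d) *: disc x s (expi t) + d *: z - disc x s (expi t) =
    d *: (z - disc x s (expi t)).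
  by move: (disc x s _) => X; apply/rowP => i; rewrite !mxE; ring.
by rewrite normrZ ger0_norm// mulrC ler_wpM2r// hD.
Qed.

Lemma env_contract x z d : omega x -> omega z -> 0 <= d <= 1 ->
  env ((1 - d) *: x + d *: z) <= env x + LP * D * d.
Proof.
move=> ox oz d01; apply/ler_addgt0Pr => e e0.
have [s hs se] := env_approx ox e0.
have [h1 h2] := contract_disc oz hs d01 erefl.
have oy : omega ((1 - d) *: x + d *: z) by exact: cvx.
apply: (le_trans (env_le oy h1)); apply: (le_trans h2); lra.
Qed.

Lemma contract_point x y r d : (forall z, `|x - z| < r -> omega z) -> 0 < r ->
  0 < d -> `|x - y| < d * r -> exists2 z, omega z & y = (1 - d) *: x + d *: z.
Proof.
move=> hr r0 d0 xy; exists (x + d^-1 *: (y - x)).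
  apply: hr; rewrite opprD addNKr normrN normrZ gtr0_norm ?invr_gt0//.
  by rewrite mulrC ltr_pdivrMr// mulrC distrC.
rewrite scalerDr scalerA divff ?gt_eqF// scale1r.
by apply/rowP => i; rewrite !mxE; ring.
Qed.

(** Every y this close to x is the image of x under a homothety of ratio 1 - d centred in omega. *)
Lemma env_lip x y r d : omega x -> (forall z, `|x - z| < r -> omega z) -> 0 < r ->
  0 < d <= 1 -> `|x - y| < d * r -> env y <= env x + LP * D * d.
Proof.
move=> ox hr r0 /andP[d0 d1] xy; have [z oz ->] := contract_point hr r0 d0 xy.
by apply: env_contract => //; rewrite ltW.
Qed.

Lemma env_continuous x : omega x -> {for x, continuous env}.
Proof.
move=> ox; have /nbhs_ballP[r /= r0 hr] : nbhs x omega by exact: open_nbhs_nbhs.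
have r20 : 0 < r / 2 by rewrite divr_gt0.
have hx z : `|x - z| < r -> omega z by move=> h; apply: hr; rewrite -ball_normE.
have hy y z : `|x - y| < r / 2 -> `|y - z| < r / 2 -> omega z.
  move=> h1 h2; apply: hx; rewrite (splitr r).
  by rewrite (le_lt_trans (ler_distD y _ _))// ltrD.
apply: continuous_at_normP => e e0.
have [d d0 hd] := pos_small (mulr_ge0 LP0 D0) e0.
pose d' := Num.min d 1.
have d'0 : 0 < d' <= 1 by rewrite lt_min d0 ltr01 ge_min lexx orbT.
have hd' : LP * D * d' <= e.
  by apply: (le_trans _ hd); rewrite ler_wpM2l ?mulr_ge0// ge_min lexx.
have m0 : 0 < d' * (r / 2) by rewrite mulr_gt0//; case/andP: d'0.
exists (d' * (r / 2)) => // y xy.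
have xy2 : `|x - y| < r / 2.
  by apply: (lt_le_trans xy); rewrite ler_piMl ?(ltW r20)//; case/andP: d'0.
have oy : omega y by apply: (hy x) => //; rewrite subrr normr0.
have h1 : env y <= env x + LP * D * d'.
  apply: (@env_lip x y (r / 2)) => // z; apply: hy; by rewrite subrr normr0.
have h2 : env x <= env y + LP * D * d'.
  by apply: (@env_lip y x (r / 2)) => // [z|]; [exact: hy|rewrite distrC].
by rewrite ler_norml; apply/andP; split; lra.
Qed.

Lemma continuous_env_disc x s : admissible x s ->
  continuous (fun t => env (disc x s (expi t))).
Proof.
move=> hs t; apply: (@continuous_comp _ _ _ (fun t => disc x s (expi t)) env).
  exact: continuous_disc.
by apply: env_continuous; apply: hs; rewrite cmod_expi.
Qed.

(** Cut the circle into arcs so short that one nearly optimal disc, taken at the left end of an arc,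
    serves all of that arc after a small homothety. Attaching these discs arc by arc yields a disc
    about c whose mean exceeds that of env by at most e. *)
Lemma env_submean c s0 : admissible c s0 ->
  env c <= mean (fun t => env (disc c s0 (expi t))).
Proof.
move=> h0; have p0 := twopi_gt0 (R := R).
have oc : omega c by rewrite -(disc0 c s0); apply: h0; rewrite cmod0.
apply/ler_addgt0Pr => e e0.
pose m0 t := env (disc c s0 (expi t)).
have cm0 : continuous m0 by exact: continuous_env_disc.
have of0 t : omega (disc c s0 (expi t)) by apply: h0; rewrite cmod_expi.
have sub0 : [set x | exists2 z, cmod z <= 1 & x = disc c s0 z] `<=` omega.
  by move=> _ [z z1 ->]; exact: h0.
have [r r0 hr] := compact_margin (@compact_disc_image _ c s0) oo sub0.
have hrt t z : `|disc c s0 (expi t) - z| < r -> omega z.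
  by apply: hr; exists (expi t) => //; rewrite cmod_expi.
have [L L0 hL] := disc_lipschitz s0.
have lipf t t' : `|disc c s0 (expi t) - disc c s0 (expi t')| <= L * 2 * `|t - t'|.
  rewrite (le_trans (hL _ _ _ _ _)) ?cmod_expi// -mulrA ler_wpM2l//.
  exact: expi_lip.
have e40 : 0 < e / 4 by rewrite divr_gt0.
(* The amount LP * D * d is spent twice on each arc, for moving the nearly optimal disc and for
   comparing env at two points of the arc. So e / 8 is allowed for it. *)
have [d1 d10 hd1] := pos_small (mulr_ge0 LP0 D0) (divr_gt0 e40 (ltr0n _ 2)).
pose d := Num.min d1 1.
have d01 : 0 < d <= 1 by rewrite lt_min d10 ltr01 ge_min lexx orbT.
have d0 : 0 < d by case/andP: d01.
have hd : LP * D * d <= e / 4 / 2.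
  by apply: (le_trans _ hd1); rewrite ler_wpM2l ?mulr_ge0// ge_min lexx.
pose dr := d * r / 4.
have dr0 : 0 < dr by rewrite divr_gt0// mulr_gt0.
have [N N0 hN] := exists_nat_gt (L * 2 * (2 * pi) / dr).
have NR : 0 < N%:R :> R by rewrite ltr0n.
pose step : R := 2 * pi / N%:R.
have step0 : 0 < step by rewrite divr_gt0.
have hstep t t' : `|t - t'| <= step -> `|disc c s0 (expi t) - disc c s0 (expi t')| <= dr.
  move=> tt; apply: (le_trans (lipf t t')).
  apply: (@le_trans _ _ (L * 2 * step)); first by rewrite ler_wpM2l ?mulr_ge0.
  by rewrite /step mulrA ler_pdivrMr// [dr * _]mulrC -ler_pdivrMr// ltW.
pose Cn : R := N%:R * (2 * pi * LP + 1).
have Cn0 : 0 <= Cn by rewrite mulr_ge0// addr_ge0// mulr_ge0// ltW.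
have [eta1 eta10 heta1] := pos_small Cn0 e40.
have [eta2 eta20 heta2] := pos_small (ler0n R N) dr0.
pose eta := Num.min eta1 eta2.
have eta0 : 0 < eta by rewrite lt_min eta10.
have hetaC : Cn * eta <= e / 4.
  by apply: (le_trans _ heta1); rewrite ler_wpM2l// ge_min lexx.
have hetaN : N%:R * eta <= dr.
  by apply: (le_trans _ heta2); rewrite ler_wpM2l// ge_min lexx orbT.
pose e2 := e / 2.
have stepN (k : nat) : (k <= N)%N -> k%:R * step <= 2 * pi.
  by move=> kN; rewrite /step mulrA ler_pdivrMr// [leRHS]mulrC ler_pM2r// ler_nat.
(* Untreated arcs still follow the original disc up to k * eta, which keeps the homotheties
   available. A further attachment moves the treated arcs by at most eta, costing 2 * pi * LP * eta,
   and has its own error eta. *)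
have claim k : (k <= N)%N -> exists s, [/\ admissible c s,
    forall t, k%:R * step <= t <= 2 * pi ->
      `|disc c s (expi t) - disc c s0 (expi t)| <= k%:R * eta &
    rint 0 (k%:R * step) (fun t => Phi (disc c s (expi t))) <=
    rint 0 (k%:R * step) m0 + e2 * (k%:R * step) + k%:R * (2 * pi * LP + 1) * eta].
  elim: k => [_|k IH kN].
    exists s0; split => //; first by move=> t _; rewrite subrr normr0 mul0r.
    rewrite !(mulr0n, mul0r) !rint_pt. by rewrite mulr0 !addr0.
  have {IH} [s [hs hclose hint]] := IH (ltnW kN).
  pose al : R := k%:R * step; pose be : R := k.+1%:R * step.
  have beE : be = al + step by rewrite /be /al -natr1 mulrDl mul1r.
  have al0 : 0 <= al by rewrite mulr_ge0// ltW.
  have ab : al < be by rewrite beE ltrDl.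
  have be2 : be <= 2 * pi by exact: stepN.
  have kdr : k%:R * eta <= dr.
    by apply: (le_trans _ hetaN); rewrite ler_pM2r// ler_nat ltnW.
  have [s1 hs1 hs1m] := env_approx (of0 al) (divr_gt0 e40 (ltr0n _ 1)).
  rewrite divr1 in hs1m.
  have near_al t : al <= t <= be -> `|disc c s0 (expi al) - disc c s (expi t)| < d * r.
    move=> /andP[t1 t2]; have h1 := hclose t _.
    have : `|disc c s0 (expi al) - disc c s0 (expi t)| <= dr.
      by apply: hstep; rewrite distrC ger0_norm ?subr_ge0//; lra.
    have := h1; rewrite t1 (le_trans t2 be2) => /(_ isT).
    have := ler_distD (disc c s0 (expi t)) (disc c s0 (expi al)) (disc c s (expi t)).
    rewrite (distrC (disc c s0 (expi t))).
    have : 4 * dr = d * r by rewrite /dr; field.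
    by move: dr0 kdr; lra.
  have d01' : 0 <= d <= 1 by case/andP: d01 => /ltW -> ->.
  pose sg := scale_spinor (1 - d) s1.
  have hsg t : al <= t <= be -> admissible (disc c s (expi t)) sg /\
      disc_mean (disc c s (expi t)) sg <= m0 t + e2.
    move=> ht; have [z oz yE] := contract_point (@hrt al) r0 d0 (near_al t ht).
    have [h1 h2] := contract_disc oz hs1 d01' yE; split => //.
    have h3 : env (disc c s0 (expi al)) <= m0 t + LP * D * d.
      apply: (@env_lip _ _ r d) => //; first exact: hrt.
      case/andP: ht => t1 t2; apply: (@le_lt_trans _ _ dr).
        by apply: hstep; rewrite ger0_norm ?subr_ge0//; lra.
      by rewrite /dr ltr_pdivrMr// ltr_pMr ?mulr_gt0// ltr1n.
    by rewrite /e2; lra.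
  have [|||s' [hs' hoff hon]] := @one_step R omega Phi LP oo LP0 lipP P01 c s sg al be
    (fun t => m0 t + e2) eta al0 ab be2 _ eta0 hs.
  - by move=> t; apply: cvgD; [exact: cm0|exact: cvg_cst].
  - by move=> t z ht z1; apply: (hsg t ht).1.
  - by move=> t ht; apply: (hsg t ht).2.
  exists s'; split => //.
    move=> t /andP[t1 t2]; rewrite -/be in t1.
    have := hoff t; rewrite t1 t2 => /(_ (or_intror isT)).
    have := hclose t; rewrite t2 (le_trans (ltW ab) t1) => /(_ isT).
    have := ler_distD (disc c s (expi t)) (disc c s' (expi t)) (disc c s0 (expi t)).
    by rewrite -natr1; lra.
  rewrite -/be.
  have cP s3 : continuous (fun t => Phi (disc c s3 (expi t))) by exact: continuous_Phi_disc'.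
  have cst k' : continuous (fun _ : R => k' : R) by move=> x; exact: cst_continuous.
  rewrite (rint_split (b := al) (a := 0) (c := be))//; last exact: ltW.
  rewrite (rint_split (b := al) (a := 0) (c := be) (q := m0))//; last exact: ltW.
  move: hon; rewrite rintD// rint_cst//; last exact: ltW.
  have : rint 0 al (fun t => Phi (disc c s' (expi t))) <=
      rint 0 al (fun t => Phi (disc c s (expi t))) + LP * eta * (2 * pi).
    apply: (@le_trans _ _ (rint 0 al (fun t => Phi (disc c s (expi t)) + LP * eta))).
      apply: le_rint => //; first by move=> t; apply: cvgD; [exact: cP|exact: cvg_cst].
      move=> t /andP[t1 t2]; rewrite -lerBlDl (le_trans (ler_norm _))// (le_trans (lipP _ _))//.
      by rewrite ler_wpM2l// hoff// t1 t2; left.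
    rewrite rintD// rint_cst// subr0 lerD2l ler_wpM2l ?mulr_ge0 ?(ltW eta0)//.
    exact: le_trans (ltW ab) be2.
  have -> : be - al = step by rewrite beE addrC addKr.
  have -> : e2 * be = e2 * al + e2 * step by rewrite beE mulrDr.
  rewrite -/al in hint; rewrite -natr1; lra.
have [s [hs _]] := claim N (leqnn N).
have -> : N%:R * step = 2 * pi by rewrite /step mulrC divfK// gt_eqF.
rewrite !rint_mean -/Cn => hint.
apply: (le_trans (env_le oc hs)); rewrite -(ler_pM2l p0); apply: (le_trans hint).
rewrite -/m0; have p2 : 2 <= pi :> R := pi_ge2 R.
have : e / 4 <= pi * (e / 4) by rewrite ler_peMl ?(ltW e40)//; lra.
rewrite /e2; lra.
Qed.

End Envelope.

(** * The extension of the envelope to R^3 *)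

Section PlanarDisc.
Context {R : realType}.
Local Notation C := (R[i]).
Local Notation V := 'rV[R]_3.

Lemma dotvE3 (x y : V) : dotv x y =
  x ord0 0 * y ord0 0 + x ord0 1 * y ord0 1 + x ord0 2%:R * y ord0 2%:R.
Proof.
rewrite /dotv !big_ord_recl big_ord0 addr0 addrA.
by congr (_ * _ + _ * _ + _ * _); congr (_ _ _); apply/val_inj.
Qed.

Lemma isothermal_dot (v1 v2 : V) : isothermal v1 v2 ->
  dotv v1 v2 = 0 /\ dotv v1 v1 = dotv v2 v2.
Proof.
move=> [h1 h2 _]; split => //.
have d0 (x : V) : 0 <= dotv x x by apply: sumr_ge0 => i _; rewrite -expr2 sqr_ge0.
by apply/eqP; rewrite -eqr_sqrt//; apply/eqP.
Qed.

Lemma prim_polyC (a : C) : prim a%:P = a *: 'X.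
Proof.
apply/polyP => -[|i]; rewrite coef_prim coefZ coefX ?mulr0// coefC.
by case: i => [|i] /=; rewrite ?divr1 ?mulr1// mul0r mulr0.
Qed.

(** The vector v1 - i v2 is null and Re ((v1 - i v2) (x + i y)) = x v1 + y v2, so a conformal plane
    is a null disc with constant spinor (a, b). The first two components of the null vector give a
    ^+ 2 and b ^+ 2. *)
Lemma planar_spinor (v1 v2 : V) : dotv v1 v2 = 0 -> dotv v1 v1 = dotv v2 v2 ->
  exists s, forall c z, disc c s z =
    c + complex.Re z *: v1 + complex.Im z *: v2.
Proof.
move=> h12 h11.
pose nu (i : 'I_3) : C := (v1 ord0 i -i* v2 ord0 i)%C.
have nu0 : nu 0 ^+ 2 + nu 1 ^+ 2 + nu 2%:R ^+ 2 = 0.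
  move: h12 h11; rewrite !dotvE3 => h12 h11.
  apply: complex_eq; rewrite !expr2 !(cReD, cImD, cReM, cImM) /=.
    by move: h11; lra.
  by move: h12; lra.
pose a := sqrtC' ((nu 0 - 'i%C * nu 1) / 2).
pose b0 := sqrtC' (- (nu 0 + 'i%C * nu 1) / 2).
have ii : ('i%C : C) * 'i%C = -1.
  by apply: complex_eq; rewrite !(cReM, cImM) /=; ring.
have a2 : a ^+ 2 = (nu 0 - 'i%C * nu 1) / 2 by rewrite sqrtC'K.
have b02 : b0 ^+ 2 = - (nu 0 + 'i%C * nu 1) / 2 by rewrite sqrtC'K.
have ab2 : (2 * a * b0) ^+ 2 = nu 2%:R ^+ 2.
  have -> : (2 * a * b0) ^+ 2 = 4 * (a ^+ 2 * b0 ^+ 2) by ring.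
  have -> : nu 2%:R ^+ 2 = - (nu 0 ^+ 2 + nu 1 ^+ 2).
    by apply/eqP; rewrite -addr_eq0 addrC nu0.
  rewrite a2 b02.
  have -> : 4 * ((nu 0 - 'i%C * nu 1) / 2 * (- (nu 0 + 'i%C * nu 1) / 2)) =
     - (nu 0 ^+ 2 - ('i%C * 'i%C) * nu 1 ^+ 2) by field.
  by rewrite ii mulN1r opprK.
(* Nullity determines 2 * a * b up to sign; changing the sign of b settles it. *)
have [b b2 ab] : exists2 b, b ^+ 2 = b0 ^+ 2 & 2 * a * b = nu 2%:R.
  move/eqP: ab2; rewrite eqf_sqr => /orP[/eqP h|/eqP h]; first by exists b0.
  by exists (- b0); rewrite ?sqrrN// mulrN h opprK.
exists (a%:P, b%:P) => c z; apply/rowP => i; rewrite !mxE.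
have -> : nullp (a%:P, b%:P) i = (nu i)%:P.
  rewrite /nullp /nullb /=.
  case: i => [[|[|[|//]]] hi] /=.
  - rewrite -!polyCM -polyCB; congr _%:P.
    rewrite -!expr2 b2 a2 b02 (_ : Ordinal hi = 0); last exact/val_inj.
    by field.
  - rewrite -!polyCM -polyCD -mul_polyC -polyCM; congr _%:P.
    rewrite -!expr2 b2 a2 b02 (_ : Ordinal hi = 1); last exact/val_inj.
    have -> : 'i%C * ((nu 0 - 'i%C * nu 1) / 2 + - (nu 0 + 'i%C * nu 1) / 2) =
      - ('i%C * 'i%C) * nu 1 by field.
    by rewrite ii opprK mul1r.
  - rewrite -!polyCM -polyCD; congr _%:P.
    rewrite (_ : Ordinal hi = 2%:R); last exact/val_inj.
    by rewrite -ab; ring.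
rewrite prim_polyC hornerZ hornerX cReM /=.
by rewrite -addrA; congr (_ + _); ring.
Qed.

End PlanarDisc.

Section Extension.
Context {R : realType}.
Local Notation C := (R[i]).
Local Notation V := 'rV[R]_3.
Variables (omega : set V) (Phi : V -> R) (LP D : R).
Hypotheses (oo : open omega) (LP0 : 0 <= LP)
  (lipP : forall x y, `|Phi x - Phi y| <= LP * `|x - y|)
  (P01 : forall x, 0 <= Phi x <= 1)
  (cvx : forall x y (t : R), omega x -> omega y -> 0 <= t <= 1 ->
    omega ((1 - t) *: x + t *: y))
  (D0 : 0 <= D) (hD : forall x y, omega x -> omega y -> `|x - y| <= D).
Let Cst := LP * D.
(** Chosen so that M / (2 * pi) >= 2 * Cst, the price of shrinking a circle per unit of the weight
    it has outside omega, and M >= 4 * pi, for circles with weight at least 1 / 2. *)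
Let M := 4 * pi * (Cst + 1).
Variable h : V -> R.
Hypotheses (ch : continuous h) (h0 : forall x, 0 <= h x)
  (hcvx : forall x z, 2 * h x <= h (x + z) + h (x - z))
  (hout : forall x, ~ omega x -> M + 1 <= h x).
Local Notation env := (env omega Phi).

(** The gluing is continuous because h > 1 >= env near every point off omega, so the maximum equals
    h there. *)
Definition env_ext (x : V) : R :=
  if pselect (omega x) then Num.max (env x) (h x) else h x.

Let Cst0 : 0 <= Cst. Proof. exact: mulr_ge0. Qed.
Let M4 : 4 * pi <= M.
Proof. by rewrite /M ler_peMr ?mulr_ge0 ?pi_ge0// lerDr. Qed.
Let M0 : 0 < M. Proof. by apply: lt_le_trans M4; rewrite mulr_gt0 ?pi_gt0. Qed.

Lemma env_ext_in x : omega x -> env_ext x = Num.max (env x) (h x).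
Proof. by rewrite /env_ext; case: pselect. Qed.

Lemma env_ext_ge_h x : h x <= env_ext x.
Proof. by rewrite /env_ext; case: pselect => o; rewrite ?le_max ?lexx ?orbT. Qed.

Lemma env_ext_ge_env x : omega x -> env x <= env_ext x.
Proof. by move=> /env_ext_in ->; rewrite le_max lexx. Qed.

Lemma continuous_env_ext : continuous env_ext.
Proof.
move=> x; have [ox|nx] := pselect (omega x).
  have [d d0 hd] := open_norm oo ox.
  apply: (@continuous_at_eq _ _ _ _ (fun y => Num.max (env y) (h y)) x d d0).
    by move=> y /hd oy; rewrite env_ext_in.
  apply: (@continuous_max _ _ env h x); last exact: ch.
  exact: (env_continuous oo LP0 lipP P01 cvx D0 hD).
have hx1 : 1 < h x.
  by apply: (lt_le_trans _ (hout nx)); rewrite ltrDr.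
have e0 : 0 < (h x - 1) / 2 by rewrite divr_gt0// subr_gt0.
have [d d0 hd] := norm_continuous_at (@ch x) e0.
apply: (@continuous_at_eq _ _ _ _ h x d d0); last exact: ch.
move=> y /hd; rewrite ler_norml => /andP[_ hy].
rewrite /env_ext; case: pselect => // oy.
rewrite max_r// (le_trans (env_le1 P01 oy))//; lra.
Qed.

(** A continuous substitute for the indicator of the complement of omega. Where it is positive, h is
    at least 1 + M * chi, and this surplus pays for the part of the circle that is lost. *)
Let chi (x : V) : R := Num.min 1 (Num.max 0 ((h x - 1) / M)).

Let cont_chi : continuous chi.
Proof.
move=> x; apply: (@continuous_min _ _ (fun=> 1) (fun x => Num.max 0 ((h x - 1) / M)) x).
  exact: cst_continuous.
apply: (@continuous_max _ _ (fun=> 0) (fun x => (h x - 1) / M) x).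
  exact: cst_continuous.
apply: (@continuous_comp _ _ _ h (fun r => (r - 1) / M)); first exact: ch.
apply: (@lipschitz_continuous _ _ _ _ `|M^-1|) => a b.
by rewrite -mulrBl (_ : a - 1 - (b - 1) = a - b) ?normrM 1?mulrC//; ring.
Qed.

Let chi_ge0 x : 0 <= chi x.
Proof. by rewrite /chi le_min ler01 le_max lexx. Qed.

Let chi_out x : ~ omega x -> chi x = 1.
Proof.
move=> /hout hx; rewrite /chi min_l// le_max; apply/orP; right.
by rewrite ler_pdivlMr// mul1r; lra.
Qed.

Let chi_h x : 0 < chi x -> 1 + M * chi x <= h x.
Proof.
rewrite /chi lt_min lt_max ltxx /= => /andP[_ hx].
have : M * Num.min 1 (Num.max 0 ((h x - 1) / M)) <= M * ((h x - 1) / M).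
  by rewrite ler_pM2l// ge_min (max_r (ltW hx)) lexx orbT.
by rewrite (mulrC M ((h x - 1) / M)) divfK ?gt_eqF//; lra.
Qed.

Lemma rint_reflect (q : R -> R) (b : R) : continuous q -> 0 <= b ->
  rint 0 b (fun t => q (b - t)) = rint 0 b q.
Proof.
move=> cq b0; have [F dF] := primitive_exists 0 b cq.
rewrite (rint_FTC b0 cq dF).
have cq' : continuous (fun t => q (b - t)).
  move=> t; apply: (@continuous_comp _ _ _ (fun t => b - t) q); last exact: cq.
  by apply: cvgB; [exact: cvg_cst|exact: cvg_id].
have dF' x : 0 <= x <= b -> is_derive x (1 : R) (fun t => - F (b - t)) (q (b - x)).
  move=> /andP[x0 xb].
  have d1 : is_derive (b - x) (1 : R) F (q (b - x)).
    by apply: dF; apply/andP; split; lra.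
  have d2 : is_derive x (1 : R) (fun t : R => b - t) (-1).
    by have := is_deriveB (is_derive_cst b x 1) (is_derive_id x 1); rewrite sub0r.
  have d3 := is_derive1_comp (f := F) (g := fun t => b - t) d1 d2.
  have := is_deriveN d3; by rewrite mulrN1 opprK.
by rewrite (rint_FTC b0 cq' dF') subrr subr0; ring.
Qed.

Section Plane.
Variables (v1 v2 : V) (s : ({poly C} * {poly C})%type).
Hypothesis hs : forall c z, disc c s z = c + complex.Re z *: v1 + complex.Im z *: v2.

Let zt (t : R) : V := cos t *: v1 + sin t *: v2.
Let discz c t : disc c s (expi t) = c + zt t.
Proof. by rewrite hs /= /zt addrA. Qed.

Let cont_zt c : continuous (fun t => c + zt t).
Proof.
have -> : (fun t => c + zt t) = (fun t => disc c s (expi t)).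
  by apply/funext => t; rewrite discz.
by move=> t; exact: continuous_disc.
Qed.

Let cont_comp (f : V -> R) c : continuous f -> continuous (fun t => f (c + zt t)).
Proof.
by move=> cf t; apply: (@continuous_comp _ _ _ (fun t => c + zt t) f);
  [exact: cont_zt|exact: cf].
Qed.

Let zt2pi t : zt (t + 2 * pi) = zt t.
Proof. by rewrite /zt mulr_natl cosD2pi sinD2pi. Qed.

Let ztpi t : zt (t + pi) = - zt t.
Proof. by rewrite /zt cosDpi sinDpi !scaleNr opprD. Qed.

Let zt_sum t u : zt (t + u) + zt (t - u) = (2 * cos u) *: zt t.
Proof.
by apply/rowP => i; rewrite !mxE cosD sinD cosB sinB; ring.
Qed.

(** Midpoint convexity, averaged over pairs of antipodal points. *)
Let h_submean c : h c <= mean (fun t => h (c + zt t)).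
Proof.
have cq : continuous (fun t => h (c + zt t)) by exact: cont_comp.
have cq2 : continuous (fun t => h (c + zt (t + pi))).
  move=> t; apply: (@continuous_comp _ _ _ (fun t => t + pi) (fun t => h (c + zt t))); last exact: cq.
  by apply: cvgD; [exact: cvg_id|exact: cvg_cst].
have e1 : mean (fun t => h (c + zt (t + pi))) = mean (fun t => h (c + zt t)).
  rewrite (@mean_rotate _ (fun t => h (c + zt t)) pi)//; first by move=> t; rewrite zt2pi.
  by have := pi_ge0 R; move=> ?; apply/andP; split; lra.
have : 2 * h c <= mean (fun t => h (c + zt t) + h (c + zt (t + pi))).
  rewrite -[leLHS]mean_cst; apply: le_mean.
  - by move=> ?; exact: cst_continuous.
  - by move=> t; apply: cvgD; [exact: cq|exact: cq2].
  - by move=> t _; rewrite ztpi.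
rewrite meanD// e1; lra.
Qed.

Let m c := rint 0 (2 * pi) (fun t => chi (c + zt t)).

(** Suppose the shrunk point at angle t0 is off omega. For every angle u up to d one of the circle
    points at t0 + u, t0 - u must be off omega too: otherwise their midpoint c + cos u * zt t0 is in
    omega, and 1 - d <= cos u with convexity brings the shrunk point in. Integrating chi over these
    pairs gives d <= 2 * m c. *)
Let shrink_in c d : omega c -> 2 * m c < d -> 0 < d < 1 ->
  forall t, 0 <= t <= 2 * pi -> omega (c + (1 - d) *: zt t).
Proof.
move=> oc md /andP[d0 d1] t0 t02; apply: contrapT => nt.
have p0 := twopi_gt0 (R := R).
have dp : d <= 2 * pi.
  by have : 2 <= pi :> R := pi_ge2 R; lra.
pose q t := chi (c + zt (t0 + t)).
have cq : continuous q.
  move=> t; apply: (@continuous_comp _ _ _ (fun t => t0 + t) (fun t => chi (c + zt t))).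
    by apply: cvgD; [exact: cvg_cst|exact: cvg_id].
  exact: cont_comp.
have key u : `|u| <= d -> 1 <= q u + q (- u).
  move=> ud; have cu : 1 - d <= cos u.
    have := cos_lip 0 u; rewrite cos0 sub0r normrN => hc.
    have := le_trans (ler_norm _) (le_trans hc ud); lra.
  have cu0 : 0 < cos u by lra.
  have [i1|n1] := pselect (omega (c + zt (t0 + u))); last first.
    by rewrite /q chi_out// lerDl.
  have [i2|n2] := pselect (omega (c + zt (t0 - u))); last first.
    by rewrite addrC /q chi_out// lerDl.
  exfalso; apply: nt.
  have half : 0 <= (2^-1 : R) <= 1 by apply/andP; split; lra.
  have o3 : omega (c + cos u *: zt t0).
    have := cvx i1 i2 half.
    have -> : (1 - 2^-1) *: (c + zt (t0 + u)) + 2^-1 *: (c + zt (t0 - u)) =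
        c + 2^-1 *: (zt (t0 + u) + zt (t0 - u)).
      by move: (zt _) (zt _) => X Y; apply/rowP => i; rewrite !mxE; field.
    by rewrite zt_sum scalerA mulrA mulVf// mul1r.
  have l01 : 0 <= (1 - d) / cos u <= 1.
    apply/andP; split; first by rewrite divr_ge0 ?(ltW cu0)//; lra.
    by rewrite ler_pdivrMr// mul1r.
  have := cvx oc o3 l01.
  rewrite scalerDr scalerA divfK ?gt_eqF// addrA -scalerDl subrK scale1r.
  exact.
have q2 t : q (t + 2 * pi) = q t by rewrite /q (addrA t0) zt2pi.
have mq : m c = rint 0 (2 * pi) q.
  have cchi : continuous (fun t => chi (c + zt t)) by exact: cont_comp.
  have pchi t : chi (c + zt (t + 2 * pi)) = chi (c + zt t) by rewrite zt2pi.
  rewrite /m (rint_mean q) (rint_mean (fun t => chi (c + zt t))); congr (_ * _).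
  rewrite -(mean_rotate cchi pchi t02); congr mean.
  by apply/funext => t; rewrite /q (addrC t0).
have q0 t : 0 <= q t by exact: chi_ge0.
clearbody q.
have cq' : continuous (fun t => q (2 * pi - t)).
  move=> t; apply: (@continuous_comp _ _ _ (fun t => 2 * pi - t) q); last exact: cq.
  by apply: cvgB; [exact: cvg_cst|exact: cvg_id].
have : d <= 2 * m c; last by lra.
have -> : 2 * m c = rint 0 (2 * pi) (fun t => q t + q (2 * pi - t)).
  by rewrite rintD// rint_reflect// ?(ltW p0)// mq mulr_natl mulr2n.
have cqq : continuous (fun t => q t + q (2 * pi - t)).
  by move=> t; apply: cvgD; [exact: cq|exact: cq'].
rewrite (rint_split (b := d))// ?(ltW d0)//.
have i2 : 0 <= rint d (2 * pi) (fun t => q t + q (2 * pi - t)).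
  by apply: rint_ge0 => t _; rewrite addr_ge0.
have i1 : 1 * (d - 0) <= rint 0 d (fun t => q t + q (2 * pi - t)).
  rewrite -rint_cst ?(ltW d0)//; apply: le_rint => //.
    by move=> ?; exact: cst_continuous.
  move=> t /andP[ta tb]; rewrite (addrC _ (- t)) q2; apply: key.
  by rewrite ger0_norm.
by move: i1; rewrite subr0; lra.
Qed.

(* When the envelope wins at c and the circle leaves omega on a set of small
   weight m (the integral of the cutoff chi), convexity brings it back into omega
   after shrinking by a factor 1 - O(m). This costs O(m), while h >= M + 1 off
   omega gains M m. *)
Lemma env_ext_submean c : env_ext c <= mean (fun t => env_ext (c + zt t)).
Proof.
have p0 := twopi_gt0 (R := R).
have hc : h c <= mean (fun t => env_ext (c + zt t)).
  apply: (le_trans (h_submean c)); apply: le_mean.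
  - exact: cont_comp.
  - exact/cont_comp/continuous_env_ext.
  - by move=> t _; exact: env_ext_ge_h.
have cw : continuous (fun t => env_ext (c + zt t)).
  exact/cont_comp/continuous_env_ext.
have cc : continuous (fun t => chi (c + zt t)) by exact: cont_comp.
have [oc|nc] := pselect (omega c); last by rewrite {1}/env_ext; case: pselect.
rewrite env_ext_in// ge_max hc andbT.
have m0 : 0 <= m c by apply: rint_ge0 => t _.
have cst k' : continuous (fun _ : R => k' : R) by move=> x; exact: cst_continuous.
have cMc : continuous (fun t => M * chi (c + zt t)).
  by move=> t; apply: cvgM; [exact: cvg_cst|exact: cc].
have meanMc : mean (fun t => M * chi (c + zt t)) = M * m c / (2 * pi).
  by rewrite /mean rintZ// mulrC.
(* If the weight is at least 1 / 2, the mean of M * chi is already at least 1, hence at least env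
   c. *)
have [m1|m1] := leP (1 / 2) (m c).
  apply: (@le_trans _ _ 1); first exact: env_le1.
  apply: (@le_trans _ _ (mean (fun t => M * chi (c + zt t)))).
    rewrite meanMc ler_pdivlMr// mul1r.
    have := ler_pM (ltW (divr_gt0 ltr01 (ltr0n _ 2))) (mulr_ge0 (ler0n R 4) (pi_ge0 R)) m1 M4.
    by rewrite [m c * _]mulrC; apply: le_trans; lra.
  apply: le_mean => // t _; apply: (le_trans _ (env_ext_ge_h _)).
  have [c0|] := ltP 0 (chi (c + zt t)); first by have := chi_h c0; lra.
  move=> c0; have -> : chi (c + zt t) = 0 by apply/eqP; rewrite eq_le c0 chi_ge0.
  by rewrite mulr0.
(* Letting d tend to 2 * m c, the cost Cst * d is absorbed by the gain M * m c / (2 * pi). *)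
suff step d : 2 * m c < d -> 0 < d < 1 ->
    env c <= mean (fun t => env_ext (c + zt t)) + Cst * d - M * m c / (2 * pi).
  have MC : 2 * Cst * m c <= M * m c / (2 * pi).
    rewrite ler_pdivlMr// /M.
    have : 0 <= pi * m c by rewrite mulr_ge0 ?pi_ge0.
    lra.
  apply/ler_addgt0Pr => e e0.
  have [d1 d10 hd1] := pos_small Cst0 e0.
  pose d := Num.min (2 * m c + d1) (m c + 1 / 2).
  have dlt : 2 * m c < d by rewrite lt_min ltrDl d10 /=; lra.
  have dle : d <= 2 * m c + d1 by rewrite ge_min lexx.
  have d01 : 0 < d < 1.
    rewrite (le_lt_trans _ dlt) ?mulr_ge0//=.
    have : d <= m c + 1 / 2 by rewrite ge_min lexx orbT.
    lra.
  apply: (le_trans (step d dlt d01)).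
  have : Cst * d <= Cst * (2 * m c + d1) by rewrite ler_wpM2l.
  lra.
move=> md d01; have /andP[d0 d1] := d01.
have d1' : 0 <= 1 - d by lra.
pose s' := scale_spinor (1 - d) s.
have discs' t : disc c s' (expi t) = c + (1 - d) *: zt t.
  by rewrite disc_scale// discz add0r.
have adm : admissible omega c s'.
  move=> z z1; have [t t2 zE] := polar z.
  have := cvx oc (shrink_in oc md d01 t2) (_ : 0 <= cmod z <= 1).
  rewrite cmod_ge0 z1 => /(_ isT).
  have -> : (1 - cmod z) *: c + cmod z *: (c + (1 - d) *: zt t) = disc c s' z.
    rewrite disc_scale// hs add0r.
    have -> : complex.Re z = cmod z * cos t by rewrite {1}zE cReM /= mul0r subr0.
    have -> : complex.Im z = cmod z * sin t by rewrite {1}zE cImM /= mul0r addr0.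
    by rewrite /zt; move: (cmod z) => r; apply/rowP => i; rewrite !mxE; ring.
  exact.
have := env_submean oo LP0 lipP P01 cvx D0 hD adm.
have cenv := continuous_env_disc oo LP0 lipP P01 cvx D0 hD adm.
move=> /le_trans; apply.
(* Where chi is positive, h is at least 1 + M * chi while env is at most 1. Where chi vanishes, the
   circle point is in omega and moving it towards c costs Cst * d. *)
have sumle : mean (fun t => env (disc c s' (expi t)) + M * chi (c + zt t)) <=
    mean (fun t => env_ext (c + zt t) + Cst * d).
  apply: le_mean.
  - by move=> t; apply: cvgD; [exact: cenv|exact: cMc].
  - by move=> t; apply: cvgD; [exact: cw|exact: cvg_cst].
  move=> t t2; have Cd0 : 0 <= Cst * d by rewrite mulr_ge0// ltW.
  have e1 : env (disc c s' (expi t)) <= 1.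
    by apply: (env_le1 P01); apply: adm; rewrite cmod_expi.
  have [c0|c0] := ltP 0 (chi (c + zt t)).
    by have := chi_h c0; have := env_ext_ge_h (c + zt t); lra.
  have c0E : chi (c + zt t) = 0 by apply/eqP; rewrite eq_le c0 chi_ge0.
  rewrite c0E mulr0 addr0.
  have ot : omega (c + zt t).
    by apply: contrapT => /chi_out h1; move: c0; rewrite h1; lra.
  apply: (@le_trans _ _ (env (c + zt t) + Cst * d)); last first.
    by rewrite lerD2r env_ext_ge_env.
  have dd : 0 <= d <= 1 by rewrite !ltW.
  have := env_contract LP0 lipP P01 cvx hD ot oc dd.
  have -> : (1 - d) *: (c + zt t) + d *: c = disc c s' (expi t).
    by rewrite discs'; move: (zt t) => X; apply/rowP => i; rewrite !mxE; ring.
  exact.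
move: sumle; rewrite !meanD// mean_cst meanMc; lra.
Qed.

End Plane.
End Extension.

(** * Null discs are conformal minimal discs *)

Section RowCalculus.
Context {R : realType}.

Lemma continuous_rv_coord (n : nat) (i : 'I_n) :
  continuous (fun x : 'rV[R]_n => x ord0 i).
Proof.
apply: (@lipschitz_continuous _ _ _ _ 1) => x y; rewrite mul1r.
by have := rv_coord_le (x - y) i; rewrite !mxE.
Qed.

Lemma differentiable_row (U : normedModType R) (n : nat) (f : U -> 'rV[R]_n) (z : U) :
  (forall i, differentiable (fun y => f y ord0 i) z) -> differentiable f z.
Proof.
move=> df; have -> : f = \sum_(i < n) (fun y => (f y ord0 i) *: (delta_mx ord0 i : 'rV[R]_n)).
  apply/funext => y; rewrite fct_sumE [LHS]row_sum_delta.
  by [].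
apply: differentiable_sum => i; exact: differentiableZl.
Qed.

Lemma derive_coord (U : normedModType R) (n : nat) (f : U -> 'rV[R]_n) (z h : U) i :
  differentiable f z -> differentiable (fun y => f y ord0 i) z /\
  ('D_h f z) ord0 i = 'D_h (fun y => f y ord0 i) z.
Proof.
move=> df; have dc : differentiable ((fun M : 'rV[R]_n => M ord0 i) \o f) z.
  by apply: differentiable_comp => //; exact: differentiable_coord.
split=> //; rewrite !deriveE//.
have -> : (fun y => f y ord0 i) = (fun M : 'rV[R]_n => M ord0 i) \o f by [].
have dg := differentiable_coord (f z) ord0 i.
have -> := congr1 (fun g => g h) (diff_comp df dg); rewrite /=.
pose lin : 'rV[R]_n -> R := fun M => M ord0 i.
have ladd : linear lin by move=> a x y; rewrite /lin !mxE.
pose L := GRing.isLinear.Build _ _ _ _ lin ladd.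
pose lin' : {linear 'rV[R]_n -> R} := HB.pack lin L.
have cl : continuous lin' by exact: continuous_rv_coord.
by have -> := congr1 (fun g => g ('d f z h)) (diff_lin (f z) cl).
Qed.

End RowCalculus.

Section HolomorphicRows.
Context {R : realType}.
Local Notation C := (R[i]).

Definition toC (z : R * R) : C := (z.1 +i* z.2)%C.

Definition reP (p : {poly C}) (z : R * R) : R := complex.Re p.[toC z].
Definition imP (p : {poly C}) (z : R * R) : R := complex.Im p.[toC z].

Lemma diff_fst (z : R * R) : differentiable (fst : R * R -> R) z /\
  forall h, 'D_h (fst : R * R -> R) z = h.1.
Proof.
have lf : linear (fst : R * R -> R) by [].
pose L := GRing.isLinear.Build _ _ _ _ (fst : R * R -> R) lf.
pose l' : {linear (R * R)%type -> R} := HB.pack (fst : R * R -> R) L.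
have cl : continuous l' by move=> x; exact: cvg_fst.
have dl : differentiable l' z by exact: linear_differentiable.
split => // h; rewrite deriveE//.
by have -> := congr1 (fun g => g h) (diff_lin z cl).
Qed.

Lemma diff_snd (z : R * R) : differentiable (snd : R * R -> R) z /\
  forall h, 'D_h (snd : R * R -> R) z = h.2.
Proof.
have lf : linear (snd : R * R -> R) by [].
pose L := GRing.isLinear.Build _ _ _ _ (snd : R * R -> R) lf.
pose l' : {linear (R * R)%type -> R} := HB.pack (snd : R * R -> R) L.
have cl : continuous l' by move=> x; exact: cvg_snd.
have dl : differentiable l' z by exact: linear_differentiable.
split => // h; rewrite deriveE//.
by have -> := congr1 (fun g => g h) (diff_lin z cl).
Qed.

(** Multiplication by z mixes real and imaginary parts, so the Horner induction treats both at
    once. *)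
Lemma diff_reP_imP p (z : R * R) :
  [/\ differentiable (reP p) z, differentiable (imP p) z,
      forall h, 'D_h (reP p) z = complex.Re (p^`().[toC z] * toC h) &
      forall h, 'D_h (imP p) z = complex.Im (p^`().[toC z] * toC h)].
Proof.
have [d1 D1] := diff_fst z; have [d2 D2] := diff_snd z.
elim/poly_ind: p => [|p c [dr di Dr Di]].
  have e1 : reP 0 = cst 0 by apply/funext => y; rewrite /reP horner0.
  have e2 : imP 0 = cst 0 by apply/funext => y; rewrite /imP horner0.
  by split; rewrite ?e1 ?e2// => h; rewrite derive_cst deriv0 horner0 mul0r.
have e1 : reP (p * 'X + c%:P) = (reP p * fst - imP p * snd) + cst (complex.Re c).
  by apply/funext => y; rewrite /reP !hornerE cReD cReM.
have e2 : imP (p * 'X + c%:P) = (reP p * snd + imP p * fst) + cst (complex.Im c).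
  by apply/funext => y; rewrite /imP !hornerE cImD cImM.
have m1 : differentiable (reP p * fst) z by exact: differentiableM.
have m2 : differentiable (imP p * snd) z by exact: differentiableM.
have m3 : differentiable (reP p * snd) z by exact: differentiableM.
have m4 : differentiable (imP p * fst) z by exact: differentiableM.
have b1 : differentiable (reP p * fst - imP p * snd) z by exact: differentiableB.
have b2 : differentiable (reP p * snd + imP p * fst) z by exact: differentiableD.
have dd (f : R * R -> R) (h : R * R) : differentiable f z -> derivable f z h.
  by move=> ?; exact: diff_derivable.
split; first by rewrite e1; exact: differentiableD.
- by rewrite e2; exact: differentiableD.
- move=> h; rewrite e1 deriveD ?deriveB ?deriveM ?derive_cst; try exact: dd.
  rewrite Dr Di D1 D2 derivD derivM derivX derivC !hornerE.
  rewrite /reP /imP !(cReM, cReD, cImM, cImD) /= /GRing.scale /=; ring.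
- move=> h; rewrite e2 deriveD ?deriveD ?deriveM ?derive_cst; try exact: dd.
  rewrite Dr Di D1 D2 derivD derivM derivX derivC !hornerE.
  rewrite /reP /imP !(cReM, cReD, cImM, cImD) /= /GRing.scale /=; ring.
Qed.

Definition prow n (c : 'rV[R]_n) (p : 'I_n -> {poly C}) (z : R * R) : 'rV[R]_n :=
  \row_i (c ord0 i + reP (p i) z).

Lemma diff_prow n c p z : differentiable (@prow n c p) z /\
  forall h, 'D_h (prow c p) z = \row_i complex.Re ((p i)^`().[toC z] * toC h).
Proof.
have dc i : differentiable (cst (c ord0 i) + reP (p i)) z /\ forall h,
    'D_h (cst (c ord0 i) + reP (p i)) z = complex.Re ((p i)^`().[toC z] * toC h).
  have [d1 _ D1 _] := diff_reP_imP (p i) z.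
  have d2 : differentiable (cst (c ord0 i) + reP (p i)) z by exact: differentiableD.
  split => // h; rewrite deriveD ?derive_cst ?add0r ?D1//; exact: diff_derivable.
have e i : (fun y => prow c p y ord0 i) = cst (c ord0 i) + reP (p i).
  by apply/funext => y; rewrite /prow mxE.
have df : differentiable (prow c p) z.
  by apply: differentiable_row => i; rewrite e; case: (dc i).
split => // h; apply/rowP => i; rewrite mxE.
by have [_ ->] := derive_coord h i df; rewrite e; case: (dc i).
Qed.

Lemma continuous_prow n c p : continuous (@prow n c p).
Proof. by move=> z; apply: differentiable_continuous; case: (diff_prow c p z). Qed.

Lemma partial_x_prow n c p :
  partial_x (@prow n c p) = prow 0 (fun i => (p i)^`()).
Proof.
apply/funext => z; rewrite /partial_x; have [_ ->] := diff_prow c p z.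
apply/rowP => i; rewrite !mxE add0r /reP; congr complex.Re.
have -> : toC (1, 0) = 1 by apply: complex_eq.
by rewrite mulr1.
Qed.

Lemma partial_y_prow n c p :
  partial_y (@prow n c p) = prow 0 (fun i => 'i%C *: (p i)^`()).
Proof.
apply/funext => z; rewrite /partial_y; have [_ ->] := diff_prow c p z.
apply/rowP => i; rewrite !mxE add0r /reP; congr complex.Re.
have -> : toC (0, 1) = 'i%C by apply: complex_eq.
by rewrite hornerZ mulrC.
Qed.

Lemma C1_on_prow n c p A : C1_on A (@prow n c p).
Proof.
move=> z _; split; first by case: (diff_prow c p z).
  rewrite partial_x_prow; exact: continuous_prow.
rewrite partial_y_prow; exact: continuous_prow.
Qed.

Lemma harmonic_on_prow n c p A : harmonic_on A (@prow n c p).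
Proof.
split; first exact: C1_on_prow.
- rewrite partial_x_prow; exact: C1_on_prow.
- rewrite partial_y_prow; exact: C1_on_prow.
move=> z _; rewrite partial_x_prow partial_y_prow partial_x_prow partial_y_prow.
apply/rowP => i; rewrite !mxE !add0r /reP derivZ !hornerZ !cReM !cImM /=; ring.
Qed.

Lemma null_identity (s : {poly C} * {poly C}) (w : C) :
  (nullp s 0).[w] ^+ 2 + (nullp s 1).[w] ^+ 2 + (nullp s 2%:R).[w] ^+ 2 = 0.
Proof.
rewrite /nullp /nullb /= !hornerE; set a := s.1.[w]; set b := s.2.[w].
have ii : ('i%C : C) ^+ 2 = -1.
  by apply: complex_eq; rewrite !expr2 !(cReM, cImM) /=; ring.
by rewrite exprMn ii; ring.
Qed.

(** The null vector is X - i Y; conformality is the real and the imaginary part of the null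
    identity. *)
Lemma disc_partials (c : 'rV[R]_3) s z :
  let X := partial_x (fun z => disc c s (toC z)) z in
  let Y := partial_y (fun z => disc c s (toC z)) z in
  [/\ dotv X X = dotv Y Y, dotv X Y = 0 &
   forall h, 'D_h (fun z => disc c s (toC z)) z = h.1 *: X + h.2 *: Y].
Proof.
have -> : (fun z => disc c s (toC z)) = prow c (fun i => prim (nullp s i)) by [].
rewrite /= partial_x_prow partial_y_prow.
have := null_identity s (toC z); move: (nullp s) => N nid.
have nr := congr1 (@complex.Re R) nid; have ni := congr1 (@complex.Im R) nid.
move: nr ni; rewrite !expr2 !(cReD, cImD, cReM, cImM) /= => nr ni.
have rei (q : {poly C}) w : complex.Re ('i%C *: q).[w] = - complex.Im q.[w].
  by rewrite hornerZ cReM /= mul0r sub0r mul1r.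
split.
- rewrite !dotvE3 !mxE !add0r /reP !deriv_prim !rei; lra.
- rewrite !dotvE3 !mxE !add0r /reP !deriv_prim !rei; lra.
- move=> h; have [_ ->] := diff_prow c (fun i => prim (N i)) z.
  by apply/rowP => i; rewrite !mxE !add0r /reP !deriv_prim rei cReM /=; ring.
Qed.

Lemma dotv_ge0 n (x : 'rV[R]_n) : 0 <= dotv x x.
Proof. by apply: sumr_ge0 => i _; rewrite -expr2 sqr_ge0. Qed.

Lemma dotv_eq0 n (x : 'rV[R]_n) : dotv x x = 0 -> x = 0.
Proof.
move=> /eqP; rewrite psumr_eq0 => [/allP h|i _]; last by rewrite -expr2 sqr_ge0.
apply/rowP => i; rewrite mxE; have := h i; rewrite mem_index_enum => /(_ isT).
by rewrite /= -expr2 sqrf_eq0 => /eqP.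
Qed.

(** The null vector determines a ^+ 2 and b ^+ 2, so it vanishes only where both spinor components
    do. Otherwise X and Y are orthogonal of equal nonzero length, hence independent. *)
Lemma disc_immersive (c : 'rV[R]_3) s z :
  ~ (s.1.[toC z] = 0 /\ s.2.[toC z] = 0) ->
  injective ('d (fun z => disc c s (toC z)) z).
Proof.
move=> ns; have := disc_partials c s z.
have -> : (fun z => disc c s (toC z)) = prow c (fun i => prim (nullp s i)) by [].
rewrite /= partial_x_prow partial_y_prow => -[hXX hXY hD].
have df : differentiable (prow c (fun i => prim (nullp s i))) z.
  by case: (diff_prow c (fun i => prim (nullp s i)) z).
set X := prow 0 _ z in hXX hXY hD; set Y := prow 0 (fun i => 'i%C *: _) z in hXX hXY hD.
have X0 : dotv X X != 0.
  apply/eqP => X0; apply: ns.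
  have Xz := dotv_eq0 X0; have Yz : Y = 0 by apply: dotv_eq0; rewrite -hXX.
  have nz i : (nullp s i).[toC z] = 0.
    have hx : X ord0 i = complex.Re (nullp s i).[toC z].
      by rewrite /X mxE mxE add0r /reP deriv_prim.
    have hy : Y ord0 i = - complex.Im (nullp s i).[toC z].
      by rewrite /Y mxE mxE add0r /reP deriv_prim (hornerZ 'i%C) cReM /= mul0r sub0r mul1r.
    apply: complex_eq => /=; first by rewrite -hx Xz mxE.
    by apply/eqP; rewrite -oppr_eq0 -hy Yz mxE.
  have := nz 0; have := nz 1; have := nz 2%:R.
  rewrite /nullp /nullb /= !hornerE; set a := s.1.[_]; set b := s.2.[_].
  move=> ab2 i1 a0.
  have i0 : ('i%C : C) != 0 by rewrite eq_complex /= negb_and oner_neq0 orbT.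
  move/eqP: i1; rewrite mulf_eq0 (negbTE i0) /= => /eqP a1.
  have a2 : a * a = 0.
    have -> : a * a = ((a * a - b * b) + (a * a + b * b)) / 2 by field.
    by rewrite a0 a1 addr0 mul0r.
  have b2 : b * b = 0 by rewrite -a1 a2 add0r.
  by split; apply/eqP; rewrite -[_ == 0]orbb -mulf_eq0; apply/eqP.
move=> h k /eqP; rewrite -subr_eq0 -linearB -deriveE// hD => /eqP e.
have c1 := congr1 (fun v => dotv v X) e; have c2 := congr1 (fun v => dotv v Y) e.
have dl (a b : R) (u v w : 'rV[R]_3) : dotv (a *: u + b *: v) w = a * dotv u w + b * dotv v w.
  by rewrite !dotvE3 !mxE; ring.
have dC (u v : 'rV[R]_3) : dotv u v = dotv v u by rewrite !dotvE3; ring.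
have d0 (w : 'rV[R]_3) : dotv 0 w = 0 by rewrite dotvE3 !mxE; ring.
rewrite dl d0 (dC Y X) hXY mulr0 addr0 in c1.
rewrite dl d0 hXY mulr0 add0r -hXX in c2.
move/eqP: c1; rewrite mulf_eq0 (negbTE X0) orbF subr_eq0 => /eqP h1.
move/eqP: c2; rewrite mulf_eq0 (negbTE X0) orbF subr_eq0 => /eqP h2.
by case: h k h1 h2 {e} => [? ?] [? ?] /= -> ->.
Qed.

Lemma disc_conformal_minimal (omega : set 'rV[R]_3) c s :
  admissible omega c s -> (forall w, cmod w <= 1 -> ~ (s.1.[w] = 0 /\ s.2.[w] = 0)) ->
  conformal_minimal_disc omega (fun z => disc c s (toC z)).
Proof.
move=> adm ns.
have cz (z : R * R) : closed_unit_disc z -> cmod (toC z) <= 1.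
  by rewrite /closed_unit_disc /= => h; rewrite /toC cmodE -sqrtr1 ler_wsqrtr.
pose P i := prim (nullp s i).
have imm z : closed_unit_disc z -> injective ('d (prow c P) z).
  by move=> zc; apply: (@disc_immersive c s z); apply: ns; exact: cz.
have conf z : dotv (partial_x (prow c P) z) (partial_x (prow c P) z) =
    dotv (partial_y (prow c P) z) (partial_y (prow c P) z) /\
    dotv (partial_x (prow c P) z) (partial_y (prow c P) z) = 0.
  by have [h1 h2 _] := disc_partials c s z; split; [exact: h1|exact: h2].
suff : conformal_minimal_disc omega (prow c P) by [].
split.
- by move=> _ [z zc <-]; apply: adm; exact: cz.
- exists setT, (prow c P); split.
  + exact: openT.
  + exact: subsetT.
  + exact: C1_on_prow.
  + by [].
  + exact: imm.
- move=> z _; have [h1 h2] := conf z; split; last exact: h2.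
  by rewrite /enorm h1.
- exact: harmonic_on_prow.
Qed.

End HolomorphicRows.

(** * Distance to a set *)

Section SetDistance.
Context {R : realType} (W : normedModType R).
Implicit Types (A : set W) (x y z : W).

Definition dist A x : R := inf [set `|x - y| | y in A].

Lemma dist_has_inf A x : A !=set0 -> has_inf [set `|x - y| | y in A].
Proof.
by move=> [y Ay]; split; [exists `|x - y|, y|exists 0 => _ [z _ <-]].
Qed.

Lemma dist_le A x y : A y -> dist A x <= `|x - y|.
Proof.
move=> Ay; apply: ge_inf; last by exists y.
by case: (@dist_has_inf A x); [exists y|].
Qed.

Lemma dist_approx A x e : A !=set0 -> 0 < e -> exists2 y, A y & `|x - y| < dist A x + e.
Proof.
by move=> A0 e0; have [_ [y Ay <-] h] := inf_adherent e0 (dist_has_inf x A0); exists y.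
Qed.

Lemma dist_ge A x r : A !=set0 -> (forall y, A y -> r <= `|x - y|) -> r <= dist A x.
Proof.
move=> A0 h; apply: lb_le_inf; first by case: (dist_has_inf x A0).
by move=> _ [y Ay <-]; exact: h.
Qed.

Lemma dist_ge0 A x : A !=set0 -> 0 <= dist A x.
Proof. by move=> A0; apply: dist_ge. Qed.

Lemma dist_in A x : A x -> dist A x = 0.
Proof.
move=> Ax; apply/eqP; rewrite eq_le dist_ge0 ?andbT; last by exists x.
by rewrite (le_trans (dist_le x Ax))// subrr normr0.
Qed.

Lemma dist_lip A x y : A !=set0 -> `|dist A x - dist A y| <= `|x - y|.
Proof.
move=> A0; have h a b : dist A a <= `|a - b| + dist A b.
  apply/ler_addgt0Pr => e e0; have [z Az hz] := dist_approx b A0 e0.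
  apply: (le_trans (dist_le a Az)); apply: (le_trans (ler_distD b a z)).
  by rewrite -addrA lerD2l ltW.
have h1 := h x y; have h2 := h y x; rewrite (distrC y x) in h2.
by rewrite ler_norml; apply/andP; split; lra.
Qed.

Lemma dist_midpoint A x z : A !=set0 ->
  (forall a b, A a -> A b -> A (2^-1 *: (a + b))) ->
  2 * dist A x <= dist A (x + z) + dist A (x - z).
Proof.
move=> A0 hA; apply/ler_addgt0Pr => e e0; have e20 : 0 < e / 2 by rewrite divr_gt0.
have [a Aa ha] := dist_approx (x + z) A0 e20.
have [b Ab hb] := dist_approx (x - z) A0 e20.
have := dist_le x (hA _ _ Aa Ab).
have -> : x - 2^-1 *: (a + b) = 2^-1 *: ((x + z - a) + (x - z - b)).
  have -> : x + z - a + (x - z - b) = (x + x) - (a + b).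
    by rewrite addrACA -opprD; congr (_ - _); rewrite addrACA subrr addr0.
  by rewrite scalerBr -{2}[x]scale1r -{3}[x]scale1r -scalerDl scalerA mulVf// scale1r.
rewrite normrZ ger0_norm ?invr_ge0//.
have := ler_normD (x + z - a) (x - z - b); lra.
Qed.

End SetDistance.

Section EuclideanNorm.
Context {R : realType}.
Local Notation V := 'rV[R]_3.

(** Three coordinates, and 3 <= 2 ^+ 2. *)
Lemma enorm_le_norm (x : V) : enorm x <= 2 * `|x|.
Proof.
have h i : x ord0 i * x ord0 i <= `|x| ^+ 2.
  by rewrite -expr2 -real_normK ?num_real// lerXn2r ?nnegrE// rv_coord_le.
rewrite /enorm -[leRHS]ger0_norm ?mulr_ge0// -sqrtr_sqr ler_wsqrtr//.
rewrite dotvE3 exprMn; have := h 0; have := h 1; have := h 2%:R.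
have := sqr_ge0 `|x|; lra.
Qed.

Lemma norm_le_enorm n (x : 'rV[R]_n) : `|x| <= enorm x.
Proof.
apply: rv_norm_le; first exact: sqrtr_ge0.
move=> i; rewrite -sqrtr_sqr ler_wsqrtr// /dotv (bigD1 i)//= -expr2 lerDl.
by apply: sumr_ge0 => j _; rewrite -expr2 sqr_ge0.
Qed.

End EuclideanNorm.

Section MinimalPsh.
Context {R : realType}.
Local Notation V := 'rV[R]_3.

Lemma usc_on_EFin (T : topologicalType) (A : set T) (w : T -> R) :
  continuous w -> usc_on A (EFin \o w).
Proof.
move=> cw; split => // x _ b /=; rewrite lte_fin => wb.
apply: cvg_within => /=.
apply: (@filterS _ (nbhs x) _ (w @^-1` [set r | r < b])).
  by move=> y /=; rewrite lte_fin.
by apply: cw; apply: open_nbhs_nbhs; split => //; exact: open_lt.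
Qed.

(** Rescaling v1 and v2 by r reduces circles of every radius to the unit circle. *)
Lemma minimal_psh_EFin (w : V -> R) : continuous w ->
  (forall c (v1 v2 : V), dotv v1 v2 = 0 -> dotv v1 v1 = dotv v2 v2 ->
    w c <= mean (fun t => w (c + (cos t *: v1 + sin t *: v2)))) ->
  minimal_psh setT (EFin \o w).
Proof.
move=> cw hw; split; first exact: usc_on_EFin.
move=> a v1 v2 /isothermal_dot[v12 v11].
have cpl : continuous (plane_pt a v1 v2).
  apply: (@lipschitz_continuous _ _ _ _ (`|v1| + `|v2|)) => x y.
  rewrite /plane_pt (_ : _ - _ = (x.1 - y.1) *: v1 + (x.2 - y.2) *: v2); last first.
    by apply/rowP => i; rewrite !mxE; ring.
  apply: (le_trans (ler_normD _ _)); rewrite !normrZ mulrDl; apply: lerD.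
    by rewrite mulrC ler_wpM2l// prod_normE /= le_max lexx.
  by rewrite mulrC ler_wpM2l// prod_normE /= le_max lexx orbT.
have cwp : continuous (w \o plane_pt a v1 v2).
  by move=> x; apply: continuous_comp; [exact: cpl|exact: cw].
split; first exact: (@usc_on_EFin _ _ (w \o plane_pt a v1 v2)).
move=> c r r0 _.
have e t : plane_pt a v1 v2 (circle_pt c r t) =
    plane_pt a v1 v2 c + (cos t *: (r *: v1) + sin t *: (r *: v2)).
  by apply/rowP => i; rewrite !mxE /=; ring.
have dZ (u v : V) : dotv (r *: u) (r *: v) = r ^+ 2 * dotv u v.
  by rewrite !dotvE3 !mxE; ring.
have := hw (plane_pt a v1 v2 c) (r *: v1) (r *: v2).
rewrite !dZ v12 v11 mulr0 => /(_ erefl erefl).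
have -> : (fun t => w (plane_pt a v1 v2 c + (cos t *: (r *: v1) + sin t *: (r *: v2)))) =
    (fun t => w (plane_pt a v1 v2 (circle_pt c r t))).
  by apply/funext => t; rewrite e.
have cc : continuous (fun t : R => w (plane_pt a v1 v2 (circle_pt c r t))).
  move=> t; apply: (@continuous_comp _ _ _ (circle_pt c r) (w \o plane_pt a v1 v2)); last exact: cwp.
  move: t; apply: (@lipschitz_continuous _ _ _ _ r) => t t'.
  rewrite prod_normE /= ge_max; apply/andP; split.
    rewrite (_ : _ - _ = r * (cos t - cos t')); last by ring.
    by rewrite normrM gtr0_norm// ler_pM2l// cos_lip.
  rewrite (_ : _ - _ = r * (sin t - sin t')); last by ring.
  by rewrite normrM gtr0_norm// ler_pM2l// sin_lip.
by rewrite /= (rintE _ _ cc) -EFinM lee_fin /mean.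
Qed.

End MinimalPsh.

(** * Perturbing spinors to have no common zero *)

Section NoCommonZero.
Context {R : realType}.
Local Notation C := (R[i]).

Lemma avoid_finite (rs : seq C) (d : R) : 0 < d ->
  exists2 a : C, cmod a <= d & a \notin rs.
Proof.
move=> d0; pose f (n : nat) : C := (d / n.+1%:R)%:C%C.
have finj : injective f.
  move=> n m [] /(mulfI (lt0r_neq0 d0)) /invr_inj /eqP; rewrite eqr_nat => /eqP[].
  by [].
apply: contrapT => h.
have sub : {subset [seq f i | i <- iota 0 (size rs).+1] <= rs}.
  move=> _ /mapP[n _ ->]; apply: contrapT => /negP hn; apply: h; exists (f n) => //.
  rewrite cmod_real ger0_norm ?divr_ge0 ?(ltW d0)// ler_pdivrMr//.
  by rewrite ler_peMr ?(ltW d0)// ler1n.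
have := uniq_leq_size (_ : uniq [seq f i | i <- iota 0 (size rs).+1]) sub.
rewrite map_inj_uniq ?iota_uniq// size_map size_iota ltnn.
by move=> /(_ isT).
Qed.

(** Once b makes q + b nonzero it has finitely many roots, and a only has to avoid the values of - p
    at them. *)
Lemma no_common_zero (p q : {poly C}) (d : R) : 0 < d ->
  exists a b : C, [/\ cmod a <= d, cmod b <= d &
    forall w, ~ ((p + a%:P).[w] = 0 /\ (q + b%:P).[w] = 0)].
Proof.
move=> d0.
have [b bd qb] : exists2 b, cmod b <= d & q + b%:P != 0.
  have [->|q0] := eqVneq q 0.
    have [b bd] := avoid_finite [:: 0] d0; rewrite inE => b0.
    by exists b => //; rewrite add0r polyC_eq0.
  by exists 0; rewrite ?addr0 ?cmod0 ?ltW.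
have [rs qE] := closed_field_poly_normal (q + b%:P).
have [a ad ha] := avoid_finite [seq - p.[r] | r <- rs] d0.
exists a, b; split => // w [pw qw]; move/negP: ha; apply.
have wr : w \in rs.
  rewrite -root_prod_XsubC; move: qw; rewrite qE hornerZ => /eqP.
  by rewrite mulf_eq0 lead_coef_eq0 (negbTE qb).
apply/mapP; exists w => //; apply/eqP; rewrite -addr_eq0 addrC.
by move: pw; rewrite hornerD hornerC => /eqP.
Qed.

End NoCommonZero.

(** * Null discs through points of the hull *)

Section Forward.
Context {R : realType}.
Local Notation C := (R[i]).
Local Notation V := 'rV[R]_3.
Notation mu := (@lebesgue_measure R).

(** Markov's inequality, read on the complement. *)
Lemma markov_mean (q : R -> R) (e : R) : continuous q -> (forall t, 0 <= q t) ->
  mean q <= e ->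
  ((2 * pi * (1 - e))%:E <=
    mu (`[0%R, (2 * pi)%R]%classic `&` [set t | (q t < 1)%R]))%E.
Proof.
move=> cq q0 me; have p0 := twopi_gt0 (R := R).
pose I := `[0, 2 * pi]%classic : set R.
have mI : measurable I by exact: measurable_itv.
have muI : mu I = (2 * pi)%:E.
  by rewrite /I lebesgue_measure_itv /= lte_fin p0 -EFinB subr0.
pose A := I `&` [set t | q t < 1]; pose B := I `&` [set t | 1 <= q t].
have mA : measurable A.
  apply: measurableI => //; apply: open_measurable.
  have -> : [set t | q t < 1] = q @^-1` [set r | r < 1] by [].
  by apply: open_comp => // x _; exact: cq.
have mB : measurable B.
  apply: measurableI => //; apply: closed_measurable.
  have -> : [set t | 1 <= q t] = q @^-1` [set r | 1 <= r] by [].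
  by apply: closed_comp; [move=> x _; exact: cq|exact: closed_ge].
have IE : I = A `|` B.
  rewrite -setIUr; apply/seteqP; split => [t It|t []//].
  by split => //; case: (ltP (q t) 1) => h; [left|right].
have dAB : A `&` B = set0.
  by apply/seteqP; split => // t [[_ /= h1] [_ /= h2]]; move: h1; rewrite ltNge h2.
have muB : (mu B <= (2 * pi * e)%:E)%E.
  apply: (@le_trans _ _ (\int[mu]_(t in I) (q t)%:E)%E); last first.
    by rewrite (rintE _ _ cq) lee_fin rint_mean ler_pM2l.
  apply: (@le_trans _ _ (\int[mu]_(t in B) (q t)%:E)%E); last first.
    apply: ge0_subset_integral => //.
    - by apply/measurable_EFinP; apply: (measurable_funS measurableT) => //; exact: continuous_measurable_fun.
    - by move=> t _; rewrite lee_fin.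
    - by move=> t [].
  rewrite -[leLHS]mul1e -integral_cst//.
  apply: ge0_le_integral => //.
  - by apply/measurable_EFinP; apply: (measurable_funS measurableT) => //; exact: continuous_measurable_fun.
  - by move=> t [_ /=]; rewrite lee_fin.
have muAB : mu I = (mu A + mu B)%E by rewrite IE measureU.
have fB : mu B \is a fin_num.
  by rewrite ge0_fin_numE// (le_lt_trans muB)// ltry.
have -> : mu A = (mu I - mu B)%E by rewrite muAB addeK.
rewrite muI -(fineK fB) -EFinB lee_fin.
have : fine (mu B) <= 2 * pi * e by rewrite -lee_fin fineK.
lra.
Qed.

(** Test with the constant 0: over an empty K the supremum is -oo. *)
Lemma hull_neq0 (K : set V) (p : V) : minimal_hull K p -> K !=set0.
Proof.
move=> hp; apply: contrapT => /set0P/negP/negPn/eqP K0.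
have h0 : minimal_psh setT (EFin \o (fun _ : V => 0 : R)).
  apply: minimal_psh_EFin; first by move=> x; exact: cst_continuous.
  by move=> c v1 v2 _ _; rewrite mean_cst.
by have := hp _ h0; rewrite K0 image_set0 ereal_sup0.
Qed.

Lemma hull_discs (K omega : set V) (p : V) (eta : R) :
  compact K -> bounded_set omega -> open omega -> convex_set omega ->
  K `<=` omega -> omega p -> minimal_hull K p -> 0 < eta ->
  exists s, [/\ admissible omega p s,
    forall w, cmod w <= 1 -> ~ (s.1.[w] = 0 /\ s.2.[w] = 0) &
    ((2 * pi - eta)%:E <=
       mu (`[0%R, (2 * pi)%R]%classic `&`
         [set t | (dist K (disc p s (expi t)) < eta)%R]))%E].
Proof.
move=> cK bo oo cvo Ko op hp eta0; have p0 := twopi_gt0 (R := R).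
have K0 := hull_neq0 hp.
have cvx := convexP cvo.
have [Mo /= hMo] : exists M : R, forall x, omega x -> `|x| <= M.
  by case: bo => M [Mr hM]; exists (M + 1) => x ox; apply: hM => //; rewrite ltrDl.
have Mo0 : 0 <= Mo by apply: (le_trans _ (hMo p op)).
pose D := 2 * Mo.
have D0 : 0 <= D by rewrite mulr_ge0.
have hD x y : omega x -> omega y -> `|x - y| <= D.
  move=> ox oy; apply: (le_trans (ler_normB _ _)); rewrite /D mulr_natl mulr2n.
  by apply: lerD; exact: hMo.
(* Phi < 1 exactly at distance less than eta from K, so a small mean of Phi turns into the measure
   estimate. *)
pose Phi (x : V) := Num.min 1 (dist K x / eta).
have P01 x : 0 <= Phi x <= 1.
  by rewrite /Phi le_min ler01 divr_ge0 ?dist_ge0 ?(ltW eta0)//= ge_min lexx.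
have LP0 : 0 <= eta^-1 by rewrite invr_ge0 ltW.
have minlip (a b : R) : `|Num.min 1 a - Num.min 1 b| <= `|a - b|.
  wlog ab : a b / a <= b.
    by move=> H; have [/H//|/ltW/H] := leP a b; rewrite distrC (distrC b).
  rewrite (ler0_norm (x := a - b)) ?subr_le0//.
  have [a1|a1] := leP 1 a.
    by rewrite !min_l ?(le_trans a1)// subrr normr0; lra.
  have [b1|b1] := leP 1 b; last first.
    by rewrite ler0_norm ?subr_le0//; lra.
  by rewrite ler0_norm ?subr_le0 ?(ltW a1)//; lra.
have lipP x y : `|Phi x - Phi y| <= eta^-1 * `|x - y|.
  apply: (le_trans (minlip _ _)); rewrite -mulrBl normrM mulrC (ger0_norm LP0).
  by rewrite ler_wpM2l// dist_lip.
pose S := K `|` [set p].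
have So : S `<=` omega by move=> x [/Ko|->].
have [rho rho0 hrho] := compact_margin (compactU cK (@compact_set1 _ p)) oo So.
(* The inner parallel set of omega: midpoint convex, containing K and p, and at distance at least
   rho from the complement of omega. A multiple of the distance to it is therefore a suitable h. *)
pose Cc := [set x : V | forall y, `|x - y| < rho -> omega y].
have SC : S `<=` Cc by move=> x Sx y xy; exact: hrho xy.
have C0 : Cc !=set0 by exists p; apply: SC; right.
have hC a b : Cc a -> Cc b -> Cc (2^-1 *: (a + b)).
  move=> Ca Cb y hy.
  have half : 0 <= (2^-1 : R) <= 1 by apply/andP; split; lra.
  set d := y - 2^-1 *: (a + b).
  have hd : `|d| < rho by rewrite /d distrC.
  have Ha : omega (a + d) by apply: Ca; rewrite opprD addNKr normrN.
  have Hb : omega (b + d) by apply: Cb; rewrite opprD addNKr normrN.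
  have := cvx _ _ _ Ha Hb half.
  have -> : (1 - 2^-1) *: (a + d) + 2^-1 *: (b + d) = y.
    by rewrite /d; apply/rowP => i; rewrite !mxE; field.
  exact.
pose M := 4 * pi * (eta^-1 * D + 1).
have M10 : 0 < M + 1.
  by rewrite ltr_wpDl// mulr_ge0 ?mulr_ge0 ?pi_ge0// addr_ge0// mulr_ge0.
pose h (x : V) := (M + 1) / rho * dist Cc x.
have A0 : 0 < (M + 1) / rho by rewrite divr_gt0.
have h0 x : 0 <= h x by rewrite mulr_ge0 ?(ltW A0) ?dist_ge0.
have ch : continuous h.
  apply: (@lipschitz_continuous _ _ _ _ ((M + 1) / rho)) => x y.
  by rewrite -mulrBr normrM (gtr0_norm A0) ler_pM2l// dist_lip.
have hcvx x z : 2 * h x <= h (x + z) + h (x - z).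
  by rewrite /h -mulrDr mulrCA ler_pM2l// dist_midpoint.
have hout x : ~ omega x -> M + 1 <= h x.
  move=> nx; rewrite /h mulrAC ler_pdivlMr// ler_pM2l//.
  apply: dist_ge => // y Cy; rewrite leNgt; apply/negP => xy; apply: nx.
  by apply: Cy; rewrite distrC.
pose w := env_ext omega Phi h.
have cw : continuous w := continuous_env_ext oo LP0 lipP P01 cvx D0 hD ch hout.
have wpsh : minimal_psh setT (EFin \o w).
  apply: minimal_psh_EFin => // c v1 v2 v12 v11.
  have [s hs] := planar_spinor v12 v11.
  exact: (env_ext_submean oo LP0 lipP P01 cvx D0 hD ch h0 hcvx hout hs).
have hS x : S x -> h x = 0 by move=> /SC Cx; rewrite /h dist_in// mulr0.
have wK x : K x -> w x = 0.
  move=> Kx; have ox := Ko x Kx; rewrite /w env_ext_in// hS; last by left.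
  apply/eqP; rewrite eq_le le_max lexx orbT andbT ge_max lexx andbT.
  apply: (le_trans (env_le_Phi P01 ox)).
  by rewrite /Phi dist_in// mul0r ge_min lexx orbT.
(* Here hull membership is used: w is minimal plurisubharmonic and vanishes on K. *)
have envp : env omega Phi p <= 0.
  have wp : w p <= 0.
    rewrite -lee_fin; apply: (le_trans (hp _ wpsh)).
    by apply: ub_ereal_sup => _ [x Kx <-] /=; rewrite wK.
  by apply: (le_trans _ wp); rewrite /w env_ext_ge_env.
(* The perturbed disc will have mean at most 2 * e, so the bad set has measure at most 4 * pi * e <=
   16 * e = eta. *)
pose e := eta / 16; have e0 : 0 < e by rewrite divr_gt0.
have [s hs se] := env_approx P01 op e0.
have sub0 : [set x | exists2 z, cmod z <= 1 & x = disc p s z] `<=` omega.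
  by move=> _ [z z1 ->]; exact: hs.
have [r r0 hr] := compact_margin (@compact_disc_image _ p s) oo sub0.
have [Kp Kp0 hKp] := disc_perturb s.
have [d1 d10 hd1] := pos_small (mulr_ge0 Kp0 (ler0n _ 2)) (divr_gt0 r0 (ltr0n _ 2)).
have [d2 d20 hd2] := pos_small (mulr_ge0 LP0 (mulr_ge0 Kp0 (ler0n _ 2))) e0.
pose d := Num.min (Num.min d1 d2) 1.
have d0 : 0 < d by rewrite !lt_min d10 d20 ltr01.
have dd1 : d <= d1 by rewrite !ge_min lexx.
have dd2 : d <= d2 by rewrite !ge_min lexx orbT.
have dd3 : d <= 1 by rewrite ge_min lexx orbT.
(* A constant perturbation of the spinor turns the disc into an immersion and keeps its centre. *)
have [a [b [ad bd hab]]] := no_common_zero s.1 s.2 d0.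
pose s' := (s.1 + a%:P, s.2 + b%:P).
have close z : cmod z <= 1 -> `|disc p s' z - disc p s z| <= Kp * (2 * d).
  move=> z1; apply: (le_trans (hKp p z a b z1 (le_trans ad dd3) (le_trans bd dd3))).
  by rewrite ler_wpM2l// mulr_natl mulr2n lerD.
have adm : admissible omega p s'.
  move=> z z1; apply: (hr (disc p s z)); first by exists z.
  rewrite distrC; apply: (le_lt_trans (close z z1)).
  have : Kp * 2 * d <= Kp * 2 * d1 by rewrite ler_wpM2l// mulr_ge0.
  by rewrite -mulrA; lra.
exists s'; split; first exact: adm.
  by move=> z _; exact: hab.
have cP s3 : continuous (fun t => Phi (disc p s3 (expi t))).
  by move=> x; exact: (continuous_Phi_disc' lipP).
have me : mean (fun t => Phi (disc p s' (expi t))) <= 2 * e.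
  apply: (@le_trans _ _ (mean (fun t => Phi (disc p s (expi t)) + e))).
    apply: le_mean => //.
      by move=> t; apply: cvgD; [exact: cP|exact: cvg_cst].
    move=> t _; rewrite -lerBlDl (le_trans (ler_norm _))// (le_trans (lipP _ _))//.
    apply: (@le_trans _ _ (eta^-1 * (Kp * (2 * d)))).
      by rewrite ler_wpM2l// close// cmod_expi.
    apply: (le_trans _ hd2); rewrite -!mulrA !ler_wpM2l//.
  rewrite meanD// ?mean_cst; last by move=> x; exact: cst_continuous.
  by move: se envp; rewrite /disc_mean; lra.
have P0 t : 0 <= Phi (disc p s' (expi t)) by case/andP: (P01 (disc p s' (expi t))).
have mk := markov_mean (cP s') P0 me.
have -> : [set t | dist K (disc p s' (expi t)) < eta] =
    [set t | Phi (disc p s' (expi t)) < 1].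
  apply/seteqP; split => t /=; rewrite /Phi.
    by move=> h1; rewrite gt_min ltr_pdivrMr// mul1r h1 orbT.
  by rewrite gt_min ltxx /= ltr_pdivrMr// mul1r.
apply: le_trans mk; rewrite lee_fin.
have pi4 : pi <= 4 :> R by have := pihalf_lt2 R; lra.
have : pi * (2 * e) <= 4 * (2 * e) by rewrite ler_wpM2r// mulr_ge0// ltW.
rewrite /e; lra.
Qed.

End Forward.

(** * Second order expansions *)

Section Taylor2.
Context {R : realType}.
Local Notation C := (R[i]).

(* Second order expansion in polar coordinates around a point, with vanishing
   l exactly when the Laplacian vanishes there. *)
Definition tay (g : R -> R -> R) (g0 A B l : R) : Prop :=
  exists K L : R, forall e : R, 0 < e -> exists2 d : R, 0 < d &
    forall r t, 0 < r < d ->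
    `|g r t - (g0 + r * (A * cos t + B * sin t) +
       r ^+ 2 * (K * (cos t ^+ 2 - sin t ^+ 2) + L * (cos t * sin t) + l))|
      <= e * r ^+ 2.

Lemma tayD g1 g2 a1 a2 A1 A2 B1 B2 l1 l2 : tay g1 a1 A1 B1 l1 -> tay g2 a2 A2 B2 l2 ->
  tay (fun r t => g1 r t + g2 r t) (a1 + a2) (A1 + A2) (B1 + B2) (l1 + l2).
Proof.
move=> [K1 [L1 h1]] [K2 [L2 h2]]; exists (K1 + K2), (L1 + L2) => e e0.
have e20 : 0 < e / 2 by rewrite divr_gt0.
have [d1 d10 hd1] := h1 _ e20; have [d2 d20 hd2] := h2 _ e20.
exists (Num.min d1 d2); first by rewrite lt_min d10.
move=> r t /andP[r0]; rewrite lt_min => /andP[rd1 rd2].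
have := hd1 r t; rewrite r0 rd1 => /(_ isT) i1.
have := hd2 r t; rewrite r0 rd2 => /(_ isT) i2.
set x := g1 r t - _ in i1; set y := g2 r t - _ in i2.
rewrite (_ : _ - _ = x + y); last by rewrite /x /y; ring.
apply: (le_trans (ler_normD _ _)); lra.
Qed.

Lemma tayZ k g a A B l : tay g a A B l ->
  tay (fun r t => k * g r t) (k * a) (k * A) (k * B) (k * l).
Proof.
move=> [K [L h]]; exists (k * K), (k * L) => e e0.
have [e1 e10 he1] := pos_small (normr_ge0 k) e0.
have [d d0 hd] := h _ e10; exists d => // r t rd; have i1 := hd r t rd.
set x := g r t - _ in i1.
rewrite (_ : _ - _ = k * x); last by rewrite /x; ring.
rewrite normrM; apply: (@le_trans _ _ (`|k| * (e1 * r ^+ 2))); first by rewrite ler_wpM2l.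
by rewrite mulrA ler_wpM2r ?sqr_ge0.
Qed.

Lemma tay_sum (I : Type) (s : seq I) (g : I -> R -> R -> R) (a A B l : I -> R) :
  (forall i, tay (g i) (a i) (A i) (B i) (l i)) ->
  tay (fun r t => \sum_(i <- s) g i r t) (\sum_(i <- s) a i)
    (\sum_(i <- s) A i) (\sum_(i <- s) B i) (\sum_(i <- s) l i).
Proof.
move=> h; elim: s => [|i s IH].
  exists 0, 0 => e e0; exists 1 => // r t _.
  by rewrite !big_nil !(mul0r, addr0, mulr0) subrr normr0 mulr_ge0 ?sqr_ge0 ?ltW.
rewrite !big_cons; have := tayD (h i) IH.
by congr tay; apply/funext => r; apply/funext => t; rewrite big_cons.
Qed.

Lemma tay_cst c : tay (fun _ _ => c) c 0 0 0.
Proof.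
exists 0, 0 => e e0; exists 1 => // r t _.
by rewrite !(mul0r, addr0, mulr0) subrr normr0 mulr_ge0 ?sqr_ge0 ?ltW.
Qed.

(** Here g is O(r ^+ 2), so its square is O(r ^+ 4) and only the linear term - 2 * x * g matters,
    whose part without trigonometric factors is 0. *)
Lemma tay_sqr (x : R) g : tay g 0 0 0 0 ->
  tay (fun r t => (x - g r t) ^+ 2) (x ^+ 2) 0 0 0.
Proof.
move=> [K [L h]]; exists (- 2 * x * K), (- 2 * x * L) => e e0.
pose Q := `|K| + `|L| + 1.
have Q0 : 0 < Q by rewrite ltr_wpDl// addr_ge0.
have e20 : 0 < e / 2 by rewrite divr_gt0.
have [e1 e10 he1] := pos_small (mulr_ge0 (ler0n R 2) (normr_ge0 x)) e20.
have [e2 e20' he2] := pos_small (sqr_ge0 Q) e20.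
pose e3 := Num.min e1 1; have e30 : 0 < e3 by rewrite lt_min e10 ltr01.
have [d d0 hd] := h _ e30.
exists (Num.min d (Num.min e2 1)); first by rewrite !lt_min d0 e20' ltr01.
move=> r t /andP[r0]; rewrite !lt_min => /andP[rd /andP[re2 r1]].
have := hd r t; rewrite r0 rd => /(_ isT).
pose q := K * (cos t ^+ 2 - sin t ^+ 2) + L * (cos t * sin t).
rewrite (_ : g r t - _ = g r t - r ^+ 2 * q); last by rewrite /q; ring.
move=> i1.
have i2 : `|g r t - r ^+ 2 * q| <= e1 * r ^+ 2.
  by apply: (le_trans i1); rewrite ler_wpM2r ?sqr_ge0// ge_min lexx.
have i3 : `|g r t - r ^+ 2 * q| <= r ^+ 2.
  by apply: (le_trans i1); rewrite ler_piMl ?sqr_ge0// ge_min lexx orbT.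
have qQ : `|q| <= Q - 1.
  have := ler_normD (K * (cos t ^+ 2 - sin t ^+ 2)) (L * (cos t * sin t)).
  rewrite /q !normrM /Q addrK => /le_trans; apply; apply: lerD.
    rewrite ler_piMr//; have c1 := sqr_ge0 (cos t); have s1 := sqr_ge0 (sin t).
    by have := cos2Dsin2 t; rewrite ler_norml => ?; apply/andP; split; lra.
  by rewrite ler_piMr// mulr_ile1 ?normr_ge0 ?cos_max ?sin_max.
have gQ : `|g r t| <= Q * r ^+ 2.
  rewrite -[g r t](subrK (r ^+ 2 * q)); apply: (le_trans (ler_normD _ _)).
  rewrite normrM (ger0_norm (sqr_ge0 r)).
  have : r ^+ 2 * `|q| <= r ^+ 2 * (Q - 1) by rewrite ler_wpM2l ?sqr_ge0.
  lra.
rewrite (_ : _ - _ = - (2 * x * (g r t - r ^+ 2 * q)) + g r t ^+ 2); last by rewrite /q; ring.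
apply: (le_trans (ler_normD _ _)); rewrite normrN.
have j1 : `|2 * x * (g r t - r ^+ 2 * q)| <= e / 2 * r ^+ 2.
  rewrite normrM normrM ger0_norm//.
  apply: (@le_trans _ _ (2 * `|x| * (e1 * r ^+ 2))); first by rewrite ler_wpM2l ?mulr_ge0.
  by rewrite mulrA ler_wpM2r ?sqr_ge0.
have j2 : `|g r t ^+ 2| <= e / 2 * r ^+ 2.
  rewrite normrX; apply: (@le_trans _ _ ((Q * r ^+ 2) ^+ 2)).
    by apply: lerXn2r; rewrite ?nnegrE// mulr_ge0 ?sqr_ge0 ?(ltW Q0).
  rewrite exprMn -exprM (_ : (2 * 2)%N = (2 + 2)%N)// exprD mulrA ler_wpM2r ?sqr_ge0//.
  apply: (le_trans _ he2); rewrite ler_wpM2l ?sqr_ge0//.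
  rewrite expr2; apply: (@le_trans _ _ (1 * r)); last by rewrite mul1r ltW.
  by rewrite ler_pM2r// ltW.
lra.
Qed.

Lemma continuous_trig2 (A B K L : R) : continuous (fun t : R => A * cos t + B * sin t +
    (K * (cos t ^+ 2 - sin t ^+ 2) + L * (cos t * sin t))).
Proof.
have hc : continuous (@cos R) := @continuous_cos R.
have hs : continuous (@sin R) := @continuous_sin R.
move=> t; apply: cvgD; apply: cvgD.
- by apply: cvgM; [exact: cvg_cst|exact: hc].
- by apply: cvgM; [exact: cvg_cst|exact: hs].
- apply: cvgM; first exact: cvg_cst.
  by rewrite !expr2; apply: cvgB; apply: cvgM; try exact: hc; exact: hs.
- by apply: cvgM; [exact: cvg_cst|apply: cvgM; [exact: hc|exact: hs]].
Qed.

Lemma mean_trig (A B K L : R) :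
  mean (fun t => A * cos t + B * sin t +
    (K * (cos t ^+ 2 - sin t ^+ 2) + L * (cos t * sin t))) = 0.
Proof.
have p0 := ltW (twopi_gt0 (R := R)).
pose F (t : R) := A * sin t - B * cos t + (K * (sin t * cos t) + L / 2 * (sin t * sin t)).
have dF x : 0 <= x <= 2 * pi -> is_derive x (1 : R) F
  (A * cos x + B * sin x + (K * (cos x ^+ 2 - sin x ^+ 2) + L * (cos x * sin x))).
  move=> _; apply: is_derive_eq; rewrite /GRing.scale /=; by field.
rewrite /mean (rint_FTC p0 (@continuous_trig2 A B K L) dF) /F mulr_natl cos2pi sin2pi cos0 sin0.
by rewrite subrr mulr0.
Qed.

(** The trigonometric terms have mean 0, and an error of at most - l / 2 * r ^+ 2 still leaves a + l
    / 2 * r ^+ 2 < a. The continuous majorant q stands in for g, which may fail to be continuous in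
    t. *)
Lemma tay_mean g a A B l : tay g a A B l -> l < 0 -> exists2 d : R, 0 < d &
  forall r, 0 < r < d -> exists q : R -> R,
    [/\ continuous q, forall t, g r t <= q t & mean q < a].
Proof.
move=> [K [L h]] l0; have e0 : 0 < - l / 2 by rewrite divr_gt0// oppr_gt0.
have [d d0 hd] := h _ e0; exists d => // r rd.
pose T t := (r * A) * cos t + (r * B) * sin t +
  ((r ^+ 2 * K) * (cos t ^+ 2 - sin t ^+ 2) + (r ^+ 2 * L) * (cos t * sin t)).
have cT : continuous T by exact: continuous_trig2.
exists (fun t => T t + (a + l / 2 * r ^+ 2)); split.
- by move=> t; apply: cvgD; [exact: cT|exact: cvg_cst].
- move=> t; have := hd r t rd; rewrite ler_norml => /andP[_]; rewrite /T; lra.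
rewrite meanD//; last by move=> t; exact: cst_continuous.
rewrite mean_cst mean_trig add0r; have /andP[r0 _] := rd.
have r20 : 0 < r ^+ 2 by rewrite exprn_gt0.
rewrite gtrDl pmulr_llt0//; lra.
Qed.

Lemma diff_eps (U : normedModType R) (f : U -> R) (z : U) : differentiable f z ->
  forall e : R, 0 < e -> exists2 d : R, 0 < d & forall h, `|h| < d ->
    `|f (z + h) - f z - 'd f z h| <= e * `|h|.
Proof.
move=> /diff_locally /eqaddoP df e e0.
have := df e e0; rewrite /= => /nbhs_ballP[d /= d0 hd].
exists d => // h hh; have := hd h; rewrite -ball_normE /= sub0r normrN => /(_ hh).
have -> : (f \o +%R^~ z - (cst (f z) + 'd f z)) h = f (h + z) - (f z + 'd f z h) by [].
by rewrite (addrC h) opprD addrA.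
Qed.

Lemma derive_pair (f : R * R -> R) (z h : R * R) : differentiable f z ->
  'd f z h = h.1 * 'D_((1, 0) : R * R) f z + h.2 * 'D_((0, 1) : R * R) f z.
Proof.
move=> df; rewrite !deriveE//.
have {1}-> : h = h.1 *: ((1, 0) : R * R) + h.2 *: ((0, 1) : R * R).
  by case: h => a b; apply/pair_equal_spec; split; rewrite /= /GRing.scale /= mulr1 mulr0 ?addr0 ?add0r.
by rewrite linearD !linearZ.
Qed.

Definition polar_shift (g : R * R -> R) (z : R * R) (r t : R) : R :=
  g (z + (r * cos t, r * sin t)).

(** The mean value theorem on the segment from z to z + eta is applied to g minus its quadratic
    model; the derivative of this difference is the first order error of the gradient, so
    differentiability of gx and gy at z suffices. The vanishing Laplacian makes the pure second
    order part a multiple of cos ^+ 2 - sin ^+ 2. *)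
Lemma tay_harmonic (g gx gy : R * R -> R) (z : R * R) (d0 : R) : 0 < d0 ->
  (forall w, `|w - z| < d0 -> [/\ differentiable g w,
     'D_((1, 0) : R * R) g w = gx w & 'D_((0, 1) : R * R) g w = gy w]) ->
  differentiable gx z -> differentiable gy z ->
  'D_((1, 0) : R * R) gx z + 'D_((0, 1) : R * R) gy z = 0 ->
  tay (polar_shift g z) (g z) (gx z) (gy z) 0.
Proof.
move=> d00 dg dgx dgy lap.
set gxx := 'D_((1, 0) : R * R) gx z in lap; set gyy := 'D_((0, 1) : R * R) gy z in lap.
pose gxy := 'D_((0, 1) : R * R) gx z; pose gyx := 'D_((1, 0) : R * R) gy z.
exists (gxx / 2), ((gxy + gyx) / 2) => e e0.
have e20 : 0 < e / 2 by rewrite divr_gt0.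
have [d1 d10 h1] := diff_eps dgx e20; have [d2 d20 h2] := diff_eps dgy e20.
exists (Num.min d0 (Num.min d1 d2)); first by rewrite !lt_min d00 d10.
move=> r t /andP[r0]; rewrite !lt_min => /andP[rd0 /andP[rd1 rd2]].
pose eta : R * R := (r * cos t, r * sin t).
have neta : `|eta| <= r.
  rewrite prod_normE /= ge_max !normrM (gtr0_norm r0).
  by rewrite !ler_piMr ?(ltW r0) ?cos_max ?sin_max.
pose phi (s : R) := g (z + s *: eta) -
  (s * (gx z * eta.1 + gy z * eta.2) +
   s ^+ 2 * (gxx / 2 * (eta.1 ^+ 2 - eta.2 ^+ 2) + (gxy + gyx) / 2 * (eta.1 * eta.2))).
have sr (s : R) : 0 <= s <= 1 -> `|s *: eta| <= r.
  move=> /andP[s0 s1]; rewrite normrZ ger0_norm//.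
  by rewrite -[leRHS]mul1r; apply: ler_pM.
pose phi' (s : R) := (gx (z + s *: eta) * eta.1 + gy (z + s *: eta) * eta.2) -
  ((gx z * eta.1 + gy z * eta.2) +
   s *+ 2 * (gxx / 2 * (eta.1 ^+ 2 - eta.2 ^+ 2) + (gxy + gyx) / 2 * (eta.1 * eta.2))).
have dphi (s : R) : 0 <= s <= 1 -> is_derive s (1 : R) phi (phi' s).
  move=> s01; have [|dgs gxE gyE] := dg (z + s *: eta).
    by rewrite addrC addKr (le_lt_trans (sr s s01)).
  have D1 : is_derive s (1 : R) (fun s : R => g (z + s *: eta))
      (gx (z + s *: eta) * eta.1 + gy (z + s *: eta) * eta.2).
    have Dg : is_derive (z + s *: eta) eta g ('D_eta g (z + s *: eta)).
      by apply: derivableP; exact: diff_derivable.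
    have DE : 'D_eta g (z + s *: eta) =
       gx (z + s *: eta) * eta.1 + gy (z + s *: eta) * eta.2.
      by rewrite [LHS]deriveE// derive_pair// gxE gyE mulrC (mulrC eta.2).
    have E : (fun h : R => h^-1 *: (((fun s : R => g (z + s *: eta)) \o shift s) (h *: (1 : R)) - g (z + s *: eta)))
      = (fun h : R => h^-1 *: ((g \o shift (z + s *: eta)) (h *: eta) - g (z + s *: eta))).
      apply/funext => h; congr (_ *: (_ - _)); rewrite /= /shift /=; congr g.
      by rewrite scalerDl addrCA /GRing.scale /= mulr1.
    have der : derivable (fun s : R => g (z + s *: eta)) s (1 : R).
      by rewrite /derivable E; exact: (diff_derivable dgs).
    apply: DeriveDef => //; rewrite /derive E -DE; by [].
  rewrite /phi /phi'; apply: is_derive_eq; rewrite /GRing.scale /=; ring.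
have cphi : {within `[0, 1], continuous phi}.
  apply/continuous_in_subspaceT => s; rewrite inE /= in_itv /= => s01.
  apply: differentiable_continuous; apply/derivable1_diffP.
  by case: (dphi s s01).
have [s s01 sE] := @MVT_segment R phi phi' 0 1 ler01 (fun s hs =>
  dphi s (subset_itv_oo_cc hs)) cphi.
rewrite in_itv /= in s01.
have -> : polar_shift g z r t - (g z + r * (gx z * cos t + gy z * sin t) +
    r ^+ 2 * (gxx / 2 * (cos t ^+ 2 - sin t ^+ 2) + (gxy + gyx) / 2 * (cos t * sin t) + 0))
    = phi 1 - phi 0.
  rewrite /phi /polar_shift scale1r scale0r (addr0 z) -/eta /eta /=; ring.
rewrite sE subr0 mulr1.
have i1 := h1 (s *: eta) (le_lt_trans (sr s s01) rd1).
have i2 := h2 (s *: eta) (le_lt_trans (sr s s01) rd2).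
have E1 : 'd gx z (s *: eta) = (s * eta.1) * gxx + (s * eta.2) * gxy by exact: derive_pair.
have E2 : 'd gy z (s *: eta) = (s * eta.1) * gyx + (s * eta.2) * gyy by exact: derive_pair.
rewrite {}E1 in i1; rewrite {}E2 in i2.
have gyyE : gyy = - gxx by apply/eqP; rewrite -addr_eq0 addrC lap.
set X := gx (z + s *: eta) - _ - _ in i1; set Y := gy (z + s *: eta) - _ - _ in i2.
have -> : phi' s = X * eta.1 + Y * eta.2.
  by rewrite /phi' /X /Y gyyE /= /GRing.scale /=; field.
have n1 : `|eta.1| <= r by apply: le_trans neta; rewrite prod_normE /= le_max lexx.
have n2 : `|eta.2| <= r by apply: le_trans neta; rewrite prod_normE /= le_max lexx orbT.
have X1 : `|X| <= e / 2 * r by apply: (le_trans i1); rewrite ler_wpM2l ?(ltW e20)// sr.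
have Y1 : `|Y| <= e / 2 * r by apply: (le_trans i2); rewrite ler_wpM2l ?(ltW e20)// sr.
apply: (le_trans (ler_normD _ _)); rewrite (normrM X) (normrM Y).
rewrite (_ : e * r ^+ 2 = e / 2 * r * r + e / 2 * r * r); last by field.
have j1 := ler_pM (normr_ge0 X) (normr_ge0 eta.1) X1 n1.
have j2 := ler_pM (normr_ge0 Y) (normr_ge0 eta.2) Y1 n2.
exact: (lerD j1 j2).
Qed.

End Taylor2.

(** * Poisson kernels with poles off the closed disc *)

Section PoissonKernel.
Context {R : realType}.
Local Notation C := (R[i]).

(** The Poisson kernel with pole a. For a pole outside the closed disc it is positive and continuous
    up to the circle, and its value at the centre is 1. *)
Definition pois (a : C) (z : R * R) : R := complex.Re ((a + toC z) / (a - toC z)).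

Lemma Re_div (u w : C) : w != 0 -> complex.Re (u / w) =
  (complex.Re u * complex.Re w + complex.Im u * complex.Im w) / cmod w ^+ 2.
Proof.
move=> w0; set q := u / w; have -> : u = q * w by rewrite /q divfK.
have cw : cmod w ^+ 2 != 0 by rewrite expf_neq0// cmod_eq0.
apply: (mulIf cw); rewrite divfK// sqr_cmod !(cReM, cImM); ring.
Qed.

Lemma pois_E (a : C) (z : R * R) : a - toC z != 0 ->
  pois a z = (cmod a ^+ 2 - cmod (toC z) ^+ 2) / cmod (a - toC z) ^+ 2.
Proof.
move=> az; rewrite /pois Re_div//; congr (_ / _); rewrite !sqr_cmod !(cReD, cImD, cReN, cImN); ring.
Qed.

Lemma toC_shift (z : R * R) (r t : R) :
  toC (z + (r * cos t, r * sin t)) = toC z + r%:C%C * expi t.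
Proof.
apply: complex_eq; rewrite !(cReD, cImD, cReM, cImM) /=; ring.
Qed.

(** Expand in powers of eta = r e^{it} by the geometric series: the real part of k2 * eta ^+ 2 has
    no constant term in t, and the explicit remainder is cubic. *)
Lemma tay_pois (a : C) (z : R * R) : a - toC z != 0 ->
  exists A B, tay (polar_shift (pois a) z) (pois a z) A B 0.
Proof.
set w := a - toC z => w0.
pose k1 := 2 * a / w ^+ 2; pose k2 := 2 * a / w ^+ 3.
exists (complex.Re k1), (- complex.Im k1), (complex.Re k2), (- 2 * complex.Im k2) => e e0.
pose W := cmod w; have W0 : 0 < W by rewrite lt_neqAle cmod_ge0 eq_sym cmod_eq0 w0.
pose K := 4 * cmod a / W ^+ 4.
have K0 : 0 <= K by rewrite divr_ge0 ?mulr_ge0 ?cmod_ge0 ?exprn_ge0 ?(ltW W0).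
have [e1 e10 he1] := pos_small K0 e0.
exists (Num.min e1 (W / 2)); first by rewrite lt_min e10 divr_gt0.
move=> r t /andP[r0]; rewrite lt_min => /andP[re rW].
set eta : C := r%:C%C * expi t.
have ceta : cmod eta = r by rewrite cmodM cmod_expi cmod_real gtr0_norm// mulr1.
have W2 : W / 2 <= cmod (w - eta).
  have := cmodD (w - eta) eta; rewrite subrK -/W ceta; lra.
have we0 : w - eta != 0.
  by rewrite -cmod_eq0 gt_eqF// (lt_le_trans _ W2)// divr_gt0.
pose rem := 2 * a * eta ^+ 3 / (w ^+ 3 * (w - eta)).
have E : (a + (toC z + eta)) / (w - eta) = (a + toC z) / w + k1 * eta + k2 * eta ^+ 2 + rem.
  have -> : toC z = a - w by rewrite /w; ring.
  by rewrite /k1 /k2 /rem; field; rewrite we0 w0.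
have -> : polar_shift (pois a) z r t = complex.Re ((a + toC z) / w + k1 * eta + k2 * eta ^+ 2 + rem).
  rewrite -E /polar_shift /pois toC_shift; congr complex.Re; congr (_ / _).
  by rewrite /w opprD addrA.
have -> : complex.Re ((a + toC z) / w + k1 * eta + k2 * eta ^+ 2 + rem) -
  (pois a z + r * (complex.Re k1 * cos t + - complex.Im k1 * sin t) +
   r ^+ 2 * (complex.Re k2 * (cos t ^+ 2 - sin t ^+ 2) + - 2 * complex.Im k2 * (cos t * sin t) + 0))
  = complex.Re rem.
  have R1 (k : C) : complex.Re (k * eta) = r * (complex.Re k * cos t - complex.Im k * sin t).
    rewrite /eta !(cReM, cImM) /=; ring.
  have R2 : complex.Re (k2 * eta ^+ 2) = r ^+ 2 * (complex.Re k2 *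
      (cos t ^+ 2 - sin t ^+ 2) - 2 * complex.Im k2 * (cos t * sin t)).
    rewrite expr2 /eta !(cReM, cImM) /=; ring.
  rewrite !cReD -/(pois a z) R1 R2; ring.
apply: (le_trans (ler_Re_cmod _)).
have -> : cmod rem = 2 * cmod a * r ^+ 3 / (W ^+ 3 * cmod (w - eta)).
  rewrite /rem (cmodM (2 * a * eta ^+ 3)) cmodV (cmodM (w ^+ 3)) (cmodM (2 * a)).
  by rewrite (cmodM 2) !(cmodX _ 3) cmod_nat ceta.
apply: (@le_trans _ _ (2 * cmod a * r ^+ 3 / (W ^+ 3 * (W / 2)))).
  rewrite ler_wpM2l ?mulr_ge0 ?cmod_ge0 ?exprn_ge0 ?(ltW r0)//.
  rewrite lef_pV2 ?posrE ?mulr_gt0 ?exprn_gt0 ?divr_gt0// ?(lt_le_trans _ W2) ?divr_gt0//.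
  by rewrite ler_wpM2l// exprn_ge0// ltW.
have -> : 2 * cmod a * r ^+ 3 / (W ^+ 3 * (W / 2)) = K * r * r ^+ 2.
  by rewrite /K; field; rewrite gt_eqF.
by rewrite ler_wpM2r ?sqr_ge0// (le_trans _ he1)// ler_wpM2l// ltW.
Qed.

Lemma continuous_pois (a : C) (z : R * R) : a - toC z != 0 -> {for z, continuous (pois a)}.
Proof.
move=> az; have cf : continuous (fun y : R * R => y.1) by move=> y; exact: cvg_fst.
have cs : continuous (fun y : R * R => y.2) by move=> y; exact: cvg_snd.
pose N (y : R * R) := (complex.Re a + y.1) * (complex.Re a - y.1) +
   (complex.Im a + y.2) * (complex.Im a - y.2).
pose Dn (y : R * R) := (complex.Re a - y.1) ^+ 2 + (complex.Im a - y.2) ^+ 2.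
have cN : {for z, continuous N}.
  apply: cvgD; apply: cvgM; (apply: cvgD || apply: cvgB); try exact: cvg_cst;
    try exact: cf; try exact: cs; (try apply: cvgN); try exact: cf; exact: cs.
have cD : {for z, continuous Dn}.
  rewrite /Dn; apply: cvgD; rewrite expr2; apply: cvgM; apply: cvgB; try exact: cvg_cst;
    try exact: cf; exact: cs.
have Dz : Dn z != 0.
  have -> : Dn z = cmod (a - toC z) ^+ 2.
    by rewrite sqr_cmod !(cReD, cImD, cReN, cImN).
  by rewrite expf_neq0// cmod_eq0.
have [d d0 hd] : exists2 d : R, 0 < d & forall y, `|z - y| < d -> Dn y != 0.
  have := norm_continuous_at cD => /(_ (`|Dn z| / 2)) [|d d0 hd].
    by rewrite divr_gt0// normr_gt0.
  exists d => // y /hd; apply: contraTneq => ->; rewrite subr0 -ltNge.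
  by rewrite ltr_pdivrMr// ltr_pMr ?normr_gt0// ltr1n.
apply: (@continuous_at_eq _ _ _ _ (fun y => N y * (Dn y)^-1) z d d0).
  move=> y /hd Dy; rewrite /pois Re_div.
    rewrite sqr_cmod !(cReD, cImD, cReN, cImN) //=.
  apply: contraNneq Dy => h; rewrite /Dn.
  have := congr1 (@complex.Re R) h; have := congr1 (@complex.Im R) h.
  by rewrite !(cReD, cImD, cReN, cImN) /= => -> ->; rewrite expr0n addr0.
by apply: cvgM => //; apply: cvgV.
Qed.

End PoissonKernel.

(** * Maxima and integrals of upper semicontinuous functions *)

Section UpperSemicontinuous.
Context {R : realType}.
Notation mu := (@lebesgue_measure R).

Lemma ereal_between (x y : \bar R) : (x < y)%E -> exists b : R, (x < b%:E < y)%E.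
Proof.
case: x => [x| |]; case: y => [y| |] //.
- rewrite lte_fin => xy; exists ((x + y) / 2); rewrite !lte_fin; apply/andP; split; lra.
- by move=> _; exists (x + 1); rewrite lte_fin ltry andbT ltrDl.
- by move=> _; exists (y - 1); rewrite lte_fin ltNyr /= gtrBl.
- by move=> _; exists 0; rewrite ltNyr ltry.
Qed.

(** If the supremum S were not attained, the sublevel sets at levels below S would cover A, and by
    compactness a single level below S would bound u. *)
Lemma usc_max (T : topologicalType) (A : set T) (u : T -> \bar R) :
  compact A -> A !=set0 ->
  (forall x, A x -> forall b : R, (u x < b%:E)%E -> \forall y \near x, (u y < b%:E)%E) ->
  exists2 x, A x & forall y, A y -> (u y <= u x)%E.
Proof.
move=> cA [a Aa] hu; pose S := ereal_sup (u @` A).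
have uS x : A x -> (u x <= S)%E by move=> Ax; apply: ereal_sup_ubound; exists x.
apply: contrapT => hn.
have lt x : A x -> (u x < S)%E.
  move=> Ax; rewrite lt_neqAle uS// andbT; apply/eqP => ux; apply: hn; exists x => //.
  by move=> y Ay; rewrite ux; exact: uS.
(* The filter of levels c increasing to S, which may be +oo. *)
pose F : set_system R := filter_from [set b | (b%:E < S)%E]
  (fun b => [set c | (b <= c)%R /\ (c%:E < S)%E]).
have [b0 /andP[_ b0S]] := ereal_between (lt a Aa).
have FF : Filter F.
  apply: filter_from_filter; first by exists b0.
  move=> i j iS jS; exists (Num.max i j) => /=.
    by rewrite /= /Num.max; case: ifP.
  by move=> c [] /=; rewrite ge_max => /andP[ic jc] cS.
have /compact_near_coveringP/(_ _ F (fun c x => (u x < c%:E)%E) FF) := cA.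
move=> [|c cS hc].
  move=> x Ax; have [b /andP[ub bS]] := ereal_between (lt x Ax).
  exists ([set y | (u y < b%:E)%E], [set c | (b <= c)%R /\ (c%:E < S)%E]).
    by split; [exact: hu|exists b].
  by move=> [y c] /= [uy [bc _]]; apply: lt_le_trans uy _; rewrite lee_fin.
have cSA : (S <= c%:E)%E.
  apply: ub_ereal_sup => _ [x Ax <-]; apply/ltW; exact: (hc c).
by move: cS => /=; rewrite ltNge cSA.
Qed.

Lemma usc_measurable (f : R -> \bar R) :
  (forall x (b : R), (f x < b%:E)%E -> \forall y \near x, (f y < b%:E)%E) ->
  measurable_fun setT f.
Proof.
move=> hf.
have h : measurable_fun setT (fun x => - f x)%E.
  apply: lower_semicontinuous_measurable => x a; rewrite lteNr => fx.
  exists [set y | (f y < (- a)%:E)%E]; first exact: hf.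
  by move=> y /=; rewrite lteNr.
have := measurableT_comp (@oppe_measurable R setT) h.
by congr measurable_fun; apply/funext => x /=; rewrite oppeK.
Qed.

(** The integral of f may be -oo, so positive and negative parts are compared separately. *)
Lemma le_integral_continuous (a b : R) (f : R -> \bar R) (q : R -> R) :
  measurable_fun setT f -> continuous q -> (forall t, (f t <= (q t)%:E)%E) ->
  (\int[mu]_(t in `[a, b]) f t <= (rint a b q)%:E)%E.
Proof.
move=> mf cq fq; rewrite -(rintE _ _ cq).
have mq : measurable_fun setT (EFin \o q).
  by apply/measurable_EFinP; exact: continuous_measurable_fun.
have S (g : R -> \bar R) : measurable_fun setT g -> measurable_fun (`[a, b] : set R) g.
  by move=> mg; exact: (measurable_funS measurableT (@subsetT _ _) mg).
rewrite integralE [leRHS]integralE; apply: leeB.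
  apply: ge0_le_integral => //.
  - by apply: measurable_funepos; exact: S.
  - by apply: measurable_funepos; exact: S.
  - by move=> t _; apply: (@funepos_le _ _ setT) => [x _|]; [exact: fq|rewrite inE].
apply: ge0_le_integral => //.
- by apply: measurable_funeneg; exact: S.
- by apply: measurable_funeneg; exact: S.
- by move=> t _; apply: (@funeneg_le _ _ setT) => [x _|]; [exact: fq|rewrite inE].
Qed.

End UpperSemicontinuous.

(** * The maximum principle along minimal discs *)

Section Viscosity.
Context {R : realType} {n : nat}.
Local Notation V := 'rV[R]_n.
Notation mu := (@lebesgue_measure R).

Lemma usc_at (u : V -> \bar R) x (b : R) : minimal_psh setT u -> (u x < b%:E)%E ->
  \forall y \near x, (u y < b%:E)%E.
Proof.
move=> [[_ h] _] ux; have := h x Logic.I b ux; rewrite near_withinE.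
by apply: filterS => y /(_ Logic.I).
Qed.

Lemma psh_ltry (u : V -> \bar R) x : minimal_psh setT u -> (u x < +oo)%E.
Proof. by move=> [[h _] _]; rewrite ltey h. Qed.

(* If u is touched from above at x, along a conformal plane, by g whose Laplacian
   is negative, the mean value inequality on a small circle fails unless
   u x < g0. *)
Lemma psh_touch (u : V -> \bar R) (x X Y : V) g (g0 A B l d : R) :
  minimal_psh setT u -> isothermal X Y -> tay g g0 A B l -> l < 0 -> 0 < d ->
  (forall r t, 0 < r < d ->
     (u (plane_pt x X Y (circle_pt (0%R, 0%R) r t)) <= (g r t)%:E)%E) ->
  (u x < g0%:E)%E.
Proof.
move=> pu iXY tg l0 d0 hu; have [d' d'0 hd'] := tay_mean tg l0.
pose r := Num.min d d' / 2.
have m0 : 0 < Num.min d d' by rewrite lt_min d0.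
have r0 : 0 < r by rewrite divr_gt0.
have rm : r < Num.min d d' by rewrite ltr_pdivrMr// ltr_pMr// ltr1n.
move: rm; rewrite lt_min => /andP[rd rd'].
have [|q [cq gq mq]] := hd' r; first by rewrite r0.
pose f t := u (plane_pt x X Y (circle_pt (0, 0) r t)).
have cgam : continuous (fun t => plane_pt x X Y (circle_pt (0, 0) r t)).
  move=> t; apply: cvgD; last first.
    apply: cvgZl; apply: cvgD; first exact: cvg_cst.
    by apply: cvgM; [exact: cvg_cst|exact: continuous_sin].
  apply: cvgD; first exact: cvg_cst.
  apply: cvgZl; apply: cvgD; first exact: cvg_cst.
  by apply: cvgM; [exact: cvg_cst|exact: continuous_cos].
have mf : measurable_fun setT f.
  apply: usc_measurable => t b fb.
  exact: (cgam t _ (usc_at pu fb)).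
have hf t : (f t <= (q t)%:E)%E.
  by apply: (le_trans (hu r t _)); rewrite ?r0// lee_fin.
have [_ hs] := pu; have [_ /(_ (0, 0) r r0)] := hs x X Y iXY.
move=> /(_ (fun _ _ => Logic.I)) /=.
have -> : plane_pt x X Y (0, 0) = x by rewrite /plane_pt /= !scale0r !addr0.
move=> sm; apply: (le_lt_trans sm).
apply: (@le_lt_trans _ _ ((2 * pi)^-1%:E * (rint 0 (2 * pi) q)%:E)%E).
  apply: lee_wpmul2l; first by rewrite lee_fin invr_ge0 ltW// twopi_gt0.
  exact: le_integral_continuous.
by rewrite -EFinM lte_fin.
Qed.

Lemma continuous_sqr_plane : continuous (fun z : R * R => z.1 ^+ 2 + z.2 ^+ 2).
Proof.
by move=> z; apply: cvgD; rewrite expr2; apply: cvgM; (exact: cvg_fst || exact: cvg_snd).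
Qed.

Lemma compact_norm_le (r : R) : compact [set x : V | `|x| <= r].
Proof.
apply: bounded_closed_compact.
  exists r; split; first exact: num_real.
  by move=> M rM x xr; exact: le_trans xr (ltW rM).
have -> : [set x : V | `|x| <= r] = (fun x : V => `|x|) @^-1` [set s | s <= r] by [].
by apply: closed_comp; [move=> x _; exact: norm_continuous|exact: closed_le].
Qed.

Lemma closed_unit_disc0 : closed_unit_disc (0 : R, 0 : R).
Proof. by rewrite /closed_unit_disc /= expr0n addr0. Qed.

Lemma subset_unit_disc : @unit_disc R `<=` @closed_unit_disc R.
Proof. by move=> z /ltW. Qed.

Lemma compact_closed_unit_disc : compact (@closed_unit_disc R).
Proof.
have sub : @closed_unit_disc R `<=` `[(-1 : R), 1] `*` `[(-1 : R), 1].
  move=> z; rewrite /closed_unit_disc /= => z1.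
  have h1 := sqr_ge0 z.1; have h2 := sqr_ge0 z.2.
  split; rewrite /= in_itv /= -ler_norml -[leRHS]ger0_norm// -ler_sqr ?nnegrE//;
    rewrite !real_normK ?num_real// expr1n; lra.
apply: (subclosed_compact _ _ sub); last first.
  by apply: compact_setX; exact: segment_compact.
have -> : @closed_unit_disc R = (fun z : R * R => z.1 ^+ 2 + z.2 ^+ 2) @^-1` [set x | x <= 1] by [].
apply: closed_comp; last exact: closed_le.
by move=> z _; exact: continuous_sqr_plane.
Qed.

Lemma continuous_attains_max (T : topologicalType) (A : set T) (h : T -> R) :
  compact A -> A !=set0 -> (forall x, A x -> {for x, continuous h}) ->
  exists2 x, A x & forall y, A y -> h y <= h x.
Proof.
move=> cA A0 ch; have [x Ax c|x Ax hx] := @usc_max R _ A (EFin \o h) cA A0.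
  move=> /=; rewrite lte_fin => hb; have cx : {for x, continuous h} := ch x Ax.
  apply: (cx [set r | (r%:E < c%:E)%E]).
  apply: (@filterS _ (nbhs (h x)) _ [set r | r < c]) => [r|]; first by rewrite /= lte_fin.
  by apply: open_nbhs_nbhs; split; [exact: open_lt|].
by exists x => // y /hx; rewrite lee_fin.
Qed.

Lemma continuous_dotv : continuous (fun x : V => dotv x x).
Proof.
have h (i : 'I_n) : continuous (fun x : V => x ord0 i * x ord0 i).
  move=> x; exact: (continuousM (@continuous_rv_coord R n i x) (@continuous_rv_coord R n i x)).
rewrite /dotv; apply: continuous_big => [|i _]; [exact: add_continuous|exact: h].
Qed.

Lemma sqr_norm_le_dotv (x : V) : `|x| ^+ 2 <= dotv x x.
Proof.
rewrite -(sqr_sqrtr (dotv_ge0 x)); apply: lerXn2r; rewrite ?nnegrE ?sqrtr_ge0//.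
exact: norm_le_enorm.
Qed.

Lemma tay_shift_sqr (z : R * R) :
  tay (polar_shift (fun w => w.1 ^+ 2 + w.2 ^+ 2) z) (z.1 ^+ 2 + z.2 ^+ 2)
    (2 * z.1) (2 * z.2) 1.
Proof.
exists 0, 0 => e e0; exists 1 => // r t _; rewrite /polar_shift /=.
rewrite (_ : _ - _ = r ^+ 2 * (cos t ^+ 2 + sin t ^+ 2 - 1)); last by ring.
by rewrite cos2Dsin2 subrr mulr0 normr0 mulr_ge0 ?sqr_ge0 ?ltW.
Qed.

(** Moving x along the tangent directions while z moves in the disc cancels the first order terms of
    x - F z. Hence the quadratic penalty contributes nothing to the Laplacian, however large its
    coefficient. *)
Lemma tay_dotv (F : R * R -> V) (z : R * R) (x X Y : V) :
  (forall i, tay (polar_shift (fun w => F w ord0 i) z) (F z ord0 i)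
     (X ord0 i) (Y ord0 i) 0) ->
  tay (fun r t => dotv (plane_pt x X Y (circle_pt (0, 0) r t) - F (z + (r * cos t, r * sin t)))
                       (plane_pt x X Y (circle_pt (0, 0) r t) - F (z + (r * cos t, r * sin t))))
    (dotv (x - F z) (x - F z)) 0 0 0.
Proof.
move=> hF; pose rem i r t := polar_shift (fun w => F w ord0 i) z r t -
  (F z ord0 i + r * (X ord0 i * cos t + Y ord0 i * sin t)).
have tr i : tay (rem i) 0 0 0 0.
  have [K [L h]] := hF i; exists K, L => e e0; have [d d0 hd] := h e e0.
  exists d => // r t rd; have := hd r t rd; rewrite /rem.
  set P := polar_shift _ _ _ _; congr (_ <= _); congr `|_|; ring.
have := @tay_sum R _ (index_enum 'I_n) (fun i r t => ((x - F z) ord0 i - rem i r t) ^+ 2)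
  (fun i => (x - F z) ord0 i ^+ 2) (fun=> 0) (fun=> 0) (fun=> 0)
  (fun i => tay_sqr ((x - F z) ord0 i) (tr i)).
rewrite !big1_eq; congr tay.
  apply/funext => r; apply/funext => t; apply: eq_bigr => i _; rewrite -expr2; congr (_ ^+ 2).
  by rewrite /rem /polar_shift /plane_pt /circle_pt !mxE /=; ring.
Qed.

End Viscosity.

Section ViscosityMax.
Context {R : realType} {n : nat}.
Local Notation V := 'rV[R]_n.
Local Notation D1 := (@closed_unit_disc R).

(** Upper semicontinuity spreads the boundary inequality to a neighbourhood of each boundary point,
    and compactness makes its width uniform. The covering is of the closed disc; near interior
    points the condition is vacuous. *)
Lemma disc_tube (u : V -> \bar R) (F : R * R -> V) (H : R * R -> R) (k : R) :
  minimal_psh setT u -> 0 < k ->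
  (forall z, D1 z -> {for z, continuous F}) ->
  (forall z, D1 z -> {for z, continuous H}) ->
  (forall z, z.1 ^+ 2 + z.2 ^+ 2 = 1 -> (u (F z) <= (H z)%:E)%E) ->
  exists2 del : R, 0 < del < 1 &
    forall x z, z.1 ^+ 2 + z.2 ^+ 2 = 1 -> dotv (x - F z) (x - F z) < del ->
      (u x < (H z + k)%:E)%E.
Proof.
move=> pu k0 cF cH hb.
have /compact_near_coveringP/(_ _ (0^'+ : set_system R)
  (fun d z => z.1 ^+ 2 + z.2 ^+ 2 = 1 -> forall x, dotv (x - F z) (x - F z) < d ->
      (u x < (H z + k)%:E)%E)) := @compact_closed_unit_disc R.
move=> /(_ _)[|r r0 hr].
  move=> z Dz; have [z1|z1] := eqVneq (z.1 ^+ 2 + z.2 ^+ 2) 1; last first.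
    exists ([set w : R * R | w.1 ^+ 2 + w.2 ^+ 2 < 1], setT); last first.
      by move=> [w d] /= [w1 _] ww; move: w1; rewrite ww ltxx.
    split; last exact: filterT.
    apply: (@continuous_sqr_plane R z [set x | x < 1]); apply: open_nbhs_nbhs; split; first exact: open_lt.
    by rewrite /= lt_neqAle z1.
  have k20 : 0 < k / 2 by rewrite divr_gt0.
  have uz : (u (F z) < (H z + k / 2)%:E)%E.
    by apply: le_lt_trans (hb z z1) _; rewrite lte_fin ltrDl.
  have /nbhs_ballP[e /= e0 he] := usc_at pu uz.
  have e20 : 0 < e / 2 by rewrite divr_gt0.
  have [d1 d10 h1] := norm_continuous_at (cF z Dz) e20.
  have [d2 d20 h2] := norm_continuous_at (cH z Dz) k20.
  exists (ball z (Num.min d1 d2), [set d | d < (e / 2) ^+ 2]).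
    split => /=; first by apply: nbhsx_ballx; rewrite lt_min d10.
    by apply: nbhs_right_lt; rewrite exprn_gt0.
  move=> [w d] /= []; rewrite -ball_normE /= lt_min => /andP[zw1 zw2] de w1 x xd.
  have := h2 w zw2; rewrite ler_norml => /andP[_ Hw].
  apply: (@lt_le_trans _ _ (H z + k / 2)%:E); last by rewrite lee_fin; lra.
  apply: he; rewrite -ball_normE /=.
  have xw : `|x - F w| < e / 2.
    rewrite -ltr_sqr ?nnegrE ?(ltW e20)//; apply: le_lt_trans (sqr_norm_le_dotv _) _.
    exact: lt_trans xd de.
  rewrite (splitr e); apply: (le_lt_trans (ler_distD (F w) _ _)).
  by rewrite (distrC (F w)) ler_ltD// h1.
exists (Num.min (r / 2) 2^-1).
  by rewrite lt_min divr_gt0// invr_gt0 ltr0n gt_min [X in _ || X]invf_lt1 ?ltr1n ?orbT.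
have m0 : 0 < Num.min (r / 2) 2^-1 by rewrite lt_min divr_gt0// invr_gt0 ltr0n.
move=> x z z1 xz; apply: (hr (Num.min (r / 2) 2^-1) _ _ z _ z1 x xz) => //=.
  rewrite sub0r normrN gtr0_norm//.
  apply: (@le_lt_trans _ _ (r / 2)); first by rewrite ge_min lexx.
  by rewrite ltr_pdivrMr// ltr_pMr// ltr1n.
by rewrite /closed_unit_disc /= z1.
Qed.

Lemma disc_interior (z : R * R) : z.1 ^+ 2 + z.2 ^+ 2 < 1 -> exists2 d : R, 0 < d &
  forall r t, 0 < r < d -> D1 (z + (r * cos t, r * sin t)).
Proof.
move=> z1; pose q := 1 - (z.1 ^+ 2 + z.2 ^+ 2).
have q0 : 0 < q by rewrite subr_gt0.
exists (q / 5); first by rewrite divr_gt0.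
move=> r t /andP[r0 rq]; rewrite /closed_unit_disc /=.
have := cos2Dsin2 t; have := sqr_ge0 z.1; have := sqr_ge0 z.2.
rewrite -/q in rq; have := ltr_pdivlMr r q (ltr0n R 5); rewrite rq => /esym rq5.
have a1 : 2 * (z.1 * cos t) <= z.1 ^+ 2 + cos t ^+ 2.
  by have := sqr_ge0 (z.1 - cos t); rewrite sqrrB mulr_natl; lra.
have a2 : 2 * (z.2 * sin t) <= z.2 ^+ 2 + sin t ^+ 2.
  by have := sqr_ge0 (z.2 - sin t); rewrite sqrrB mulr_natl; lra.
move=> s1 s2 cs; have qE : q = 1 - (z.1 ^+ 2 + z.2 ^+ 2) by [].
have -> : (z.1 + r * cos t) ^+ 2 + (z.2 + r * sin t) ^+ 2 =
  z.1 ^+ 2 + z.2 ^+ 2 + r * (2 * (z.1 * cos t) + 2 * (z.2 * sin t) + r * (cos t ^+ 2 + sin t ^+ 2)).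
  by ring.
rewrite cs mulr1.
have r1 : r <= 1 by lra.
have : r * (2 * (z.1 * cos t) + 2 * (z.2 * sin t) + r) <= r * 5.
  by rewrite ler_pM2l//; lra.
lra.
Qed.

(* Maximise u(x) - H(z) + k |z|^2 - alpha |x - F(z)|^2 over x and z. For large
   alpha the maximum has z inside the disc, and there u is touched from above,
   along the tangent plane of F, by a function with negative Laplacian. *)
Lemma psh_max (u : V -> \bar R) (F : R * R -> V) (H : R * R -> R) :
  minimal_psh setT u ->
  (forall z, D1 z -> {for z, continuous F}) ->
  (forall z, D1 z -> {for z, continuous H}) ->
  (forall z, unit_disc z -> exists X Y, isothermal X Y /\
     forall i, tay (polar_shift (fun w => F w ord0 i) z) (F z ord0 i)
       (X ord0 i) (Y ord0 i) 0) ->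
  (forall z, unit_disc z -> exists A B, tay (polar_shift H z) (H z) A B 0) ->
  (forall z, z.1 ^+ 2 + z.2 ^+ 2 = 1 -> (u (F z) <= (H z)%:E)%E) ->
  (u (F (0%R, 0%R)) <= (H (0%R, 0%R))%:E)%E.
Proof.
move=> pu cF cH tF tH hb; rewrite leNgt; apply/negP => hlt.
have D0 := @closed_unit_disc0 R.
have [b /andP[Hb bu]] := ereal_between hlt.
(* Half of a strict lower bound for the violation at the centre: one k pays for the term k |z|^2,
   the other for the tube. *)
pose k := (b - H (0, 0)) / 2.
have k0 : 0 < k by rewrite divr_gt0// subr_gt0 -lte_fin.
have [del /andP[del0 del1] hdel] := disc_tube pu k0 cF cH hb.
have cD := @compact_closed_unit_disc R.
have D_ne : D1 !=set0 by exists (0, 0).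
have [zf Dzf hzf] := @continuous_attains_max R _ D1 (fun z => `|F z|) cD D_ne
  (fun z Dz => @continuous_comp _ _ _ F (fun x => `|x|) z (cF z Dz) (@norm_continuous _ _ (F z))).
(* The ball of radius rho contains the unit neighbourhood of the image of F, so a maximum point
   within 1 of that image is interior to the ball. *)
pose rho := `|F zf| + 1.
have rho0 : 0 < rho by rewrite ltr_wpDl.
pose BB : set V := [set x | `|x| <= rho].
have cBB : compact BB by exact: compact_norm_le.
have BBF z : D1 z -> `|F z| <= rho - 1 by move=> /hzf; rewrite /rho addrK.
have BF0 : BB (F (0, 0)) by rewrite /BB /= (le_trans (BBF _ D0))// gerBl.
have BB0 : BB !=set0 by exists (F (0, 0)).
have [xm Bxm hxm] := usc_max cBB BB0 (fun x _ b ux => usc_at pu ux).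
have [Mu Mu1] : exists Mu : R, forall x, BB x -> (u x <= Mu%:E)%E.
  have [c /andP[uc _]] := ereal_between (psh_ltry xm pu).
  by exists c => x /hxm h; apply: le_trans h (ltW uc).
have [zh Dzh hzh] := @continuous_attains_max R _ D1 (fun z => - H z) cD D_ne
  (fun z Dz => continuousN (cH z Dz)).
(* Large enough that at a maximum point, where the functional exceeds 2 * k, the squared distance to
   the disc is below del; Mu bounds u on the ball and H zh is the minimum of H. *)
pose alpha := (`|Mu - H zh| + 1) / del.
have al0 : 0 < alpha by rewrite divr_gt0// ltr_wpDl.
pose D (y : V * (R * R)) := dotv (y.1 - F y.2) (y.1 - F y.2).
pose G (y : V * (R * R)) := H y.2 + - k * (y.2.1 ^+ 2 + y.2.2 ^+ 2) + alpha * D y.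
have cG y : D1 y.2 -> {for y, continuous G}.
  move=> Dy; have c1 : {for y, continuous (fun y : V * (R * R) => H y.2)}.
    exact: (@continuous_comp _ _ _ snd H y (@cvg_snd _ _ _ _ _) (cH y.2 Dy)).
  have c2 : {for y, continuous (fun y : V * (R * R) => y.2.1 ^+ 2 + y.2.2 ^+ 2)}.
    exact: (@continuous_comp _ _ _ snd _ y (@cvg_snd _ _ _ _ _)
      (@continuous_sqr_plane R y.2)).
  have c3 : {for y, continuous (fun y : V * (R * R) => y.1 - F y.2)}.
    apply: (@continuousB _ _ _ (fun y : V * (R * R) => y.1) (fun y => F y.2)).
      exact: cvg_fst.
    exact: (@continuous_comp _ _ _ snd F y (@cvg_snd _ _ _ _ _) (cF y.2 Dy)).
  have c4 : {for y, continuous D}.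
    exact: (@continuous_comp _ _ _ _ (fun x : V => dotv x x) y c3 (@continuous_dotv R n _)).
  apply: cvgD; last by apply: cvgM; [exact: cvg_cst|exact: c4].
  by apply: cvgD; [exact: c1|apply: cvgM; [exact: cvg_cst|exact: c2]].
pose Psi (y : V * (R * R)) := (u y.1 - (G y)%:E)%E.
have cA : compact (BB `*` D1) by exact: compact_setX.
have A0 : (BB `*` D1) !=set0.
  by exists (F (0, 0), (0, 0)).
have [|[xh zz] [/= Bxh Dzz] hmax] := @usc_max R _ _ Psi cA A0.
  move=> y [_ Dy] c; rewrite /Psi lteBlDr// => uc.
  have [c' /andP[uc' cc']] := ereal_between uc.
  have cc : c' - c < G y by rewrite ltrBlDl -lte_fin EFinD.
  have n1 : \forall y' \near y, (u y'.1 < c'%:E)%E.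
    exact: (@cvg_fst _ _ (nbhs y.1) (nbhs y.2) _ _ (usc_at pu uc')).
  have n2 : \forall y' \near y, c' - c < G y'.
    by apply: (cG y Dy [set r | c' - c < r]); apply: open_nbhs_nbhs; split => //; exact: open_gt.
  apply: filterS2 n1 n2 => y' u1 g1; rewrite lteBlDr//.
  by apply: (lt_trans u1); rewrite -EFinD lte_fin -ltrBlDl.
have PsiF : ((b - H (0, 0))%:E < Psi (xh, zz))%E.
  apply: (@lt_le_trans _ _ (Psi (F (0, 0), (0, 0)))); last exact: hmax.
  rewrite /Psi lteBrDr// -EFinD /G /D /= subrr.
  have -> : dotv (0 : V) 0 = 0 by apply: big1 => i _; rewrite mxE mul0r.
  by rewrite expr0n /= addr0 !mulr0 !addr0 subrK.
have [U uU] : exists U, u xh = U%:E.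
  have := psh_ltry xh pu; move: PsiF; rewrite /Psi /=; case: (u xh) => // U _ _.
  by exists U.
have UMu : U <= Mu by have := Mu1 _ Bxh; rewrite uU lee_fin.
have UG : b - H (0, 0) < U - G (xh, zz) by move: PsiF; rewrite /Psi uU -EFinB lte_fin.
pose dd := D (xh, zz); pose s := zz.1 ^+ 2 + zz.2 ^+ 2.
have GE : G (xh, zz) = H zz + - k * s + alpha * dd by [].
have bE : b - H (0, 0) = k + k by rewrite /k -splitr.
rewrite bE GE in UG.
have dd0 : 0 <= dd by exact: dotv_ge0.
have s1 : s <= 1 by exact: Dzz.
have ks : k * s <= k by rewrite ler_piMr// ltW.
have Hzz : H zh <= H zz by have := hzh _ Dzz; rewrite lerN2.
have ad0 : 0 <= alpha * dd by rewrite mulr_ge0// ltW.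
have ddel : dd < del.
  rewrite -(ltr_pM2l al0) {2}/alpha divfK ?gt_eqF//.
  have := ler_norm (Mu - H zh); lra.
(* On the circle the tube gives u < H + k, so the functional would be below 2 * k. *)
have sl1 : s < 1.
  rewrite lt_neqAle s1 andbT; apply/eqP => sE; have := hdel xh zz sE ddel.
  rewrite uU lte_fin ltNge => /negP; apply.
  by rewrite sE mulr1 in UG; lra.
have xhr : `|xh| < rho.
  have : `|xh - F zz| < 1.
    rewrite -ltr_sqr ?nnegrE// expr1n; apply: le_lt_trans (sqr_norm_le_dotv _) _.
    exact: lt_trans ddel del1.
  have := BBF _ Dzz; have := ler_normD (xh - F zz) (F zz); rewrite subrK; lra.
have [X [Y [iXY tXY]]] := tF zz sl1; have [A [B tAB]] := tH zz sl1.
(* The constant term adds up to u xh, and the Laplacian part comes from - k |z|^2 alone, hence is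
   negative. *)
have tg := tayD (tay_cst (U - G (xh, zz))) (tayD (tayD tAB (tayZ (- k) (tay_shift_sqr zz)))
  (tayZ alpha (tay_dotv xh tXY))).
have [d1 d10 hd1] := disc_interior sl1.
have [d2 d20 hd2] : exists2 d : R, 0 < d & (`|X| + `|Y|) * d <= rho - `|xh|.
  by apply: pos_small; rewrite ?addr_ge0// subr_gt0.
have m0 : 0 < Num.min d1 d2 by rewrite lt_min d10.
have l0 : 0 + (0 + - k * 1 + alpha * 0) < 0 by rewrite mulr0 addr0 !add0r mulr1 oppr_lt0.
have := psh_touch pu iXY tg l0 m0.
move=> /(_ xh); rewrite -/s -/dd -GE subrK uU ltxx => /(_ _)/notF; apply.
move=> r t /andP[r0]; rewrite lt_min => /andP[rd1 rd2].
set x := plane_pt _ _ _ _; set z := zz + _.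
have Bx : BB x.
  rewrite /BB /= /x /plane_pt /circle_pt /= !add0r -addrA.
  apply: (le_trans (ler_normD _ _)); rewrite -lerBrDl.
  apply: le_trans hd2; apply: (le_trans (ler_normD _ _)); rewrite !normrZ mulrDl.
  have rc (c : R) : `|c| <= 1 -> `|r * c| <= d2.
    by move=> c1; rewrite normrM gtr0_norm// (le_trans _ (ltW rd2))// ler_piMr// ltW.
  by apply: lerD; rewrite mulrC ler_wpM2l// -normrM rc// ?cos_max ?sin_max.
have Dz : D1 z by apply: hd1; rewrite r0.
by have := hmax (x, z) (conj Bx Dz); rewrite /Psi uU leeBlDr// -EFinB -EFinD.
Qed.

End ViscosityMax.

Section MinimalDiscMax.
Context {R : realType} {n : nat}.
Local Notation V := 'rV[R]_n.
Local Notation D1 := (@closed_unit_disc R).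

Lemma tay_near (g g' : R -> R -> R) a A B l d : 0 < d ->
  (forall r t, 0 < r < d -> g r t = g' r t) -> tay g a A B l -> tay g' a A B l.
Proof.
move=> d0 E [K [L h]]; exists K, L => e e0; have [d' d'0 hd] := h e e0.
exists (Num.min d d'); first by rewrite lt_min d0.
move=> r t /andP[r0]; rewrite lt_min => /andP[rd rd'].
by rewrite -E ?r0//; apply: hd; rewrite r0.
Qed.

Lemma open_unit_disc : open (@unit_disc R).
Proof.
have -> : @unit_disc R = (fun z : R * R => z.1 ^+ 2 + z.2 ^+ 2) @^-1` [set x | x < 1] by [].
apply: open_comp; last exact: open_lt.
by move=> z _; exact: continuous_sqr_plane.
Qed.

(** The length is nonzero because the extension F, whose differential is injective, has the same
    derivatives as f inside the disc. *)
Lemma conformal_minimal_isothermal (omega : set V) f z :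
  conformal_minimal_disc omega f -> unit_disc z ->
  isothermal (partial_x f z) (partial_y f z).
Proof.
move=> [_ [U [F [oU DU CF Ff inj]]] conf _] Dz.
have Dz1 := subset_unit_disc Dz.
have [en dxy] := conf z Dz; split; [exact: dxy|exact: en|apply/eqP => e0].
have dX : dotv (partial_x f z) (partial_x f z) = 0.
  apply/eqP; rewrite eq_le dotv_ge0 andbT -sqrtr_eq0; exact/eqP.
have X0 := dotv_eq0 dX; have [dF _ _] := CF z (DU z Dz1).
have nFf : \forall w \near z, F w = f w.
  have := open_nbhs_nbhs (conj open_unit_disc Dz); apply: filterS => w Dw.
  exact: Ff (subset_unit_disc Dw).
have : 'd F z ((1, 0) : R * R) = 'd F z 0.
  have h1 : 'd F z ((1, 0) : R * R) = 'D_((1, 0) : R * R) F z by rewrite deriveE.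
  have h2 : 'D_((1, 0) : R * R) F z = 'D_((1, 0) : R * R) f z by exact: near_eq_derive.
  have h3 : 'D_((1, 0) : R * R) f z = 0 by exact: X0.
  have h4 : 'd F z 0 = 0 by exact: linear0.
  exact: etrans h1 (etrans h2 (etrans h3 (esym h4))).
by move/(inj z Dz1) => /(congr1 fst) /= /eqP; rewrite oner_eq0.
Qed.

Lemma harmonic_tay (f : R * R -> V) z i : harmonic_on (@unit_disc R) f -> unit_disc z ->
  tay (polar_shift (fun w => f w ord0 i) z) (f z ord0 i)
    (partial_x f z ord0 i) (partial_y f z ord0 i) 0.
Proof.
move=> [C1f C1x C1y lap] Dz; have [d d0 hd] := open_norm open_unit_disc Dz.
have [dfx _ _] := C1x z Dz; have [dfy _ _] := C1y z Dz.
have [cx ex] := derive_coord ((1, 0) : R * R) i dfx.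
have [cy ey] := derive_coord ((0, 1) : R * R) i dfy.
have lapi : 'D_((1, 0) : R * R) (fun w => partial_x f w ord0 i) z +
    'D_((0, 1) : R * R) (fun w => partial_y f w ord0 i) z = 0.
  rewrite -ex -ey; have := congr1 (fun v : V => v ord0 i) (lap z Dz); rewrite !mxE.
  by [].
have near w : `|w - z| < d -> [/\ differentiable (fun w => f w ord0 i) w,
    'D_((1, 0) : R * R) (fun w => f w ord0 i) w = partial_x f w ord0 i &
    'D_((0, 1) : R * R) (fun w => f w ord0 i) w = partial_y f w ord0 i].
  rewrite distrC => wz; have [dfw _ _] := C1f w (hd w wz).
  have [c1 e1] := derive_coord ((1, 0) : R * R) i dfw.
  have [_ e2] := derive_coord ((0, 1) : R * R) i dfw.
  by split; [exact: c1|exact: (esym e1)|exact: (esym e2)].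
exact: (tay_harmonic d0 near cx cy lapi).
Qed.

Lemma psh_max_disc (omega : set V) (u : V -> \bar R) f (H : R * R -> R) :
  minimal_psh setT u -> conformal_minimal_disc omega f ->
  (forall z, D1 z -> {for z, continuous H}) ->
  (forall z, unit_disc z -> exists A B, tay (polar_shift H z) (H z) A B 0) ->
  (forall z, z.1 ^+ 2 + z.2 ^+ 2 = 1 -> (u (f z) <= (H z)%:E)%E) ->
  (u (f (0%R, 0%R)) <= (H (0%R, 0%R))%:E)%E.
Proof.
move=> pu cf cH tH hb; have iso z := @conformal_minimal_isothermal omega f z cf.
have [_ [U [F [oU DU CF Ff _]]] _ hf] := cf.
have D0 := @closed_unit_disc0 R.
(* The extension F replaces f, whose values off the closed disc are arbitrary, to have continuity at
   boundary points. *)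
rewrite -Ff//; apply: (@psh_max R n u F H pu _ cH _ tH).
- by move=> z /DU /CF[dF _ _]; exact: differentiable_continuous.
- move=> z Dz; exists (partial_x f z), (partial_y f z); split; first exact: iso.
  have Dz1 := subset_unit_disc Dz.
  move=> i; rewrite Ff//; have [d d0 hd] := disc_interior Dz.
  apply: (tay_near d0 _ (harmonic_tay i hf Dz)) => r t rd.
  by rewrite /polar_shift Ff//; exact: hd.
- by move=> z z1; rewrite Ff; [exact: hb|rewrite /closed_unit_disc /= z1].
Qed.

End MinimalDiscMax.

(** * Harmonic majorants from Poisson kernels *)

Section Arcs.
Context {R : realType}.
Local Notation C := (R[i]).
Local Notation D1 := (@closed_unit_disc R).
Notation mu := (@lebesgue_measure R).

Lemma sqr_cmod_toC (z : R * R) : cmod (toC z) ^+ 2 = z.1 ^+ 2 + z.2 ^+ 2.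
Proof. by rewrite sqr_cmod. Qed.

Lemma cmod_toC_le1 (z : R * R) : D1 z -> cmod (toC z) <= 1.
Proof.
by move=> Dz; rewrite -(@expr_le1 _ 2)// ?cmod_ge0// sqr_cmod_toC.
Qed.

Lemma pole_neq (a : C) z : 1 < cmod a -> D1 z -> a - toC z != 0.
Proof.
move=> a1 Dz; rewrite subr_eq0; apply: contraTneq a1 => ->.
by rewrite -leNgt cmod_toC_le1.
Qed.

Lemma pois_ge0 (a : C) z : 1 < cmod a -> D1 z -> 0 <= pois a z.
Proof.
move=> a1 Dz; rewrite pois_E ?pole_neq//; apply: divr_ge0; last by rewrite sqr_ge0.
rewrite subr_ge0; apply: lerXn2r; rewrite ?nnegrE ?cmod_ge0//.
exact: le_trans (cmod_toC_le1 Dz) (ltW a1).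
Qed.

Lemma pois0 (a : C) : a != 0 -> pois a (0, 0) = 1.
Proof.
move=> a0; have -> : pois a (0, 0) = complex.Re ((a + 0) / (a - 0)) by [].
by rewrite addr0 subr0 divff.
Qed.

(** The pole lies l outside the circle, so on the arc its distance is at most 3 * l, while the
    numerator (1 + l) ^+ 2 - 1 is at least 2 * l: the kernel is at least 2 / (9 * l). *)
Lemma pois_arc (l th t : R) : 0 < l <= 1 -> `|t - th| <= l ->
  1 <= 9 * l / 2 * pois ((1 + l)%:C%C * expi th) (cos t, sin t).
Proof.
move=> /andP[l0 l1] tl; set a := _ * expi th.
have ca : cmod a = 1 + l by rewrite cmodM cmod_expi cmod_real mulr1 gtr0_norm// addr_gt0.
have a1 : 1 < cmod a by rewrite ca ltrDl.
have Dt : D1 (cos t, sin t) by rewrite /closed_unit_disc /= cos2Dsin2.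
have az := pole_neq a1 Dt; rewrite pois_E// sqr_cmod_toC cos2Dsin2 ca.
have c3 : cmod (a - toC (cos t, sin t)) <= 3 * l.
  have -> : a - toC (cos t, sin t) = l%:C%C * expi th + (expi th - expi t).
    by apply: complex_eq; rewrite /a !(cReD, cImD, cReN, cImN, cReM, cImM) /=; ring.
  apply: (le_trans (cmodD _ _)); rewrite cmodM cmod_expi cmod_real mulr1 gtr0_norm//.
  by have := expi_lip th t; rewrite distrC; lra.
have w0 : 0 < cmod (a - toC (cos t, sin t)) ^+ 2 by rewrite exprn_gt0// lt_neqAle eq_sym cmod_eq0 az cmod_ge0.
rewrite mulrA ler_pdivlMr// mul1r.
apply: (@le_trans _ _ ((3 * l) ^+ 2)).
  by apply: lerXn2r; rewrite ?nnegrE ?cmod_ge0 ?mulr_ge0 ?(ltW l0).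
have -> : 9 * l / 2 * ((1 + l) ^+ 2 - 1) = (3 * l) ^+ 2 + 9 / 2 * l ^+ 3 by field.
by rewrite lerDl mulr_ge0// ?exprn_ge0 ?(ltW l0)// divr_ge0.
Qed.

Lemma arc_of (l t : R) n : 0 <= t <= n.+1%:R * l ->
  exists2 k, (k < n.+1)%N & k%:R * l <= t <= k.+1%:R * l.
Proof.
elim: n => [|n IH] /andP[t0 tn]; first by exists 0%N; rewrite // mul0r t0.
have [h|h] := leP t (n.+1%:R * l).
  by have [|k kn hk] := IH; [rewrite t0|exists k => //; exact: ltnW].
by exists n.+1; rewrite // (ltW h).
Qed.

(** The diagonal over [a, b] is compact inside the open set of pairs with close values, and a margin
    around it is the modulus of continuity. *)
Lemma unif_cont (W : normedModType R) (g : R -> W) (a b e : R) : continuous g -> 0 < e ->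
  exists2 d : R, 0 < d & forall s t, a <= s <= b -> `|s - t| < d -> `|g s - g t| < e.
Proof.
move=> cg e0; pose O := [set z : R * R | `|g z.1 - g z.2| < e].
have oO : open O.
  have -> : O = (fun z : R * R => `|g z.1 - g z.2|) @^-1` [set r | r < e] by [].
  apply: open_comp; last exact: open_lt.
  move=> z _; have c1 : {for z, continuous (fun z : R * R => g z.1 - g z.2)}.
    apply: (@continuousB _ _ _ (fun z : R * R => g z.1) (fun z => g z.2)).
      exact: (@continuous_comp _ _ _ fst g z (@cvg_fst _ _ _ _ _) (cg z.1)).
    exact: (@continuous_comp _ _ _ snd g z (@cvg_snd _ _ _ _ _) (cg z.2)).
  exact: (@continuous_comp _ _ _ _ (fun x : W => `|x|) z c1 (@norm_continuous _ _ _)).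
have cS : compact ((fun t : R => (t, t)) @` `[a, b]).
  apply: continuous_compact; last exact: segment_compact.
  apply/continuous_subspaceT => t.
  apply: continuous_at_normP => e' e'0; exists e' => // y ty.
  by rewrite prod_normE /= maxxx ltW.
have [|d d0 hd] := compact_margin cS oO.
  by move=> _ [t _ <-]; rewrite /O /= subrr normr0.
exists d => // s t sab st; apply: (hd (s, s) (s, t)); first by exists s; rewrite //= in_itv.
by rewrite prod_normE /= subrr normr0 max_r.
Qed.

Lemma cover_arcs (G : set R) (l : R) N (bad : pred nat) : 0 <= l -> measurable G ->
  (forall t, G t -> exists2 k, (k < N)%N & ~~ bad k /\ k%:R * l <= t <= k.+1%:R * l) ->
  (mu G <= ((N - count bad (iota 0 N))%:R * l)%:E)%E.
Proof.
move=> l0 mG hG; pose B k : set R := if bad k then set0 else `[k%:R * l, k.+1%:R * l]%classic.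
have mB k : measurable (B k) by rewrite /B; case: (bad k); exact: measurable0 || exact: measurable_itv.
have GB : G `<=` \big[setU/set0]_(k < N) B k.
  move=> t /hG[k kN [bk tk]]; rewrite -bigcup_mkord; exists k => //.
  by rewrite /B (negbTE bk) /= in_itv.
have le1 : (mu G <= \sum_(k < N) mu (B k))%E.
  by apply: content_subadditive => // k _; exact: mB.
apply: (le_trans le1).
have muB k : mu (B k) = ((~~ bad k)%:R * l)%:E.
  rewrite /B; case: (bad k) => /=; first by rewrite measure0 mul0r.
  rewrite lebesgue_measure_itv /= lte_fin -natr1 mulrDl !mul1r ltrDl -EFinB addrC addKr.
  by case: ltP => // l00; rewrite (@le_anti _ _ l 0)// l00.
rewrite (eq_bigr (fun k : 'I_N => ((~~ bad k)%:R * l)%:E)); last by move=> k _; exact: muB.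
rewrite sumEFin -mulr_suml lee_fin ler_wpM2r// -natr_sum ler_nat.
rewrite -(big_mkord xpredT (fun k => nat_of_bool (~~ bad k))) /index_iota subn0.
rewrite (eq_bigr (fun k => if ~~ bad k then 1%N else 0%N)); last by move=> k _; case: (bad k).
by rewrite -big_mkcond sum1_count -{2}(size_iota 0 N) -(count_predC bad) addKn.
Qed.

End Arcs.

Section BadArcs.
Context {R : realType} {n : nat}.
Local Notation V := 'rV[R]_n.
Local Notation C := (R[i]).
Local Notation D1 := (@closed_unit_disc R).
Notation mu := (@lebesgue_measure R).

Lemma edist_lt (x : V) (K : set V) (c : R) :
  (edist_set x K < c%:E)%E <-> exists2 y, K y & enorm (x - y) < c.
Proof.
split=> [/ereal_inf_lt[_ [y Ky <-]]|[y Ky h]]; first by rewrite lte_fin; exists y.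
apply: (@le_lt_trans _ _ (enorm (x - y))%:E); last by rewrite lte_fin.
by apply: ereal_inf_lbound; exists y.
Qed.

Lemma measurable_edist (g : R -> V) (K : set V) (c : R) : continuous g ->
  measurable [set t : R | (0 <= t <= 2 * pi)%R /\ (edist_set (g t) K < c%:E)%E].
Proof.
move=> cg; have -> : [set t : R | (0 <= t <= 2 * pi)%R /\ (edist_set (g t) K < c%:E)%E] =
  `[0, 2 * pi]%classic `&` \bigcup_(y in K) [set t | enorm (g t - y) < c].
  apply/seteqP; split => [t [t0 /edist_lt[y Ky h]]|t [t0 [y Ky h]]].
    by split; [rewrite /= in_itv|exists y].
  by move: t0; rewrite /= in_itv /= => t0; split => //; apply/edist_lt; exists y.
apply: measurableI; first exact: measurable_itv.
apply: open_measurable; apply: bigcup_open => y _.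
have -> : [set t | enorm (g t - y) < c] = (fun t => enorm (g t - y)) @^-1` [set r | r < c] by [].
apply: open_comp; last exact: open_lt.
move=> t _; have c1 : {for t, continuous (fun t => g t - y)}.
  by apply: (@continuousB _ _ _ g (fun=> y)); [exact: cg|exact: cst_continuous].
have c2 := @continuous_comp _ _ _ _ (fun x : V => dotv x x) t c1 (@continuous_dotv R n _).
exact: (@continuous_comp _ _ _ _ Num.sqrt t c2 (@sqrt_continuous _ _)).
Qed.

(* On the circle the harmonic majorant is b plus Poisson bumps, each at least
   M - b on one of the arcs where the boundary curve strays from K; its value at
   the centre is controlled by the total length of these arcs. *)
Lemma disc_estimate (K omega : set V) (u : V -> \bar R) f (b M e : R) :
  minimal_psh setT u -> conformal_minimal_disc omega f ->
  (forall x, omega x -> (u x <= M%:E)%E) -> b <= M -> 0 < e ->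
  (forall x y, K y -> `|x - y| < 2 * e -> (u x <= b%:E)%E) ->
  ((2 * pi - e)%:E <= mu [set t : R | (0 <= t <= 2 * pi)%R /\
     (edist_set (f (circle_pt (0%R, 0%R) 1 t)) K < e%:E)%E])%E ->
  (u (f (0%R, 0%R)) <= (b + (M - b) * (9 / 2 * e))%:E)%E.
Proof.
move=> pu cf uM bM e0 uK mG; pose g t := f (circle_pt (0, 0) 1 t).
have [fom [U [F [oU DU CF Ff _]]] _ _] := cf.
have Dc t : D1 (circle_pt (0, 0) 1 t).
  by rewrite /closed_unit_disc /= !add0r !mul1r cos2Dsin2.
have cg : continuous g.
  have -> : g = F \o circle_pt (0, 0) 1 by apply/funext => t; rewrite /= Ff.
  move=> t; have cc : {for t, continuous (circle_pt (0, 0) 1 : R -> R * R)}.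
    apply: (@cvg_pair _ _ _ _ (nbhs _) (nbhs _)).
      by apply: cvgD; [exact: cvg_cst|apply: cvgM; [exact: cvg_cst|exact: continuous_cos]].
    by apply: cvgD; [exact: cvg_cst|apply: cvgM; [exact: cvg_cst|exact: continuous_sin]].
  apply: (@continuous_comp _ _ _ _ F t cc); apply: differentiable_continuous.
  by have [] := CF _ (DU _ (Dc t)).
have [rho rho0 hrho] := unif_cont 0 (2 * pi) cg e0.
have p0 := @twopi_gt0 R.
(* N exceeds 2 * pi / rho, so that g varies by less than e on an arc, and 2 * pi, so that l <= 1 as
   [pois_arc] asks. *)
have [N0 _ N0h] := exists_nat_gt (2 * pi / rho + 2 * pi).
pose N := N0.+1; pose l : R := 2 * pi / N%:R.
have Npos : 0 < N%:R :> R by rewrite ltr0n.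
have NE : N%:R * l = 2 * pi by rewrite /l mulrC divfK// gt_eqF.
have Nh : 2 * pi / rho + 2 * pi < N%:R by apply: (lt_trans N0h); rewrite ltr_nat.
have q0 : 0 < 2 * pi / rho by rewrite divr_gt0.
have l0 : 0 < l by rewrite divr_gt0.
have l1 : l <= 1.
  by rewrite /l ler_pdivrMr// mul1r (le_trans _ (ltW Nh))// lerDr ltW.
have lrho : l < rho.
  by rewrite /l ltr_pdivrMr// (mulrC rho) -ltr_pdivrMr// (le_lt_trans _ Nh)// lerDl ltW.
(* A point closer than e to K makes its whole arc good, since g varies by less than e there. So the
   good arcs cover the set measured in mG, and the bad ones have total length at most e. *)
pose bad k := `[< exists t, k%:R * l <= t <= k.+1%:R * l /\ forall y, K y -> 2 * e <= `|g t - y| >].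
have arcs k s t : k%:R * l <= s <= k.+1%:R * l -> k%:R * l <= t <= k.+1%:R * l -> `|s - t| <= l.
  rewrite -natr1 mulrDl mul1r => /andP[s1 s2] /andP[t1 t2].
  by rewrite ler_norml; apply/andP; split; lra.
have in2pi k t : (k < N)%N -> k%:R * l <= t <= k.+1%:R * l -> 0 <= t <= 2 * pi.
  move=> kN /andP[t1 t2]; apply/andP; split.
    by apply: le_trans t1; rewrite mulr_ge0// ltW.
  by apply: (le_trans t2); rewrite -NE ler_wpM2r ?(ltW l0)// ler_nat.
pose nb := count bad (iota 0 N).
have nbl : nb%:R * l <= e.
  have := cover_arcs (bad := bad) (N := N) (ltW l0) (measurable_edist K e cg).
  move=> /(_ _)/(le_trans mG)-/(_ _).
  have nbN : (nb <= N)%N by rewrite -[X in (_ <= X)%N](size_iota 0 N) count_size.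
  rewrite -/nb lee_fin natrB// mulrBl NE => h.
  suff : 2 * pi - e <= 2 * pi - nb%:R * l by lra.
  apply: h => t [t2p /edist_lt[y Ky ye]].
  have [|k kN tk] := @arc_of R l t N0; first by rewrite NE.
  exists k => //; split => //; apply/negP => /asboolP[s [sk hs]].
  have st : `|g s - g t| < e.
    by apply: hrho; [exact: in2pi kN sk|exact: le_lt_trans (arcs k s t sk tk) lrho].
  have := hs y Ky; have := ler_distD (g t) (g s) y; have := norm_le_enorm (g t - y); lra.
pose a k : C := (1 + l)%:C%C * expi (k%:R * l).
have ca k : cmod (a k) = 1 + l by rewrite cmodM cmod_expi cmod_real mulr1 gtr0_norm// addr_gt0.
have a1 k : 1 < cmod (a k) by rewrite ca ltrDl.
(* By [pois_arc] the coefficient c lifts each bump to at least M - b on its arc. At the centre every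
   kernel equals 1, so the bumps add up to (M - b) * 9 / 2 times the total length of the bad
   arcs. *)
pose s := [seq k <- iota 0 N | bad k]; pose c := (M - b) * (9 * l / 2).
have c0 : 0 <= c.
  by rewrite mulr_ge0 ?subr_ge0// divr_ge0// mulr_ge0// ltW.
pose H z := b + c * \sum_(k <- s) pois (a k) z.
have H0 : H (0, 0) <= b + (M - b) * (9 / 2 * e).
  rewrite /H lerD2l (eq_bigr (fun=> 1)); last first.
    by move=> k _; rewrite pois0// -cmod_eq0 gt_eqF// (lt_trans ltr01).
  rewrite big_const_seq count_predT size_filter -/nb iter_addr_0.
  have -> : c * (1 *+ nb) = (M - b) * (9 / 2 * (nb%:R * l)) by rewrite /c; field.
  by rewrite ler_wpM2l ?subr_ge0// ler_wpM2l// divr_ge0.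
apply: (@le_trans _ _ (H (0, 0))%:E); last by rewrite lee_fin.
apply: (psh_max_disc pu cf).
- move=> z Dz; apply: cvgD; first exact: cvg_cst.
  apply: cvgM; first exact: cvg_cst.
  apply: cvg_big => [|k _]; first exact: add_continuous.
  by apply: continuous_pois; exact: pole_neq.
- move=> z Dz; have Dz1 := subset_unit_disc Dz.
  have hAB k : exists AB : R * R, tay (polar_shift (pois (a k)) z) (pois (a k) z) AB.1 AB.2 0.
    by have [A [B h]] := tay_pois (pole_neq (a1 k) Dz1); exists (A, B).
  have [AB hABk] := choice hAB.
  have := tayD (tay_cst b) (tayZ c (@tay_sum R _ s _ _ _ _ _ hABk)).
  rewrite big1_eq mulr0 addr0 => h; eexists; eexists; exact: h.
move=> z z1; have [t t2p zt] : exists2 t, 0 <= t <= 2 * pi & z = (cos t, sin t).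
  have [|t t2p tz] := @expi_surj R (toC z); last first.
    by exists t => //; case: z tz {z1} => x y [-> ->].
  by rewrite cmodE /= z1 sqrtr1.
have Dz : D1 z by rewrite /closed_unit_disc /= z1.
have gE : f z = g t by rewrite /g /circle_pt /= !add0r !mul1r zt.
have [|k kN tk] := @arc_of R l t N0; first by rewrite NE.
have [bk|bk] := boolP (bad k); last first.
  have [y Ky ty] : exists2 y, K y & `|g t - y| < 2 * e.
    apply: contrapT => hn; move/negP: bk; apply; apply/asboolP; exists t; split => // y Ky.
    by rewrite leNgt; apply/negP => h; apply: hn; exists y.
  rewrite gE; apply: (le_trans (uK _ _ Ky ty)); rewrite lee_fin lerDl mulr_ge0//.
  by apply: sumr_ge0 => i _; exact: pois_ge0.
apply: (@le_trans _ _ M%:E); first by apply: uM; apply: fom; exists z.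
rewrite lee_fin -lerBlDl /H.
have ks : k \in s by rewrite mem_filter bk mem_iota.
rewrite (big_rem k ks) /= mulrDr.
have P1 : M - b <= c * pois (a k) z.
  rewrite /c -mulrA -[leLHS]mulr1 ler_wpM2l ?subr_ge0// zt.
  apply: pois_arc; first by rewrite l0.
  by apply: (arcs k) => //; rewrite lexx -natr1 mulrDl mul1r lerDl ltW.
apply: (le_trans P1); rewrite lerDl mulr_ge0//.
by apply: sumr_ge0 => i _; exact: pois_ge0.
Qed.

End BadArcs.

(** * The two implications *)

Section MinimalHull.
Context {R : realType}.
Notation mu := (@lebesgue_measure R).

Lemma discs_hull n (K omega : set 'rV[R]_n) (p : 'rV[R]_n) (f : nat -> R * R -> 'rV[R]_n) :
  compact K -> bounded_set omega -> omega p ->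
  (forall j : nat, (0 < j)%N -> [/\ conformal_minimal_disc omega (f j), f j (0, 0) = p &
     ((2 * pi - j%:R^-1)%:E <= mu [set t : R | (0 <= t <= 2 * pi)%R /\
        (edist_set (f j (circle_pt (0%R, 0%R) 1 t)) K < (j%:R^-1)%:E)%E])%E]) ->
  minimal_hull K p.
Proof.
move=> cK [r [_ hr]] op hf u pu; rewrite leNgt; apply/negP.
(* Two levels between the supremum over K and u p: u stays below b near K, and b' - b is the room
   for the bad arcs. *)
move=> /ereal_between[b /andP[Kb bp]]; have [b' /andP[bb' b'p]] := ereal_between bp.
rewrite lte_fin in bb'.
pose O := [set x | (u x < b%:E)%E].
have oO : open O by rewrite openE => x Ox; exact: (usc_at pu Ox).
have KO : K `<=` O.
  by move=> x Kx; apply: le_lt_trans Kb; apply: ereal_sup_ubound; exists x.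
have [rho rho0 hrho] := compact_margin cK oO KO.
pose BB : set 'rV[R]_n := [set x | `|x| <= r + 1].
have oB : omega `<=` BB by apply: hr; rewrite ltrDl.
have cB : compact BB by exact: compact_norm_le.
have [|xm _ hxm] := usc_max cB _ (fun x _ c ux => usc_at pu ux); first by exists p; exact: oB.
have [Mu /andP[uMu _]] := ereal_between (psh_ltry xm pu).
pose M := Num.max b Mu.
have uM x : omega x -> (u x <= M%:E)%E.
  move=> /oB/hxm h; apply: (le_trans h); apply: (le_trans (ltW uMu)).
  by rewrite lee_fin le_max lexx orbT.
have bM : b <= M by rewrite le_max lexx.
have A0 : 0 <= (M - b) * (9 / 2) by rewrite mulr_ge0 ?subr_ge0// divr_ge0.
have [d d0 hd] : exists2 d : R, 0 < d & (M - b) * (9 / 2) * d <= b' - b.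
  by apply: pos_small; rewrite ?subr_gt0.
have [j j0 hj] := exists_nat_gt (2 / rho + d^-1).
have jR : 0 < j%:R :> R by rewrite ltr0n.
have q1 : 0 < 2 / rho by rewrite divr_gt0.
have q2 : 0 < d^-1 by rewrite invr_gt0.
have jd : j%:R^-1 <= d.
  by rewrite -[leRHS]invrK lef_pV2 ?posrE// (le_trans _ (ltW hj))// lerDr ltW.
have jrho : 2 * j%:R^-1 <= rho.
  by rewrite ler_pdivrMr// (mulrC rho) -ler_pdivrMr// (le_trans _ (ltW hj))// lerDl ltW.
have [cf f0 mf] := hf j j0; have e0 : 0 < j%:R^-1 :> R by rewrite invr_gt0.
have uK x y : K y -> `|x - y| < 2 * j%:R^-1 -> (u x <= b%:E)%E.
  move=> Ky xy; apply: ltW; apply: (hrho y x Ky).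
  by rewrite distrC (lt_le_trans xy).
have := disc_estimate pu cf uM bM e0 uK mf; rewrite f0 leNgt => /negP; apply.
apply: le_lt_trans b'p; rewrite lee_fin -lerBrDl; apply: le_trans hd.
by rewrite mulrA ler_wpM2l.
Qed.

Lemma hull_disc (K omega : set 'rV[R]_3) (p : 'rV[R]_3) (j : nat) :
  compact K -> bounded_set omega -> open omega -> convex_set omega ->
  K `<=` omega -> omega p -> minimal_hull K p -> (0 < j)%N ->
  exists f, [/\ conformal_minimal_disc omega f, f (0, 0) = p &
     ((2 * pi - j%:R^-1)%:E <= mu [set t : R | (0 <= t <= 2 * pi)%R /\
        (edist_set (f (circle_pt (0%R, 0%R) 1 t)) K < (j%:R^-1)%:E)%E])%E].
Proof.
move=> cK bo oo co Ko op hp j0; pose e : R := j%:R^-1.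
have e0 : 0 < e by rewrite invr_gt0 ltr0n.
(* Halving e pays for passing from the sup norm distance to the Euclidean one. *)
have e20 : 0 < e / 2 by rewrite divr_gt0.
have K0 := hull_neq0 hp.
have [s [adm ns ms]] := hull_discs cK bo oo co Ko op hp e20.
exists (fun z => disc p s (toC z)); split; first exact: disc_conformal_minimal.
  exact: disc0.
have tE t : toC (circle_pt (0, 0) 1 t) = expi t.
  by apply: complex_eq; rewrite /= add0r mul1r.
have cg : continuous (fun t => disc p s (toC (circle_pt (0, 0) 1 t))).
  move=> t; have -> : (fun t => disc p s (toC (circle_pt (0, 0) 1 t))) = (fun t => disc p s (expi t)).
    by apply/funext => x; rewrite tE.
  exact: continuous_disc.
apply: (@le_trans _ _ (2 * pi - e / 2)%:E).
  by rewrite lee_fin lerD2l lerN2 ler_pdivrMr// ler_pMr// ler1n.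
apply: (le_trans ms); apply: le_measure; rewrite ?inE.
- apply: measurableI; first exact: measurable_itv.
  apply: open_measurable.
  have -> : [set t | (dist K (disc p s (expi t)) < e / 2)%R] =
    (fun t => dist K (disc p s (expi t))) @^-1` [set r | r < e / 2] by [].
  apply: open_comp; last exact: open_lt.
  move=> t _; have cd : continuous (dist K).
    by apply: (@lipschitz_continuous _ _ _ _ 1) => x y; rewrite mul1r dist_lip.
  exact: (@continuous_comp _ _ _ _ (dist K) t (@continuous_disc _ p s t) (cd _)).
- exact: measurable_edist.
- move=> t [/=]; rewrite in_itv /= => t2 dt; split=> //; apply/edist_lt; rewrite tE.
  have h0 : 0 < e / 2 - dist K (disc p s (expi t)) by rewrite subr_gt0.
  have [y Ky hy] := dist_approx (disc p s (expi t)) K0 h0; exists y => //.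
  apply: (le_lt_trans (enorm_le_norm _)); move: hy; rewrite (addrC (dist _ _)) subrK => hy.
  by rewrite mulrC -ltr_pdivlMr.
Qed.

End MinimalHull.

Theorem theorem1p3 (R : realType) (K omega : set 'rV[R]_3)
    (compactK : compact K)
    (bounded_omega : bounded_set omega)
    (open_omega : open omega)
    (convex_omega : convex_set omega)
    (sub_K_omega : K `<=` omega)
    (p : 'rV[R]_3) (omega_p : omega p) :
  minimal_hull K p <->
  exists f : nat -> R * R -> 'rV[R]_3,
    forall j : nat, (0 < j)%N ->
      [/\ conformal_minimal_disc omega (f j),
          f j (0, 0) = p &
          ((2 * pi - j%:R^-1)%:E <=
             lebesgue_measure
               [set t : R | (0 <= t <= 2 * pi)%R /\
                 edist_set (f j (circle_pt (0%R, 0%R) 1 t)) K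
                   < (j%:R^-1)%:E])%E].
Proof.
split=> [hp|[f hf]]; last exact: discs_hull compactK bounded_omega omega_p hf.
have h j : exists fj, (0 < j)%N -> [/\ conformal_minimal_disc omega fj, fj (0, 0) = p &
    ((2 * pi - j%:R^-1)%:E <= lebesgue_measure [set t : R | (0 <= t <= 2 * pi)%R /\
      edist_set (fj (circle_pt (0%R, 0%R) 1 t)) K < (j%:R^-1)%:E])%E].
  (* Index 0 carries no condition, so a constant map fills it before the choice. *)
  have [j0|j0] := boolP (0 < j)%N; last by exists (fun=> p).
  have [fj hj] := hull_disc compactK bounded_omega open_omega convex_omega
    sub_K_omega omega_p hp j0.
  by exists fj.
by have [f hf] := choice h; exists f.
Qed.
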